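(* Let $\mathcal T$ be the flat topology on $\mathbf{Aff}$, and let $\Phi:(X_0,X_1)\to(Y_0,Y_1)$ be an internal equivalence (with respect to $\mathcal T$) of presheaves of groupoids on $\mathbf{Aff}_{\mathcal T}$. Then the functor $\Phi^*:\mathbf{Sh}^{\mathrm{qc}}_{(Y_0,Y_1)}\to\mathbf{Sh}^{\mathrm{qc}}_{(X_0,X_1)}$ on categories of quasi-coherent sheaves is an equivalence of categories.
   Context: All rings are commutative with unit and of cardinality less than a fixed infinite cardinal $\kappa$; $\mathbf{Rings}$ is the category of such rings and $\mathbf{Aff}$ its opposite (regarded as a small category). In the flat (fpqc) topology on $\mathbf{Aff}$, a cover of $R$ is a finite family of ring maps $\{R\to S_i\}$ with each $S_i$ flat over $R$ and $\prod_iS_i$ faithfully flat over $R$. A presheaf of groupoids is a functor $(X_0,X_1)$ from $\mathbf{Rings}$ to small groupoids, $X_0(R)$ being the objects and $X_1(R)$ the morphisms, with natural maps $\operatorname{dom},\operatorname{codom}:X_1\to X_0$. A map of presheaves of groupoids is a natural transformation. A point of a functor $X:\mathbf{Rings}\to\mathbf{Set}$ is a pair $(R,x)$ with $x\in X(R)$; a map of points $(R,x)\to(S,y)$ is a ring map $f:R\to S$ with $X(f)(x)=y$. A quasi-coherent sheaf over $X$ is a functorial assignment to each point $(R,x)$ of an $R$-module $M_x$, and to each map of points $f:(R,x)\to(S,y)$ of an $R$-linear map $M_x\to M_y$, such that the adjoint map $S\otimes_RM_x\to M_y$ is an isomorphism for every $f$. Maps are families of $R$-linear maps $M_x\to N_x$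 natural in $(R,x)$. A quasi-coherent sheaf over $(X_0,X_1)$ is a quasi-coherent sheaf $M$ over $X_0$ with $R$-linear isomorphisms $\psi_\alpha:M_{\operatorname{dom}\alpha}\to M_{\operatorname{codom}\alpha}$, natural in the points $(R,\alpha)$ of $X_1$, satisfying $\psi_{\beta\alpha}=\psi_\beta\psi_\alpha$ for composable $\beta,\alpha$. A map $\tau:M\to N$ is a map over $X_0$ with $\tau_{\operatorname{codom}\alpha}\psi^M_\alpha=\psi^N_\alpha\tau_{\operatorname{dom}\alpha}$ for all $\alpha$. This is the category $\mathbf{Sh}^{\mathrm{qc}}_{(X_0,X_1)}$. A map $\Phi:(X_0,X_1)\to(Y_0,Y_1)$ induces the functor $\Phi^*$ with $(\Phi^*M)_x=M_{\Phi x}$ and $\psi^{\Phi^*M}_\alpha=\psi^M_{\Phi\alpha}$. The essential image of $\Phi$ consists of the points $(R,y)$ of $Y_0$ for which there are $x\in X_0(R)$ and a morphism $\Phi x\to y$ in $Y_1(R)$. The sheaf-theoretic essential image consists of the points $(R,y)$ of $Y_0$ for which there is a $\mathcal T$-cover $\{f_i:R\to S_i\}$ with each $Y_0(f_i)(y)$ in the essential image. $\Phi$ is an internal equivalence if $\Phi(R)$ is full and faithful for all $R$ and the sheaf-theoretic essential image of $\Phi$ is all of $Y_0$. *)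

(* Defs.v *)
From HB Require Import structures.
From mathcomp Require Import all_boot all_algebra generic_quotient.
From mathcomp Require Import boolp classical_sets cardinality.

Set Implicit Arguments.
Unset Strict Implicit.
Unset Printing Implicit Defensive.
#[local] Obligation Tactic := idtac.

Import GRing.Theory.
Local Open Scope quotient_scope.
Local Open Scope ring_scope.

Section Basechange.
Variables (R S : comPzRingType) (f : {rmorphism R -> S}) (M : lmodType R).

(* [:: (s1, m1); ...; (sk, mk)] stands for the formal sum of the si (x) mi,
   S being an R-module through f.  Opposites need no generator: the opposite of
   s (x) m is (- s) (x) m. *)
Inductive tensor_eqv : seq (S * M) -> seq (S * M) -> Prop :=
| tensor_refl l : tensor_eqv l l
| tensor_sym l1 l2 : tensor_eqv l1 l2 -> tensor_eqv l2 l1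
| tensor_trans l1 l2 l3 :
    tensor_eqv l1 l2 -> tensor_eqv l2 l3 -> tensor_eqv l1 l3
| tensor_cat k1 k2 l1 l2 :
    tensor_eqv k1 l1 -> tensor_eqv k2 l2 -> tensor_eqv (k1 ++ k2) (l1 ++ l2)
| tensor_catC l1 l2 : tensor_eqv (l1 ++ l2) (l2 ++ l1)
| tensor_0l m : tensor_eqv [:: (0, m)] [::]
| tensor_Dl s t m : tensor_eqv [:: (s + t, m)] [:: (s, m); (t, m)]
| tensor_Dr s m n : tensor_eqv [:: (s, m + n)] [:: (s, m); (s, n)]
| tensor_bal s r m : tensor_eqv [:: (s * f r, m)] [:: (s, r *: m)].

Definition tensor_eqvb (l1 l2 : seq (S * M)) : bool := `[< tensor_eqv l1 l2 >].

Lemma tensor_eqvb_refl : reflexive tensor_eqvb.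
Proof. by move=> l; apply/asboolP; apply: tensor_refl. Qed.

Lemma tensor_eqvb_sym : symmetric tensor_eqvb.
Proof.
by move=> l1 l2; apply/asboolP/asboolP; apply: tensor_sym.
Qed.

Lemma tensor_eqvb_trans : transitive tensor_eqvb.
Proof.
move=> l2 l1 l3 /asboolP h1 /asboolP h2; apply/asboolP.
exact: tensor_trans h1 h2.
Qed.

Canonical tensor_equiv :=
  EquivRel tensor_eqvb tensor_eqvb_refl tensor_eqvb_sym tensor_eqvb_trans.

(* S (x)_R M *)
Definition basechange : Type := {eq_quot tensor_equiv}.

HB.instance Definition _ := Choice.on basechange.

Definition tclass (l : seq (S * M)) : basechange :=
  \pi_{eq_quot tensor_equiv} l.
Definition trepr (x : basechange) : seq (S * M) :=
  repr (x : {eq_quot tensor_equiv}).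

Definition tensor (s : S) (m : M) : basechange := tclass [:: (s, m)].

Lemma treprK : cancel trepr tclass.
Proof. by move=> x; rewrite /tclass /trepr reprK. Qed.

Lemma tclassP l1 l2 : tclass l1 = tclass l2 <-> tensor_eqv l1 l2.
Proof.
split=> [/eqmodP /asboolP //|h]; apply/eqmodP; exact/asboolP.
Qed.

Lemma trepr_tclass l : tensor_eqv (trepr (tclass l)) l.
Proof. by apply/tclassP; rewrite treprK. Qed.

Definition tadd (x y : basechange) : basechange := tclass (trepr x ++ trepr y).
Definition tscale (a : S) (x : basechange) : basechange :=
  tclass [seq (a * p.1, p.2) | p <- trepr x].

Lemma tscale_eqv a l1 l2 : tensor_eqv l1 l2 ->
  tensor_eqv [seq (a * p.1, p.2) | p <- l1] [seq (a * p.1, p.2) | p <- l2].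
Proof.
elim=> {l1 l2} /=.
- by move=> l; apply: tensor_refl.
- by move=> l1 l2 _; apply: tensor_sym.
- by move=> l1 l2 l3 _ h1 _ h2; apply: tensor_trans h1 h2.
- by move=> k1 k2 l1 l2 _ h1 _ h2; rewrite !map_cat; apply: tensor_cat.
- by move=> l1 l2; rewrite !map_cat; apply: tensor_catC.
- by move=> m; rewrite mulr0; apply: tensor_0l.
- by move=> s t m; rewrite mulrDr; apply: tensor_Dl.
- by move=> s m n; apply: tensor_Dr.
- by move=> s r m; rewrite mulrA; apply: tensor_bal.
Qed.

Lemma tadd_class l1 l2 : tadd (tclass l1) (tclass l2) = tclass (l1 ++ l2).
Proof. by apply/tclassP; apply: tensor_cat; apply: trepr_tclass. Qed.

Lemma tscale_class a l :
  tscale a (tclass l) = tclass [seq (a * p.1, p.2) | p <- l].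
Proof. by apply/tclassP; apply: tscale_eqv; apply: trepr_tclass. Qed.

Lemma taddA : associative tadd.
Proof.
move=> x y z; rewrite -[x]treprK -[y]treprK -[z]treprK.
by rewrite !tadd_class catA.
Qed.

Lemma taddC : commutative tadd.
Proof. by move=> x y; apply/tclassP; apply: tensor_catC. Qed.

Lemma tadd0 : left_id (tclass [::]) tadd.
Proof. by move=> x; rewrite -[x]treprK tadd_class. Qed.

Lemma tscaleDl x : {morph tscale^~ x : a b / a + b >-> tadd a b}.
Proof.
move=> a b; rewrite /= -[x]treprK !tscale_class tadd_class; apply/tclassP.
elim: (trepr x) => [|[s m] l IHl] /=; first exact: tensor_refl.
rewrite mulrDl.
apply: (@tensor_trans _ ([:: (a * s, m); (b * s, m)] ++
    ([seq (a * p.1, p.2) | p <- l] ++ [seq (b * p.1, p.2) | p <- l]))).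
  by rewrite -cat1s; apply: tensor_cat => //; apply: tensor_Dl.
rewrite -[_ :: _ in X in tensor_eqv _ X]cat1s.
rewrite -(cat1s (a * s, m) [:: _]) -catA; apply: tensor_cat.
  exact: tensor_refl.
rewrite -(cat1s (b * s, m) (map _ l)) !catA.
by apply: tensor_cat; [apply: tensor_catC | apply: tensor_refl].
Qed.

Lemma tscale0 x : tscale 0 x = tclass [::].
Proof.
rewrite -[x]treprK tscale_class; apply/tclassP.
elim: (trepr x) => [|[s m] l IHl] /=; first exact: tensor_refl.
rewrite mul0r -cat1s -[X in tensor_eqv _ X](cat0s [::]).
by apply: tensor_cat => //; apply: tensor_0l.
Qed.

Lemma tscale1 : left_id 1 tscale.
Proof.
move=> x; rewrite -[x]treprK tscale_class; congr tclass.
by rewrite -[RHS]map_id; apply: eq_map => -[s m] /=; rewrite mul1r.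
Qed.

Lemma tscaleA a b x : tscale a (tscale b x) = tscale (a * b) x.
Proof.
rewrite -[x]treprK !tscale_class -map_comp; congr tclass.
by apply: eq_map => -[s m] /=; rewrite mulrA.
Qed.

Lemma tscaleDr : right_distributive tscale tadd.
Proof.
move=> a x y; rewrite -[x]treprK -[y]treprK.
by rewrite !(tscale_class, tadd_class) map_cat.
Qed.

Lemma taddN : left_inverse (tclass [::]) (tscale (-1)) tadd.
Proof. by move=> x; rewrite -{2}[x]tscale1 -tscaleDl addNr tscale0. Qed.

HB.instance Definition _ :=
  GRing.isZmodule.Build basechange taddA taddC tadd0 taddN.

HB.instance Definition _ :=
  GRing.Zmodule_isLmodule.Build S basechange tscaleA tscale1 tscaleDr tscaleDl.

Lemma tclassD l1 l2 : tclass l1 + tclass l2 = tclass (l1 ++ l2).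
Proof. exact: tadd_class. Qed.

Lemma tclassZ a l : a *: tclass l = tclass [seq (a * p.1, p.2) | p <- l].
Proof. exact: tscale_class. Qed.

Lemma tclass_sum l : tclass l = \sum_(p <- l) tensor p.1 p.2.
Proof.
elim: l => [|[s m] l IHl]; first by rewrite big_nil.
by rewrite big_cons -IHl /= -cat1s -tclassD.
Qed.

End Basechange.

Arguments tensor {R S} f {M} s m.

Section Adjoint.
Variables (R S : comPzRingType) (f : {rmorphism R -> S}).
Variables (M : lmodType R) (N : lmodType S).
Variable phi : {linear M -> N | f \; *:%R}.

(* The S-linear map S (x)_R M -> N adjoint to the R-linear map phi : M -> N,
   where N is an R-module through f. *)
Definition adjoint (x : basechange f M) : N :=
  \sum_(p <- trepr x) p.1 *: phi p.2.

Lemma adjoint_eqv l1 l2 : tensor_eqv f l1 l2 ->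
  \sum_(p <- l1) p.1 *: phi p.2 = \sum_(p <- l2) p.1 *: phi p.2.
Proof.
elim=> {l1 l2} //.
- by move=> l1 l2 l3 _ -> _ ->.
- by move=> k1 k2 l1 l2 _ h1 _ h2; rewrite !big_cat /= h1 h2.
- by move=> l1 l2; rewrite !big_cat /= addrC.
- by move=> m; rewrite big_seq1 big_nil scale0r.
- by move=> s t m; rewrite !big_cons !big_nil /= !addr0 scalerDl.
- by move=> s m n; rewrite !big_cons !big_nil /= !addr0 linearD scalerDr.
- by move=> s r m; rewrite !big_seq1 /= linearZ /= scalerA.
Qed.

Lemma adjoint_class l : adjoint (tclass f l) = \sum_(p <- l) p.1 *: phi p.2.
Proof. exact/adjoint_eqv/trepr_tclass. Qed.

Lemma adjoint_is_linear : linear adjoint.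
Proof.
move=> a x y; rewrite -[x]treprK -[y]treprK.
rewrite tclassZ tclassD !adjoint_class big_cat /=.
congr (_ + _); rewrite big_map scaler_sumr; apply: eq_bigr => p _.
by rewrite scalerA.
Qed.

HB.instance Definition _ :=
  GRing.isLinear.Build S (basechange f M) N _ adjoint adjoint_is_linear.

Lemma adjoint_tensor s m : adjoint (tensor f s m) = s *: phi m.
Proof. by rewrite adjoint_class big_seq1. Qed.

End Adjoint.

Section BasechangeMap.
Variables (R S : comPzRingType) (f : {rmorphism R -> S}).
Variables (M N : lmodType R) (h : {linear M -> N}).

Definition basechange_map (x : basechange f M) : basechange f N :=
  tclass f [seq (p.1, h p.2) | p <- trepr x].

Lemma basechange_map_eqv l1 l2 : tensor_eqv f l1 l2 ->
  tensor_eqv f [seq (p.1, h p.2) | p <- l1] [seq (p.1, h p.2) | p <- l2].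
Proof.
elim=> {l1 l2} /=.
- by move=> l; apply: tensor_refl.
- by move=> l1 l2 _; apply: tensor_sym.
- by move=> l1 l2 l3 _ h1 _ h2; apply: tensor_trans h1 h2.
- by move=> k1 k2 l1 l2 _ h1 _ h2; rewrite !map_cat; apply: tensor_cat.
- by move=> l1 l2; rewrite !map_cat; apply: tensor_catC.
- by move=> m; apply: tensor_0l.
- by move=> s t m; apply: tensor_Dl.
- by move=> s m n; rewrite linearD; apply: tensor_Dr.
- by move=> s r m; rewrite linearZ; apply: tensor_bal.
Qed.

Lemma basechange_map_class l :
  basechange_map (tclass f l) = tclass f [seq (p.1, h p.2) | p <- l].
Proof. exact/tclassP/basechange_map_eqv/trepr_tclass. Qed.

Lemma basechange_map_is_linear : linear basechange_map.
Proof.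
move=> a x y; rewrite -[x]treprK -[y]treprK.
rewrite tclassZ tclassD !basechange_map_class tclassZ tclassD map_cat -!map_comp.
by congr (tclass f (_ ++ _)); apply: eq_map.
Qed.

HB.instance Definition _ :=
  GRing.isLinear.Build S (basechange f M) (basechange f N) _
    basechange_map basechange_map_is_linear.

Lemma basechange_map_tensor s m :
  basechange_map (tensor f s m) = tensor f s (h m).
Proof. exact: basechange_map_class. Qed.

End BasechangeMap.

Arguments basechange_map {R S} f {M N} h x.

Definition exact_at (R : comPzRingType) (M1 M2 M3 : lmodType R)
    (g : M1 -> M2) (h : M2 -> M3) : Prop :=
  forall y, h y = 0 <-> exists x, g x = y.

Definition flat (R S : comPzRingType) (f : {rmorphism R -> S}) : Prop :=
  forall (M1 M2 M3 : lmodType R) (g : {linear M1 -> M2}) (h : {linear M2 -> M3}),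
    exact_at g h -> exact_at (basechange_map f g) (basechange_map f h).

Definition faithfully_flat (R S : comPzRingType) (f : {rmorphism R -> S}) :
    Prop :=
  forall (M1 M2 M3 : lmodType R) (g : {linear M1 -> M2}) (h : {linear M2 -> M3}),
    exact_at g h <-> exact_at (basechange_map f g) (basechange_map f h).

(* The zero ring is allowed (hence comPzRingType), in particular as the empty
   product. *)
Section ProductRing.
Variables (n : nat) (S : 'I_n -> comPzRingType).

Definition product_ring : Type := forall i, S i.

HB.instance Definition _ := gen_eqMixin product_ring.
HB.instance Definition _ := gen_choiceMixin product_ring.

Implicit Types x y z : product_ring.

Let pzero : product_ring := fun i => 0.
Let pone : product_ring := fun i => 1.
Let popp x : product_ring := fun i => - x i.
Let padd x y : product_ring := fun i => x i + y i.
Let pmul x y : product_ring := fun i => x i * y i.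

Lemma product_addA : associative padd.
Proof. by move=> x y z; apply/functional_extensionality_dep => i; apply: addrA. Qed.
Lemma product_addC : commutative padd.
Proof. by move=> x y; apply/functional_extensionality_dep => i; apply: addrC. Qed.
Lemma product_add0 : left_id pzero padd.
Proof. by move=> x; apply/functional_extensionality_dep => i; apply: add0r. Qed.
Lemma product_addN : left_inverse pzero popp padd.
Proof. by move=> x; apply/functional_extensionality_dep => i; apply: addNr. Qed.

HB.instance Definition _ := GRing.isZmodule.Build product_ring
  product_addA product_addC product_add0 product_addN.

Lemma product_mulA : associative pmul.
Proof. by move=> x y z; apply/functional_extensionality_dep => i; apply: mulrA. Qed.
Lemma product_mulC : commutative pmul.
Proof. by move=> x y; apply/functional_extensionality_dep => i; apply: mulrC. Qed.
Lemma product_mul1 : left_id pone pmul.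
Proof. by move=> x; apply/functional_extensionality_dep => i; apply: mul1r. Qed.
Lemma product_mulDl : left_distributive pmul +%R.
Proof. by move=> x y z; apply/functional_extensionality_dep => i; apply: mulrDl. Qed.

HB.instance Definition _ := GRing.Zmodule_isComPzRing.Build product_ring
  product_mulA product_mulC product_mul1 product_mulDl.

Variables (R : comPzRingType) (f : forall i, {rmorphism R -> S i}).

Definition product_map (r : R) : product_ring := fun i => f i r.

Lemma product_map_is_zmod_morphism : zmod_morphism product_map.
Proof. by move=> x y; apply/functional_extensionality_dep => i; apply: rmorphB. Qed.

Lemma product_map_is_monoid_morphism : monoid_morphism product_map.
Proof.
split; first by apply/functional_extensionality_dep => i; apply: rmorph1.
by move=> x y; apply/functional_extensionality_dep => i; apply: rmorphM.
Qed.

HB.instance Definition _ := GRing.isZmodMorphism.Build R product_ring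
  product_map product_map_is_zmod_morphism.
HB.instance Definition _ := GRing.isMonoidMorphism.Build R product_ring
  product_map product_map_is_monoid_morphism.

End ProductRing.

Record category := Category {
  cat_ob :> Type;
  cat_hom : cat_ob -> cat_ob -> Type;
  cat_id : forall x, cat_hom x x;
  cat_comp : forall x y z, cat_hom y z -> cat_hom x y -> cat_hom x z;
  cat_compid : forall x y (u : cat_hom x y), cat_comp u (cat_id x) = u;
  cat_idcomp : forall x y (u : cat_hom x y), cat_comp (cat_id y) u = u;
  cat_compA : forall x y z t (w : cat_hom z t) (v : cat_hom y z)
      (u : cat_hom x y),
    cat_comp w (cat_comp v u) = cat_comp (cat_comp w v) u
}.

Record functor (C D : category) := Functor {
  fun_ob :> C -> D;
  fun_hom : forall x y, cat_hom x y -> cat_hom (fun_ob x) (fun_ob y);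
  fun_id : forall x, fun_hom (cat_id x) = cat_id (fun_ob x);
  fun_comp : forall x y z (v : cat_hom y z) (u : cat_hom x y),
    fun_hom (cat_comp v u) = cat_comp (fun_hom v) (fun_hom u)
}.

Definition id_functor (C : category) : functor C C :=
  @Functor C C (fun x => x) (fun _ _ u => u)
    (fun=> erefl) (fun _ _ _ _ _ => erefl).

Program Definition comp_functor (C D E : category) (G : functor D E)
    (F : functor C D) : functor C E :=
  @Functor C E (fun x => G (F x)) (fun _ _ u => fun_hom G (fun_hom F u)) _ _.
Next Obligation. by move=> *; rewrite /= !fun_id. Qed.
Next Obligation. by move=> *; rewrite /= !fun_comp. Qed.

Definition naturally_isomorphic (C D : category) (F G : functor C D) : Prop :=
  exists (t : forall x, cat_hom (F x) (G x)) (s : forall x, cat_hom (G x) (F x)),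
    [/\ forall x y (u : cat_hom x y),
          cat_comp (t y) (fun_hom F u) = cat_comp (fun_hom G u) (t x),
        forall x, cat_comp (s x) (t x) = cat_id (F x)
      & forall x, cat_comp (t x) (s x) = cat_id (G x)].

Definition equivalence_of_categories (C D : category) (F : functor C D) : Prop :=
  exists G : functor D C,
    naturally_isomorphic (comp_functor G F) (id_functor C) /\
    naturally_isomorphic (comp_functor F G) (id_functor D).

Record groupoid := Groupoid {
  gpd_ob : Type;
  gpd_ar : Type;
  gpd_dom : gpd_ar -> gpd_ob;
  gpd_cod : gpd_ar -> gpd_ob;
  gpd_id : gpd_ob -> gpd_ar;
  gpd_comp : forall b a, gpd_dom b = gpd_cod a -> gpd_ar;
  gpd_inv : gpd_ar -> gpd_ar;
  gpd_dom_id : forall x, gpd_dom (gpd_id x) = x;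
  gpd_cod_id : forall x, gpd_cod (gpd_id x) = x;
  gpd_dom_comp : forall b a (e : gpd_dom b = gpd_cod a),
    gpd_dom (gpd_comp e) = gpd_dom a;
  gpd_cod_comp : forall b a (e : gpd_dom b = gpd_cod a),
    gpd_cod (gpd_comp e) = gpd_cod b;
  gpd_dom_inv : forall a, gpd_dom (gpd_inv a) = gpd_cod a;
  gpd_cod_inv : forall a, gpd_cod (gpd_inv a) = gpd_dom a;
  gpd_compA : forall c b a (ecb : gpd_dom c = gpd_cod b)
      (eba : gpd_dom b = gpd_cod a)
      (e1 : gpd_dom c = gpd_cod (gpd_comp eba))
      (e2 : gpd_dom (gpd_comp ecb) = gpd_cod a),
    gpd_comp e1 = gpd_comp e2;
  gpd_compid : forall a x (e : gpd_dom a = gpd_cod (gpd_id x)), gpd_comp e = a;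
  gpd_idcomp : forall a x (e : gpd_dom (gpd_id x) = gpd_cod a), gpd_comp e = a;
  gpd_compV : forall a (e : gpd_dom a = gpd_cod (gpd_inv a)),
    gpd_comp e = gpd_id (gpd_cod a);
  gpd_Vcomp : forall a (e : gpd_dom (gpd_inv a) = gpd_cod a),
    gpd_comp e = gpd_id (gpd_dom a)
}.

Definition gpd_hom (G : groupoid) (a : gpd_ar G) (x y : gpd_ob G) : Prop :=
  gpd_dom a = x /\ gpd_cod a = y.

Record gpd_functor (G H : groupoid) := GpdFunctor {
  gf_ob : gpd_ob G -> gpd_ob H;
  gf_ar : gpd_ar G -> gpd_ar H;
  gf_dom : forall a, gpd_dom (gf_ar a) = gf_ob (gpd_dom a);
  gf_cod : forall a, gpd_cod (gf_ar a) = gf_ob (gpd_cod a);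
  gf_id : forall x, gf_ar (gpd_id x) = gpd_id (gf_ob x);
  gf_comp : forall b a (e : gpd_dom b = gpd_cod a)
      (e' : gpd_dom (gf_ar b) = gpd_cod (gf_ar a)),
    gf_ar (gpd_comp e) = gpd_comp e'
}.

Definition gpd_full (G H : groupoid) (F : gpd_functor G H) : Prop :=
  forall x y b, gpd_hom b (gf_ob F x) (gf_ob F y) ->
    exists2 a, gpd_hom a x y & gf_ar F a = b.

Definition gpd_faithful (G H : groupoid) (F : gpd_functor G H) : Prop :=
  forall x y a a', gpd_hom a x y -> gpd_hom a' x y ->
    gf_ar F a = gf_ar F a' -> a = a'.

(* The cardinal kappa is given by a type K of that cardinality; the two
   conditions together say that the cardinality of the ring is < kappa. *)
Record small_ring (K : Type) := SmallRing {
  small_ring_sort :> comPzRingType;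
  small_ring_card : ([set: small_ring_sort] #<= [set: K])%card /\
                    ~ ([set: K] #<= [set: small_ring_sort])%card
}.

Section Presheaves.
Variable K : Type.
Local Notation ring := (small_ring K).

Record presheaf := Presheaf {
  psh_ob :> ring -> Type;
  psh_map : forall R S : ring, {rmorphism R -> S} -> psh_ob R -> psh_ob S;
  psh_id : forall (R : ring) (x : psh_ob R),
    psh_map (idfun : {rmorphism R -> R}) x = x;
  psh_comp : forall (R S T : ring) (g : {rmorphism S -> T})
      (f : {rmorphism R -> S}) (x : psh_ob R),
    psh_map (g \o f : {rmorphism R -> T}) x = psh_map g (psh_map f x)
}.

Record gpd_presheaf := GpdPresheaf {
  gp_at :> ring -> groupoid;
  gp_map : forall R S : ring,
    {rmorphism R -> S} -> gpd_functor (gp_at R) (gp_at S);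
  gp_ob_id : forall (R : ring) x,
    gf_ob (gp_map (idfun : {rmorphism R -> R})) x = x;
  gp_ar_id : forall (R : ring) a,
    gf_ar (gp_map (idfun : {rmorphism R -> R})) a = a;
  gp_ob_comp : forall (R S T : ring) (g : {rmorphism S -> T})
      (f : {rmorphism R -> S}) x,
    gf_ob (gp_map (g \o f : {rmorphism R -> T})) x =
    gf_ob (gp_map g) (gf_ob (gp_map f) x);
  gp_ar_comp : forall (R S T : ring) (g : {rmorphism S -> T})
      (f : {rmorphism R -> S}) a,
    gf_ar (gp_map (g \o f : {rmorphism R -> T})) a =
    gf_ar (gp_map g) (gf_ar (gp_map f) a)
}.

Definition objects (X : gpd_presheaf) : presheaf :=
  @Presheaf (fun R => gpd_ob (X R)) (fun R S f => gf_ob (gp_map X f))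
    (@gp_ob_id X) (@gp_ob_comp X).

Definition arrows (X : gpd_presheaf) : presheaf :=
  @Presheaf (fun R => gpd_ar (X R)) (fun R S f => gf_ar (gp_map X f))
    (@gp_ar_id X) (@gp_ar_comp X).

Record gpd_presheaf_map (X Y : gpd_presheaf) := GpdPresheafMap {
  gpm_at :> forall R : ring, gpd_functor (X R) (Y R);
  gpm_ob_nat : forall (R S : ring) (f : {rmorphism R -> S}) (x : objects X R),
    gf_ob (gpm_at S) (psh_map f x) = psh_map f (gf_ob (gpm_at R) x : objects Y R);
  gpm_ar_nat : forall (R S : ring) (f : {rmorphism R -> S}) (a : arrows X R),
    gf_ar (gpm_at S) (psh_map f a) = psh_map f (gf_ar (gpm_at R) a : arrows Y R)
}.

Record family (R : ring) := Family {
  fam_size : nat;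
  fam_ring : 'I_fam_size -> ring;
  fam_map : forall i, {rmorphism R -> fam_ring i}
}.

Arguments fam_ring {R} f i.
Arguments fam_map {R} f i.

Definition flat_cover (R : ring) (U : family R) : Prop :=
  (forall i, flat (fam_map U i)) /\
  faithfully_flat (product_map (fam_map U) :
    {rmorphism R -> product_ring (fun i => fam_ring U i : comPzRingType)}).

Definition ess_image (X Y : gpd_presheaf) (Phi : gpd_presheaf_map X Y)
    (R : ring) (y : objects Y R) : Prop :=
  exists (x : objects X R) (b : arrows Y R), gpd_hom b (gf_ob (Phi R) x) y.

Definition sheaf_ess_image (covers : forall R : ring, family R -> Prop)
    (X Y : gpd_presheaf) (Phi : gpd_presheaf_map X Y)
    (R : ring) (y : objects Y R) : Prop :=
  exists2 U : family R, covers R U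
    & forall i, ess_image Phi (psh_map (fam_map U i) y).

Definition internal_equivalence (covers : forall R : ring, family R -> Prop)
    (X Y : gpd_presheaf) (Phi : gpd_presheaf_map X Y) : Prop :=
  [/\ forall R, gpd_full (Phi R),
      forall R, gpd_faithful (Phi R)
    & forall (R : ring) (y : objects Y R), sheaf_ess_image covers Phi y].

(* A map of points (R, x) -> (S, y) is a ring map f together with a proof of
   psh_map f x = y. *)
Record qcoh (X : presheaf) := Qcoh {
  qc_mod :> forall R : ring, X R -> lmodType R;
  qc_map : forall (R S : ring) (f : {rmorphism R -> S}) (x : X R) (y : X S),
    psh_map f x = y -> {linear qc_mod x -> qc_mod y | f \; *:%R};
  qc_map_id : forall (R : ring) (x : X R)
      (e : psh_map (idfun : {rmorphism R -> R}) x = x) m,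
    qc_map e m = m;
  qc_map_comp : forall (R S T : ring) (g : {rmorphism S -> T})
      (f : {rmorphism R -> S}) (x : X R) (y : X S) (z : X T)
      (ef : psh_map f x = y) (eg : psh_map g y = z)
      (egf : psh_map (g \o f : {rmorphism R -> T}) x = z) m,
    qc_map egf m = qc_map eg (qc_map ef m);
  qc_iso : forall (R S : ring) (f : {rmorphism R -> S}) (x : X R) (y : X S)
      (e : psh_map f x = y),
    bijective (adjoint (qc_map e))
}.

Record qcoh_map (X : presheaf) (M N : qcoh X) := QcohMap {
  qm_at :> forall (R : ring) (x : X R), {linear M R x -> N R x};
  qm_nat : forall (R S : ring) (f : {rmorphism R -> S}) (x : X R) (y : X S)
      (e : psh_map f x = y) m,
    qm_at y (qc_map M e m) = qc_map N e (qm_at x m)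
}.

(* psi_a is indexed by a : X_1(R) together with proofs that dom a = x and
   cod a = y, so that psi_(b a) = psi_b psi_a can be stated although
   dom (b a) = dom a and cod (b a) = cod b are not definitional. *)
Record gqcoh (X : gpd_presheaf) := Gqcoh {
  gq_qcoh :> qcoh (objects X);
  gq_psi : forall (R : ring) (a : arrows X R) (x y : objects X R),
    gpd_hom a x y -> {linear gq_qcoh R x -> gq_qcoh R y};
  gq_psi_bij : forall (R : ring) (a : arrows X R) (x y : objects X R)
      (h : gpd_hom a x y), bijective (gq_psi h);
  gq_psi_nat : forall (R S : ring) (f : {rmorphism R -> S})
      (a : arrows X R) (b : arrows X S) (x y : objects X R) (x' y' : objects X S)
      (ha : gpd_hom a x y) (hb : gpd_hom b x' y') (e : psh_map f a = b)
      (ex : psh_map f x = x') (ey : psh_map f y = y') m,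
    gq_psi hb (qc_map gq_qcoh ex m) = qc_map gq_qcoh ey (gq_psi ha m);
  gq_psi_comp : forall (R : ring) (b a : arrows X R) (x y z : objects X R)
      (ha : gpd_hom a x y) (hb : gpd_hom b y z) (e : gpd_dom b = gpd_cod a)
      (hc : gpd_hom (gpd_comp e) x z) m,
    gq_psi hc m = gq_psi hb (gq_psi ha m)
}.

Record gqcoh_map (X : gpd_presheaf) (M N : gqcoh X) := GqcohMap {
  gm_map :> qcoh_map M N;
  gm_psi : forall (R : ring) (a : arrows X R) (x y : objects X R)
      (h : gpd_hom a x y) m,
    gm_map R y (gq_psi M h m) = gq_psi N h (gm_map R x m)
}.

Lemma gqcoh_map_eq (X : gpd_presheaf) (M N : gqcoh X) (s t : gqcoh_map M N) :
  (forall (R : ring) (x : objects X R) m, s R x m = t R x m) -> s = t.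
Proof.
case: s t => [[s s1] s2] [[t t1] t2] /= st.
have est : s = t.
  apply/functional_extensionality_dep => R.
  apply/functional_extensionality_dep => x.
  move: (s R x) (t R x) (st R x) => u v uv.
  have /= : u = v :> (_ -> _) by apply/funext.
  case: u v {uv} => u [[u1] [u2]] [v [[v1] [v2]]] /= uv.
  by case: _ / uv in v1 v2 *; rewrite (Prop_irrelevance u1 v1) (Prop_irrelevance u2 v2).
case: _ / est in t1 t2 *.
rewrite (Prop_irrelevance t1 s1) in t2 *.
by rewrite (Prop_irrelevance t2 s2).
Qed.

Section ShQc.
Variable X : gpd_presheaf.

Definition gqcoh_id (M : gqcoh X) : gqcoh_map M M :=
  @GqcohMap X M M (@QcohMap _ M M (fun _ _ => idfun)
    (fun _ _ _ _ _ _ _ => erefl)) (fun _ _ _ _ _ _ => erefl).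

Program Definition gqcoh_comp (L M N : gqcoh X) (t : gqcoh_map M N)
    (s : gqcoh_map L M) : gqcoh_map L N :=
  @GqcohMap X L N (@QcohMap _ L N (fun R x => t R x \o s R x) _) _.
Next Obligation. by move=> *; rewrite /= !qm_nat. Qed.
Next Obligation. by move=> *; rewrite /= !gm_psi. Qed.

Program Definition ShQc : category :=
  @Category (gqcoh X) (@gqcoh_map X) gqcoh_id gqcoh_comp _ _ _.
Next Obligation. by move=> *; apply: gqcoh_map_eq. Qed.
Next Obligation. by move=> *; apply: gqcoh_map_eq. Qed.
Next Obligation. by move=> *; apply: gqcoh_map_eq. Qed.

End ShQc.

Section Pullback.
Variables (X Y : gpd_presheaf) (Phi : gpd_presheaf_map X Y).

Lemma gpm_point (R S : ring) (f : {rmorphism R -> S}) (x : objects X R)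
    (y : objects X S) : psh_map f x = y ->
  psh_map f (gf_ob (Phi R) x : objects Y R) = gf_ob (Phi S) y.
Proof. by move=> <-; rewrite gpm_ob_nat. Qed.

Lemma gpm_hom (R : ring) (a : arrows X R) (x y : objects X R) : gpd_hom a x y ->
  gpd_hom (gf_ar (Phi R) a) (gf_ob (Phi R) x) (gf_ob (Phi R) y).
Proof. by case=> <- <-; split; rewrite ?gf_dom ?gf_cod. Qed.

Program Definition pullback_qcoh (M : gqcoh Y) : qcoh (objects X) :=
  @Qcoh (objects X) (fun R x => M R (gf_ob (Phi R) x))
    (fun R S f x y e => qc_map M (gpm_point e)) _ _ _.
Next Obligation.
move=> M R x e m /=; move: (gpm_point e) => e'.
by rewrite qc_map_id.
Qed.
Next Obligation. by move=> *; apply: qc_map_comp. Qed.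
Next Obligation. by move=> *; apply: qc_iso. Qed.

Program Definition pullback_ob (M : gqcoh Y) : gqcoh X :=
  @Gqcoh X (pullback_qcoh M)
    (fun R a x y h => gq_psi M (gpm_hom h)) _ _ _.
Next Obligation. by move=> *; apply: gq_psi_bij. Qed.
Next Obligation.
move=> M R S f a b x y x' y' ha hb e ex ey m.
apply: (@gq_psi_nat _ M R S f (gf_ar (Phi R) a)).
by rewrite -e gpm_ar_nat.
Qed.
Next Obligation.
move=> M R b a x y z ha hb e hc m /=.
have e' : gpd_dom (gf_ar (Phi R) b) = gpd_cod (gf_ar (Phi R) a).
  by rewrite gf_dom gf_cod e.
move: (gpm_hom hc); rewrite (gf_comp _ e') => hc'.
exact: gq_psi_comp.
Qed.

Program Definition pullback_map (M N : gqcoh Y) (t : gqcoh_map M N) :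
    gqcoh_map (pullback_ob M) (pullback_ob N) :=
  @GqcohMap X (pullback_ob M) (pullback_ob N)
    (@QcohMap _ (pullback_ob M) (pullback_ob N)
      (fun R x => t R (gf_ob (Phi R) x)) _) _.
Next Obligation. by move=> M N t R S f x y e m; apply: (qm_nat t (gpm_point e)). Qed.
Next Obligation. by move=> M N t R a x y h m; apply: (gm_psi t (gpm_hom h)). Qed.

Program Definition pullback : functor (ShQc Y) (ShQc X) :=
  @Functor (ShQc Y) (ShQc X) pullback_ob pullback_map _ _.
Next Obligation. by move=> *; apply: gqcoh_map_eq. Qed.
Next Obligation. by move=> *; apply: gqcoh_map_eq. Qed.

End Pullback.

End Presheaves.

(* Main.v *)
(* Given N over X and a point (R, y) of Y_0, consider the charts of y: the
   R-algebras T together with x in X_0(T) and an arrow b : Phi x -> y over T.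
   As Phi is fully faithful, each map of R-algebras between two charts lifts to a
   unique arrow of X, so N assigns to every chart a T-module, compatibly with base
   change.  The sheaf-theoretic essential image condition provides charts c_i whose
   rings S_i cover R, and the value at y of the inverse functor is the kernel of
   prod N(c_i) -> prod N(c_i (x) c_j).  Base change along a flat R -> S_k turns this
   kernel into the corresponding one for the cover S_k (x) S_i of S_k, which splits,
   so it becomes N(c_k).  The same splitting, with faithful flatness, shows that N
   of an arbitrary chart is glued from N of its products with the c_i; hence the
   kernel is the module of compatible families over all charts, which makes it
   functorial in (R, y).  All rings involved stay small because a tensor product of
   two rings of cardinality < kappa has cardinality < kappa, which rests on
   A x A = A for infinite cardinals. *)
From HB Require Import structures.
Require Import Defs.
From mathcomp Require Import all_boot all_algebra.
From mathcomp Require Import boolp classical_sets functions cardinality.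

Set Implicit Arguments.
Unset Strict Implicit.
Unset Printing Implicit Defensive.

Import GRing.Theory.
Local Open Scope ring_scope.

(** * Tensor products and cartesian maps *)

(** Base change enters as a property and not as a construction: [cart f phi] says that the
    semilinear map [phi] exhibits its target as a base change of its source. The value of N at a
    chart over a tensor product is a base change only through the structure maps of N, so exactness,
    kernels and locality are all stated for arbitrary models of base change, and composites of such
    maps replace iterated tensor products. Maps stay bare functions, with additivity as a predicate,
    because the same function has to be read over several rings.

    The module at a point is chosen separately for each point, from a cover unrelated to those
    chosen elsewhere. Two such choices are related only through evaluation at charts: evaluations
    determine an element, and every compatible family of values is realised. Hence each structure
    map is defined by prescribing its evaluations, and each identity, functoriality included, is
    checked on evaluations, so the choices never have to be compared. *)

Definition addfun (V W : zmodType) (h : V -> W) : Prop :=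
  forall x y, h (x + y) = h x + h y.

Section Addf.
Variables (V W : zmodType) (h : V -> W).
Hypothesis hD : addfun h.

Lemma addf0 : h 0 = 0.
Proof. by apply: (addrI (h 0)); rewrite -hD !addr0. Qed.

Lemma addfN x : h (- x) = - h x.
Proof. by apply: (addrI (h x)); rewrite -hD !subrr addf0. Qed.

Lemma addfB x y : h (x - y) = h x - h y.
Proof. by rewrite hD addfN. Qed.

Lemma addf_sum I (r : seq I) (F : I -> V) :
  h (\sum_(i <- r) F i) = \sum_(i <- r) h (F i).
Proof.
elim: r => [|i r IHr]; first by rewrite !big_nil addf0.
by rewrite !big_cons hD IHr.
Qed.

Lemma addf_inj : (forall x, h x = 0 -> x = 0) -> injective h.
Proof.
move=> h0 x y exy; apply/eqP; rewrite -subr_eq0; apply/eqP/h0.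
by rewrite addfB exy subrr.
Qed.

End Addf.

Lemma addf_comp (U V W : zmodType) (h : V -> W) (k : U -> V) :
  addfun h -> addfun k -> addfun (fun x => h (k x)).
Proof. by move=> hD kD x y; rewrite kD hD. Qed.

Lemma addf_id (V : zmodType) : addfun (fun x : V => x).
Proof. by []. Qed.

Lemma bij_inj_surj (A B : Type) (h : A -> B) :
  injective h -> (forall y, exists x, h x = y) -> bijective h.
Proof.
move=> hI hS; have [k kP] := choice hS.
by exists k => x; [apply: hI; rewrite kP | rewrite kP].
Qed.

Section TensorLift.
Variables (R S : comPzRingType) (f : {rmorphism R -> S}) (M : lmodType R).
Variable W : zmodType.

Lemma tensorDl (s t : S) (m : M) : tensor f (s + t) m = tensor f s m + tensor f t m.
Proof. by rewrite /tensor tclassD; apply/tclassP; apply: tensor_Dl. Qed.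

Lemma tensorDr (s : S) (m n : M) : tensor f s (m + n) = tensor f s m + tensor f s n.
Proof. by rewrite /tensor tclassD; apply/tclassP; apply: tensor_Dr. Qed.

Lemma tensorZr (s : S) r (m : M) : tensor f s (r *: m) = tensor f (s * f r) m.
Proof. by symmetry; apply/tclassP; apply: tensor_bal. Qed.

Lemma tensorZl (a s : S) (m : M) : a *: tensor f s m = tensor f (a * s) m.
Proof. exact: tclassZ. Qed.

Lemma tensorE (s : S) (m : M) : tensor f s m = s *: tensor f 1 m.
Proof. by rewrite tensorZl mulr1. Qed.

Lemma tensor_ind (P : basechange f M -> Prop) :
  P 0 -> (forall x y, P x -> P y -> P (x + y)) ->
  (forall s m, P (tensor f s m)) -> forall x, P x.
Proof.
move=> P0 PD Pt x; rewrite -[x]treprK tclass_sum.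
by elim: (trepr x) => [|p l IHl]; rewrite ?big_nil // big_cons; apply: PD.
Qed.

Lemma tensor_ext (h k : basechange f M -> W) : addfun h -> addfun k ->
  (forall s m, h (tensor f s m) = k (tensor f s m)) -> h =1 k.
Proof.
move=> hD kD hk; elim/tensor_ind => //; first by rewrite !addf0.
by move=> x y hx hy; rewrite hD kD hx hy.
Qed.

Definition balanced (beta : S -> M -> W) : Prop :=
  [/\ forall s t m, beta (s + t) m = beta s m + beta t m,
      forall s, addfun (beta s)
    & forall s r m, beta (s * f r) m = beta s (r *: m)].

(** The map out of the tensor product induced by [beta]. The sum runs over a chosen representative,
    and balancedness makes it independent of that choice. The target is only an abelian group, so
    that it may be a module over any ring. *)
Definition tlift (beta : S -> M -> W) (x : basechange f M) : W :=
  \sum_(p <- trepr x) beta p.1 p.2.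

Variable beta : S -> M -> W.
Hypothesis betaP : balanced beta.

Lemma tlift_class l : tlift beta (tclass f l) = \sum_(p <- l) beta p.1 p.2.
Proof.
case: betaP => bDl bDr bZ.
have b0 m : beta 0 m = 0.
  by apply: (addrI (beta 0 m)); rewrite -bDl !addr0.
suff eqv l1 l2 : tensor_eqv f l1 l2 ->
    \sum_(p <- l1) beta p.1 p.2 = \sum_(p <- l2) beta p.1 p.2.
  exact/eqv/trepr_tclass.
elim=> {l l1 l2} //.
- by move=> l1 l2 l3 _ -> _ ->.
- by move=> k1 k2 l1 l2 _ h1 _ h2; rewrite !big_cat /= h1 h2.
- by move=> l1 l2; rewrite !big_cat /= addrC.
- by move=> m; rewrite big_seq1 big_nil b0.
- by move=> s t m; rewrite !big_cons !big_nil /= !addr0 bDl.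
- by move=> s m n; rewrite !big_cons !big_nil /= !addr0 bDr.
- by move=> s r m; rewrite !big_seq1 /= bZ.
Qed.

Lemma tlift_tensor s m : tlift beta (tensor f s m) = beta s m.
Proof. by rewrite tlift_class big_seq1. Qed.

Lemma tliftD : addfun (tlift beta).
Proof.
move=> x y; rewrite -[x]treprK -[y]treprK tclassD !tlift_class.
by rewrite big_cat.
Qed.

End TensorLift.

(** * Base change as a property of a semilinear map *)

Section Semilinear.
Variables (R S : comPzRingType) (f : {rmorphism R -> S}).

Definition semilin (M : lmodType R) (N : lmodType S) (phi : M -> N) : Prop :=
  addfun phi /\ forall r m, phi (r *: m) = f r *: phi m.

(** Unbundled form of [adjoint], convertible to it, so that [qc_iso] yields [cart] directly. *)
Definition cadj (M : lmodType R) (N : lmodType S) (phi : M -> N) :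
  basechange f M -> N := tlift (fun s m => s *: phi m).

(* N is the base change of M along f, through phi. *)
Definition cart (M : lmodType R) (N : lmodType S) (phi : M -> N) : Prop :=
  semilin phi /\ bijective (cadj phi).

Variables (M : lmodType R) (N : lmodType S).

Lemma linear_semilinear (phi : {linear M -> N | f \; *:%R}) : semilin phi.
Proof. by split=> [x y|r m]; [apply: linearD | rewrite linearZ]. Qed.

Variable phi : M -> N.

Section Bundle.
Hypothesis phiP : semilin phi.

Lemma semilinear_linear : linear_for (f \; *:%R) phi.
Proof. by case: phiP => D Z a x y; rewrite D Z. Qed.

Definition slinear : {linear M -> N | f \; *:%R} :=
  HB.pack phi (GRing.isLinear.Build R M N (f \; *:%R) phi semilinear_linear).

Lemma semilinear_balanced : balanced f (fun s m => s *: phi m).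
Proof.
case: phiP => D Z; split=> [s t m|s x y|s r m].
- by rewrite scalerDl.
- by rewrite D scalerDr.
- by rewrite Z scalerA.
Qed.

Lemma cadj_tensor s m : cadj phi (tensor f s m) = s *: phi m.
Proof. by rewrite /cadj tlift_tensor //; apply: semilinear_balanced. Qed.

Lemma cadjD : addfun (cadj phi).
Proof. exact/tliftD/semilinear_balanced. Qed.

Lemma cadjZ s x : cadj phi (s *: x) = s *: cadj phi x.
Proof.
move: x; apply: tensor_ext.
- by move=> x y; rewrite scalerDr cadjD.
- by move=> x y; rewrite cadjD scalerDr.
- by move=> t m; rewrite tensorZl !cadj_tensor scalerA.
Qed.

End Bundle.

(** Being a left inverse of [cadj phi] can be checked on pure tensors as soon as [k] is additive;
    surjectivity does the rest. *)
Lemma cart_intro (k : N -> basechange f M) : semilin phi ->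
  (forall n, exists x, cadj phi x = n) -> addfun k ->
  (forall s m, k (s *: phi m) = tensor f s m) -> cart phi.
Proof.
move=> phiP surj kD kP; split=> //; apply: bij_inj_surj => //.
apply: (can_inj (g := k)); apply: tensor_ext.
- by apply: addf_comp => //; apply: cadjD.
- exact: addf_id.
- by move=> s m; rewrite cadj_tensor.
Qed.

Lemma tensor_semilinear : semilin (tensor f 1 : M -> basechange f M).
Proof. by split=> [x y|r m]; rewrite ?tensorDr // tensorZr mul1r tensorE. Qed.

Section Cart.
Hypothesis phiC : cart phi.
Let phiP : semilin phi := phiC.1.

Lemma cart_ind (P : N -> Prop) :
  P 0 -> (forall x y, P x -> P y -> P (x + y)) ->
  (forall s m, P (s *: phi m)) -> forall n, P n.
Proof.
move=> P0 PD Pt n; case: phiC => _ [k _ kK]; rewrite -[n]kK.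
elim/tensor_ind: (k n) => [|x y|s m]; first by rewrite addf0 //; apply: cadjD.
  by rewrite cadjD //; apply: PD.
by rewrite cadj_tensor.
Qed.

Variable W : zmodType.

Lemma cart_ext (h k : N -> W) : addfun h -> addfun k ->
  (forall s m, h (s *: phi m) = k (s *: phi m)) -> h =1 k.
Proof.
move=> hD kD hk; elim/cart_ind => //; first by rewrite !addf0.
by move=> x y hx hy; rewrite hD kD hx hy.
Qed.

(** The universal property of the tensor product, carried over to any model of the base change. *)
Lemma cart_lift (beta : S -> M -> W) : balanced f beta ->
  exists2 h : N -> W, addfun h & forall s m, h (s *: phi m) = beta s m.
Proof.
move=> betaP; case: phiC => _ [k kK Kk].
exists (fun n => tlift beta (k n)) => [x y|s m].
  rewrite -tliftD //; congr tlift; apply: (can_inj kK).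
  by rewrite cadjD // !Kk.
by rewrite -(cadj_tensor phiP) kK tlift_tensor.
Qed.

End Cart.

End Semilinear.

Lemma cart_tensor (R S : comPzRingType) (f : {rmorphism R -> S}) (M : lmodType R) :
  cart f (tensor f 1 : M -> basechange f M).
Proof.
have slP := tensor_semilinear f M.
apply: (cart_intro (k := id) slP) => // [x|s m]; last by rewrite -tensorE.
exists x; apply: (tensor_ext (h := cadj _)) (cadjD slP) (@addf_id _) _ x => s m.
by rewrite cadj_tensor // -tensorE.
Qed.

Section CartComposition.
Variables (R S T : comPzRingType).
Variables (f : {rmorphism R -> S}) (g : {rmorphism S -> T}) (gf : {rmorphism R -> T}).
Hypothesis gfE : forall r, gf r = g (f r).
Variables (M : lmodType R) (N : lmodType S) (L : lmodType T).
Variables (phi : M -> N) (psi : N -> L).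

Lemma semilinear_comp : semilin f phi -> semilin g psi ->
  semilin gf (fun m => psi (phi m)).
Proof.
by case=> fD fZ [gD gZ]; split=> [x y|r m]; rewrite ?fD ?gD // fZ gZ gfE.
Qed.

(** Transitivity of base change. The inverse is built by two lifts: [j] on N sends [s *: phi m] to
    [g s (x) m], then [k] on L sends [t *: psi n] to [t *: j n]. *)
Lemma cart_comp : cart f phi -> cart g psi -> cart gf (fun m => psi (phi m)).
Proof.
move=> phiC psiC; have [phiP psiP] := (phiC.1, psiC.1).
have cP := semilinear_comp phiP psiP.
have [|j jD jP] := cart_lift (W := basechange gf M) phiC (beta := fun s m => tensor gf (g s) m).
  split=> [s t m|s x y|s r m]; rewrite ?rmorphD ?tensorDl ?tensorDr //.
  by rewrite rmorphM tensorZr gfE.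
have jZ s n : j (s *: n) = g s *: j n.
  move: n; apply: (cart_ext phiC).
  - by move=> x y; rewrite scalerDr jD.
  - by move=> x y; rewrite jD scalerDr.
  - by move=> t m; rewrite scalerA !jP tensorZl rmorphM.
have [|k kD kP] := cart_lift (W := basechange gf M) psiC (beta := fun t n => t *: j n).
  split=> [s t m|s x y|s r m]; first by rewrite scalerDl.
    by rewrite jD scalerDr.
  by rewrite jZ scalerA.
apply: (cart_intro (k := k)) => //; last first.
  move=> t m; rewrite kP -[phi m]scale1r jP rmorph1 [RHS]tensorE.
  by [].
elim/(cart_ind psiC) => [|x y [x' <-] [y' <-]|t n].
- by exists 0; rewrite addf0 //; apply: cadjD.
- by exists (x' + y'); rewrite cadjD.
elim/(cart_ind phiC): n => [|x y [x' hx] [y' hy]|s m].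
- by exists 0; rewrite (addf0 (cadjD cP)) (addf0 psiP.1) scaler0.
- by exists (x' + y'); rewrite cadjD // hx hy psiP.1 scalerDr.
- by exists (tensor gf (t * g s) m); rewrite cadj_tensor // psiP.2 scalerA.
Qed.

(** As L is a base change of M, sending [t *: psi (phi m)] to [t (x) phi m] is well defined on L;
    this inverts the adjoint of [psi]. *)
Lemma cart_cancel : cart f phi -> semilin g psi ->
  cart gf (fun m => psi (phi m)) -> cart g psi.
Proof.
move=> phiC psiP cC; have [phiP cP] := (phiC.1, cC.1).
have [|k kD kP] := cart_lift (W := basechange g N) cC
    (beta := fun t m => tensor g t (phi m)).
  split=> [s t m|s x y|s r m]; rewrite ?tensorDl ?phiP.1 ?tensorDr //.
  by rewrite phiP.2 tensorZr gfE.
apply: (cart_intro (k := k)) => //.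
  elim/(cart_ind cC) => [|x y [x' <-] [y' <-]|t m].
  - by exists 0; rewrite addf0 //; apply: cadjD.
  - by exists (x' + y'); rewrite cadjD.
  - by exists (tensor g t (phi m)); rewrite cadj_tensor.
move=> t; apply: (cart_ext phiC).
- by move=> x y; rewrite psiP.1 scalerDr kD.
- by move=> x y; rewrite tensorDr.
- by move=> s m; rewrite psiP.2 scalerA kP tensorZr.
Qed.

End CartComposition.

Lemma cart_id_bij (R : comPzRingType) (f : {rmorphism R -> R})
    (M N : lmodType R) (phi : M -> N) :
  f =1 id -> cart f phi -> bijective phi.
Proof.
move=> fE phiC; have phiP := phiC.1.
have [|k kD kP] := cart_lift (W := M) phiC (beta := fun s m => s *: m).
  split=> [s t m|s x y|s r m]; rewrite ?scalerDl ?scalerDr //.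
  by rewrite fE scalerA.
exists k => [m|]; first by rewrite -[phi m]scale1r kP scale1r.
apply: (cart_ext phiC); [exact: addf_comp phiP.1 kD | exact: addf_id |].
by move=> s m; rewrite kP phiP.2 fE.
Qed.

Lemma bij_cart_id (R : comPzRingType) (f : {rmorphism R -> R})
    (M N : lmodType R) (phi : M -> N) :
  f =1 id -> semilin f phi -> bijective phi -> cart f phi.
Proof.
move=> fE phiP [k kK Kk].
have kD : addfun k by move=> x y; apply: (can_inj kK); rewrite phiP.1 !Kk.
apply: (cart_intro (k := fun n => tensor f 1 (k n))) => //.
- by move=> n; exists (tensor f 1 (k n)); rewrite cadj_tensor // scale1r Kk.
- by move=> x y; rewrite kD tensorDr.
- move=> s m; have -> : s *: phi m = phi (s *: m) by rewrite phiP.2 fE.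
  by rewrite kK tensorZr fE mul1r.
Qed.

(** * Finite products and restriction of scalars *)

Section ProductModule.
Variables (R : comPzRingType) (I : finType) (A : I -> lmodType R).

Definition prodm : Type := forall i, A i.

HB.instance Definition _ := gen_eqMixin prodm.
HB.instance Definition _ := gen_choiceMixin prodm.

Let padd (x y : prodm) : prodm := fun i => x i + y i.
Let popp (x : prodm) : prodm := fun i => - x i.
Let pscale (a : R) (x : prodm) : prodm := fun i => a *: x i.

Lemma prodm_addA : associative padd.
Proof. by move=> x y z; apply/functional_extensionality_dep => i; apply: addrA. Qed.
Lemma prodm_addC : commutative padd.
Proof. by move=> x y; apply/functional_extensionality_dep => i; apply: addrC. Qed.
Lemma prodm_add0 : left_id ((fun i => 0) : prodm) padd.
Proof. by move=> x; apply/functional_extensionality_dep => i; apply: add0r. Qed.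
Lemma prodm_addN : left_inverse ((fun i => 0) : prodm) popp padd.
Proof. by move=> x; apply/functional_extensionality_dep => i; apply: addNr. Qed.

HB.instance Definition _ :=
  GRing.isZmodule.Build prodm prodm_addA prodm_addC prodm_add0 prodm_addN.

Lemma prodm_scaleA a b x : pscale a (pscale b x) = pscale (a * b) x.
Proof. by apply/functional_extensionality_dep => i; apply: scalerA. Qed.
Lemma prodm_scale1 : left_id 1 pscale.
Proof. by move=> x; apply/functional_extensionality_dep => i; apply: scale1r. Qed.
Lemma prodm_scaleDr : right_distributive pscale +%R.
Proof. by move=> a x y; apply/functional_extensionality_dep => i; apply: scalerDr. Qed.
Lemma prodm_scaleDl x : {morph pscale^~ x : a b / a + b}.
Proof. by move=> a b; apply/functional_extensionality_dep => i; apply: scalerDl. Qed.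

HB.instance Definition _ := GRing.Zmodule_isLmodule.Build R prodm
  prodm_scaleA prodm_scale1 prodm_scaleDr prodm_scaleDl.

Lemma prodm_addE (x y : prodm) i : (x + y) i = x i + y i. Proof. by []. Qed.
Lemma prodm_scaleE a (x : prodm) i : (a *: x) i = a *: x i. Proof. by []. Qed.
Lemma prodm_sumE J (r : seq J) (F : J -> prodm) i :
  (\sum_(j <- r) F j) i = \sum_(j <- r) F j i.
Proof. by apply: (big_morph (fun x : prodm => x i)). Qed.

Lemma prodmP (x y : prodm) : x = y <-> forall i, x i = y i.
Proof. by split=> [->|xy] //; apply/functional_extensionality_dep. Qed.

Definition inj_at (i : I) (a : A i) : prodm := dfwith (fun i => 0 : A i) a.

Lemma inj_at_in i (a : A i) : inj_at a i = a.
Proof. exact: dfwith_in. Qed.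

Lemma inj_at_out i (a : A i) j : i != j -> inj_at a j = 0.
Proof. exact: dfwith_out. Qed.

Lemma inj_at_linear i : linear (@inj_at i).
Proof.
move=> r a b; apply/prodmP => j; rewrite prodm_addE prodm_scaleE.
have [<-|ij] := eqVneq i j; first by rewrite !inj_at_in.
by rewrite !inj_at_out // scaler0 addr0.
Qed.

HB.instance Definition _ i := GRing.isLinear.Build R (A i) prodm _
  (@inj_at i) (@inj_at_linear i).

Lemma prodm_decomp (x : prodm) : x = \sum_i inj_at (x i).
Proof.
apply/prodmP => j; rewrite prodm_sumE (bigD1 j) //= inj_at_in.
by rewrite big1 ?addr0 // => i ij; rewrite inj_at_out.
Qed.

End ProductModule.

Section CartProduct.
Variables (R S : comPzRingType) (f : {rmorphism R -> S}).
Variables (I : finType) (A : I -> lmodType R) (B : I -> lmodType S).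
Variable phi : forall i, A i -> B i.
Hypothesis phiC : forall i, cart f (@phi i).

Definition prodm_map (x : prodm A) : prodm B := fun i => phi (x i).

(** Base change commutes with finite products: a family is the finite sum of its components, and the
    inverse treats each component inside its own factor. *)
Lemma cart_prodm : cart f prodm_map.
Proof.
have pP : semilin f prodm_map.
  by split=> [x y|r x]; apply/prodmP => i; have [D Z] := (phiC i).1; [apply: D | apply: Z].
have inv i : exists k : B i -> basechange f (A i),
    addfun k /\ forall s m, k (s *: phi m) = tensor f s m.
  have [|k kD kP] := cart_lift (W := basechange f (A i)) (phiC i)
    (beta := fun s m => tensor f s m); last by exists k.
  split=> [s t m|s x y|s r m]; rewrite ?tensorDl ?tensorDr //.
  by rewrite tensorZr.
pose k i := sval (cid (inv i)); have kP i : addfun (k i) /\ _ := svalP (cid (inv i)).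
pose inv_map (n : prodm B) : basechange f (prodm A) :=
  \sum_i basechange_map f (@inj_at _ _ A i) (k i (n i)).
apply: (@cart_intro _ _ f _ _ prodm_map inv_map) => //.
- move=> n; rewrite (prodm_decomp n).
  elim: (index_enum I) => [|i r [x hx]]; first by exists 0; rewrite big_nil (addf0 (cadjD pP)).
  rewrite big_cons -{}hx.
  suff [y <-] : exists y : basechange f (prodm A), cadj prodm_map y = inj_at (n i).
    by exists (y + x); rewrite (cadjD pP).
  move: (n i); apply: (cart_ind (phiC i)) => [|a b [a' ha] [b' hb]|s m].
  + by exists 0; rewrite (addf0 (cadjD pP)) linear0.
  + by exists (a' + b'); rewrite (cadjD pP) ha hb linearD.
  exists (tensor f s (inj_at m)); rewrite (cadj_tensor pP) linearZ /=.
  congr (_ *: _); apply/prodmP => j; rewrite /prodm_map /=.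
  have [<-|ij] := eqVneq i j; first by rewrite !inj_at_in.
  by rewrite !inj_at_out // (addf0 (phiC j).1.1).
- move=> x y; rewrite -big_split; apply: eq_bigr => i _.
  by rewrite (kP i).1 linearD.
- move=> s m; rewrite [in RHS](prodm_decomp m) (addf_sum (tensorDr f s)).
  apply: eq_bigr => i _; rewrite -basechange_map_tensor; congr basechange_map.
  exact: (kP i).2.
Qed.

End CartProduct.

(** The carrier is literally that of P, so a function on P is also a function on its restriction,
    without any transport. *)
Definition restr (R S : comPzRingType) (f : {rmorphism R -> S}) (P : lmodType S) :
  Type := P.

Section Restriction.
Variables (R S : comPzRingType) (f : {rmorphism R -> S}) (P : lmodType S).

HB.instance Definition _ := GRing.Zmodule.on (restr f P).

Let rscale (r : R) (x : restr f P) : restr f P := f r *: (x : P).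

Lemma restr_scaleA a b x : rscale a (rscale b x) = rscale (a * b) x.
Proof. by rewrite /rscale scalerA rmorphM. Qed.
Lemma restr_scale1 : left_id 1 rscale.
Proof. by move=> x; rewrite /rscale rmorph1 scale1r. Qed.
Lemma restr_scaleDr : right_distributive rscale +%R.
Proof. by move=> a x y; apply: scalerDr. Qed.
Lemma restr_scaleDl x : {morph rscale^~ x : a b / a + b}.
Proof. by move=> a b; rewrite /rscale rmorphD scalerDl. Qed.

HB.instance Definition _ := GRing.Zmodule_isLmodule.Build R (restr f P)
  restr_scaleA restr_scale1 restr_scaleDr restr_scaleDl.

Lemma restr_scaleE r (x : restr f P) : r *: x = f r *: (x : P).
Proof. by []. Qed.

End Restriction.

(** The sum is a third bundled map, known pointwise, because this is how multiplication by a sum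
    arises from [orbit]. *)
Lemma basechange_mapD (R S : comPzRingType) (f : {rmorphism R -> S})
    (M N : lmodType R) (h k l : {linear M -> N}) :
  (forall m, l m = h m + k m) ->
  forall x, basechange_map f l x = basechange_map f h x + basechange_map f k x.
Proof.
move=> lE; apply: tensor_ext.
- by move=> x y; rewrite linearD.
- by move=> x y; rewrite !linearD addrACA.
- by move=> s m; rewrite !basechange_map_tensor lE tensorDr.
Qed.

Section OrbitMap.
Variables (R T : comPzRingType) (g : {rmorphism R -> T}) (P : lmodType T) (p : P).

Definition orbit_map (t : restr g T^o) : restr g P := (t : T) *: p.

Lemma orbit_map_linear : linear orbit_map.
Proof.
move=> a x y; rewrite /orbit_map restr_scaleE scalerDl; congr (_ + _).
by rewrite restr_scaleE scalerA.
Qed.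

HB.instance Definition _ :=
  GRing.isLinear.Build R (restr g T^o) (restr g P) _ orbit_map orbit_map_linear.

Definition orbit : {linear restr g T^o -> restr g P} := orbit_map.

End OrbitMap.

Arguments orbit {R T} g {P} p.

(** * The tensor product of two algebras *)

Section TensorRing.
Variables (R S T : comPzRingType) (f : {rmorphism R -> S}) (g : {rmorphism R -> T}).

(* S (x)_R T, with T regarded as an R-module through g. *)
Definition tensor_ring : Type := basechange f (restr g T^o).

HB.instance Definition _ := GRing.Zmodule.on tensor_ring.

Definition pure (s : S) (t : T) : tensor_ring := tensor f s (t : restr g T^o).

(** The pure tensor of [s] and [t] acts as [s] times the base change of multiplication by [t]. With
    the second factor acted on by a linear map, only the first factor needs a lift. *)
Definition tmul (x y : tensor_ring) : tensor_ring :=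
  tlift (fun (s : S) (t : restr g T^o) => s *: basechange_map f (orbit g (t : T^o)) y) x.

Lemma pure_act s t s' t' :
  s *: basechange_map f (orbit g (t : T^o)) (pure s' t') = pure (s * s') (t * t').
Proof. by rewrite basechange_map_tensor tensorZl [t * t']mulrC. Qed.

Lemma tmul_balanced y :
  balanced f (fun (s : S) (t : restr g T^o) => s *: basechange_map f (orbit g (t : T^o)) y).
Proof.
split=> [s t m|s t t'|s r m].
- by rewrite scalerDl.
- rewrite -scalerDr; congr (_ *: _); apply: basechange_mapD => u.
  exact: (scalerDr (u : T) (t : T^o) t').
- rewrite -scalerA; congr (_ *: _).
  move: y; apply: tensor_ext.
  + by move=> x y; rewrite linearD scalerDr.
  + by move=> x y; rewrite linearD.
  + move=> s' u; rewrite !basechange_map_tensor tensorZl mulrC -tensorZr.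
    congr tensor; rewrite /orbit /orbit_map !restr_scaleE.
    exact: (mulrCA (g r) (u : T) (m : T)).
Qed.

Lemma tmul_pure s t s' t' : tmul (pure s t) (pure s' t') = pure (s * s') (t * t').
Proof. by rewrite /tmul tlift_tensor ?pure_act //; apply: tmul_balanced. Qed.

Lemma tmulDl : left_distributive tmul +%R.
Proof. by move=> x y z; rewrite /tmul tliftD //; apply: tmul_balanced. Qed.

Lemma tmulDr x : addfun (tmul x).
Proof.
move=> y z; move: x; apply: tensor_ext => [||s t].
- by move=> u v; rewrite tmulDl.
- by move=> u v; rewrite !tmulDl addrACA.
- rewrite /tmul !tlift_tensor; try exact: tmul_balanced.
  by rewrite linearD scalerDr.
Qed.

Lemma pure_ind (P : tensor_ring -> Prop) :
  P 0 -> (forall x y, P x -> P y -> P (x + y)) ->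
  (forall s t, P (pure s t)) -> forall x, P x.
Proof. exact: tensor_ind. Qed.

Lemma pure_ext (W : zmodType) (h k : tensor_ring -> W) : addfun h -> addfun k ->
  (forall s t, h (pure s t) = k (pure s t)) -> h =1 k.
Proof. exact: tensor_ext. Qed.

Lemma tmulC : commutative tmul.
Proof.
move=> x y; move: x; apply: pure_ext => [u v|u v|s t]; rewrite ?tmulDl ?tmulDr //.
move: y; apply: pure_ext => [u v|u v|s' t']; rewrite ?tmulDl ?tmulDr //.
by rewrite !tmul_pure mulrC [t * t']mulrC.
Qed.

Lemma tmulA : associative tmul.
Proof.
move=> x y z; move: x; apply: pure_ext => [u v|u v|s t]; rewrite ?tmulDl //.
move: y; apply: pure_ext => [u v|u v|s' t'].
- by rewrite !(tmulDl, tmulDr).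
- by rewrite !(tmulDl, tmulDr).
move: z; apply: pure_ext => [u v|u v|s2 t2].
- by rewrite !(tmulDl, tmulDr).
- by rewrite !(tmulDl, tmulDr).
by rewrite !tmul_pure !mulrA.
Qed.

Lemma tmul1 : left_id (pure 1 1) tmul.
Proof.
apply: pure_ext => [u v|u v|s t]; rewrite ?tmulDr //.
by rewrite tmul_pure !mul1r.
Qed.

HB.instance Definition _ :=
  GRing.Zmodule_isComPzRing.Build tensor_ring tmulA tmulC tmul1 tmulDl.

Lemma pureM s t s' t' : pure s t * pure s' t' = pure (s * s') (t * t').
Proof. exact: tmul_pure. Qed.

Lemma pureDl t : addfun (pure^~ t).
Proof. by move=> x y; apply: tensorDl. Qed.
Lemma pureDr s : addfun (pure s).
Proof. by move=> x y; apply: (tensorDr f s (x : restr g T^o) y). Qed.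

Definition inl_ring (s : S) : tensor_ring := pure s 1.
Definition inr_ring (t : T) : tensor_ring := pure 1 t.

Lemma inl_zmod_morphism : zmod_morphism inl_ring.
Proof. by move=> x y; apply: (addfB (pureDl 1)). Qed.
Lemma inl_monoid_morphism : monoid_morphism inl_ring.
Proof. by split=> // x y; rewrite pureM mulr1. Qed.
Lemma inr_zmod_morphism : zmod_morphism inr_ring.
Proof. by move=> x y; apply: (addfB (pureDr 1)). Qed.
Lemma inr_monoid_morphism : monoid_morphism inr_ring.
Proof. by split=> // x y; rewrite pureM mulr1. Qed.

HB.instance Definition _ :=
  GRing.isZmodMorphism.Build S tensor_ring inl_ring inl_zmod_morphism.
HB.instance Definition _ :=
  GRing.isMonoidMorphism.Build S tensor_ring inl_ring inl_monoid_morphism.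
HB.instance Definition _ :=
  GRing.isZmodMorphism.Build T tensor_ring inr_ring inr_zmod_morphism.
HB.instance Definition _ :=
  GRing.isMonoidMorphism.Build T tensor_ring inr_ring inr_monoid_morphism.

Lemma pureE s t : pure s t = inl_ring s * inr_ring t.
Proof. by rewrite pureM mulr1 mul1r. Qed.

Lemma tensor_ring_square r : inl_ring (f r) = inr_ring (g r).
Proof.
rewrite /inl_ring /inr_ring /pure -[f r]mul1r -tensorZr.
by congr tensor; rewrite restr_scaleE; apply: mulr1.
Qed.

Lemma tensor_ring_rmorph_ext (C : comPzRingType) (h k : {rmorphism tensor_ring -> C}) :
  (forall s, h (inl_ring s) = k (inl_ring s)) ->
  (forall t, h (inr_ring t) = k (inr_ring t)) -> h =1 k.
Proof.
move=> hl hr; apply: pure_ext; try by move=> x y; rewrite rmorphD.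
by move=> s t; rewrite pureE !rmorphM hl hr.
Qed.

Section Universal.
Variables (C : comPzRingType) (a : {rmorphism S -> C}) (b : {rmorphism T -> C}).
Hypothesis ab : forall r, a (f r) = b (g r).

Definition tensor_ring_lift (x : tensor_ring) : C :=
  tlift (fun (s : S) (t : restr g T^o) => a s * b t) x.

Lemma lift_balanced : balanced f (fun (s : S) (t : restr g T^o) => a s * b t).
Proof.
split=> [s t m|s x y|s r m].
- by rewrite rmorphD mulrDl.
- by rewrite (rmorphD b) mulrDr.
- by rewrite restr_scaleE rmorphM (rmorphM b) ab mulrA.
Qed.

Lemma tensor_ring_liftE s t : tensor_ring_lift (pure s t) = a s * b t.
Proof. by rewrite /tensor_ring_lift tlift_tensor //; apply: lift_balanced. Qed.

Lemma tensor_ring_liftD : addfun tensor_ring_lift.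
Proof. exact/tliftD/lift_balanced. Qed.

Lemma tensor_ring_lift_zmod : zmod_morphism tensor_ring_lift.
Proof. exact: (addfB tensor_ring_liftD). Qed.

Lemma tensor_ring_lift_monoid : monoid_morphism tensor_ring_lift.
Proof.
split=> [|x y]; first by rewrite tensor_ring_liftE !rmorph1 mulr1.
move: x; apply: pure_ext => [u v|u v|s t].
- by rewrite mulrDl tensor_ring_liftD.
- by rewrite tensor_ring_liftD mulrDl.
move: y; apply: pure_ext => [u v|u v|s' t'].
- by rewrite mulrDr tensor_ring_liftD.
- by rewrite tensor_ring_liftD mulrDr.
by rewrite pureM !tensor_ring_liftE !rmorphM mulrACA.
Qed.

Lemma tensor_ring_universal : exists h : {rmorphism tensor_ring -> C},
  (forall s, h (inl_ring s) = a s) /\ (forall t, h (inr_ring t) = b t).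
Proof.
pose h : {rmorphism tensor_ring -> C} := HB.pack tensor_ring_lift
  (GRing.isZmodMorphism.Build _ _ _ tensor_ring_lift_zmod)
  (GRing.isMonoidMorphism.Build _ _ _ tensor_ring_lift_monoid).
by exists h; split=> x; rewrite /h /= tensor_ring_liftE rmorph1 ?mulr1 ?mul1r.
Qed.

End Universal.

(* S (x)_R P is the base change of P along T -> S (x)_R T: the inverse of the
   comparison map sends (s (x) t) (x) p to s (x) t p. *)
Lemma cart_restr (P : lmodType T) (Q : lmodType tensor_ring) (phi : P -> Q) :
  cart (inr_ring : {rmorphism T -> tensor_ring}) phi ->
  cart f (phi : restr g P -> restr (inl_ring : {rmorphism S -> tensor_ring}) Q).
Proof.
move=> phiC; have [phiD phiZ] := phiC.1.
have phiP : semilin f (phi : restr g P ->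
    restr (inl_ring : {rmorphism S -> tensor_ring}) Q).
  split=> [x y|r x]; first exact: phiD.
  transitivity (inr_ring (g r) *: phi x); first exact: phiZ.
  by rewrite -tensor_ring_square.
pose beta (b : tensor_ring) (p : P) : basechange f (restr g P) :=
  basechange_map f (orbit g p) b.
have betaP : balanced (inr_ring : {rmorphism T -> tensor_ring}) beta.
  split=> [b c p|b p q|b t p].
  - exact: linearD.
  - by apply: basechange_mapD => u; apply: (scalerDr (u : T) p q).
  - rewrite /beta; move: b; apply: pure_ext => [u v|u v|s u].
    + by rewrite mulrDl linearD.
    + by rewrite linearD.
    + rewrite pureM !basechange_map_tensor mulr1; congr tensor.
      exact: (esym (scalerA (u : T) t p)).
have [k kD kP] := cart_lift phiC betaP.
apply: (@cart_intro _ _ f _ _ (phi : restr g P ->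
    restr (inl_ring : {rmorphism S -> tensor_ring}) Q) k) => //.
  apply: (cart_ind phiC) => [|x y [x' <-] [y' <-]|b p].
  - by exists 0; rewrite (addf0 (cadjD phiP)).
  - by exists (x' + y'); rewrite (cadjD phiP).
  - move: b; apply: pure_ind => [|x y [x' hx] [y' hy]|s t].
    + by exists 0; rewrite (addf0 (cadjD phiP)) scale0r.
    + by exists (x' + y'); rewrite (cadjD phiP) hx hy scalerDl.
    + exists (tensor f s (t *: p : restr g P)); rewrite (cadj_tensor phiP).
      by rewrite restr_scaleE phiZ scalerA -pureE.
move=> s p; rewrite restr_scaleE kP /beta basechange_map_tensor.
by congr tensor; apply: (scale1r (p : P)).
Qed.

End TensorRing.

(** * Flatness and joint faithful flatness *)

Definition lin (R : comPzRingType) (M N : lmodType R) (h : M -> N) : Prop :=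
  addfun h /\ forall r m, h (r *: m) = r *: h m.

Section Bundle.
Variables (R : comPzRingType) (M N : lmodType R) (h : M -> N).
Hypothesis hP : lin h.

Lemma lin_linear : linear h.
Proof. by case: hP => D Z a x y; rewrite D Z. Qed.

Definition bundle : {linear M -> N} :=
  HB.pack h (GRing.isLinear.Build R M N *:%R h lin_linear).

End Bundle.

Lemma linear_lin (R : comPzRingType) (M N : lmodType R) (h : {linear M -> N}) : lin h.
Proof. by split=> [x y|r x]; [apply: linearD | apply: linearZ]. Qed.

Section ExactCart.
Variables (R S : comPzRingType) (f : {rmorphism R -> S}).

Lemma cadj_basechange_map (M N : lmodType R) (M' N' : lmodType S)
    (g : {linear M -> N}) (g' : M' -> N') (phi : M -> M') (psi : N -> N') :
  lin g' -> semilin f phi -> semilin f psi ->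
  (forall m, g' (phi m) = psi (g m)) ->
  forall x, cadj psi (basechange_map f g x) = g' (cadj phi x).
Proof.
move=> [g'D g'Z] phiP psiP gg'; apply: tensor_ext.
- by move=> x y; rewrite linearD (cadjD psiP).
- by move=> x y; rewrite (cadjD phiP) g'D.
- by move=> s m; rewrite basechange_map_tensor !cadj_tensor // g'Z gg'.
Qed.

Variables (M1 M2 M3 : lmodType R) (N1 N2 N3 : lmodType S).
Variables (g : {linear M1 -> M2}) (h : {linear M2 -> M3}).
Variables (g' : N1 -> N2) (h' : N2 -> N3).
Variables (phi1 : M1 -> N1) (phi2 : M2 -> N2) (phi3 : M3 -> N3).

(** Exactness after base change may be tested on any model of the base change. *)
Lemma exact_cart : lin g' -> lin h' ->
  cart f phi1 -> cart f phi2 -> cart f phi3 ->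
  (forall m, g' (phi1 m) = phi2 (g m)) -> (forall m, h' (phi2 m) = phi3 (h m)) ->
  exact_at (basechange_map f g) (basechange_map f h) <-> exact_at g' h'.
Proof.
move=> g'P h'P [c1 [k1 kK1 Kk1]] [c2 [k2 kK2 Kk2]] [c3 [k3 kK3 Kk3]] gg' hh'.
have ag := cadj_basechange_map g'P c1 c2 gg'.
have ah := cadj_basechange_map h'P c2 c3 hh'.
split=> ex y; split.
- move=> h'y; have : basechange_map f h (k2 y) = 0.
    by apply: (can_inj kK3); rewrite ah Kk2 h'y (addf0 (cadjD c3)).
  by case/ex => x gx; exists (cadj phi1 x); rewrite -ag gx Kk2.
- move=> [x gx]; have : basechange_map f h (k2 y) = 0.
    by apply/ex; exists (k1 x); apply: (can_inj kK2); rewrite ag Kk1 Kk2.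
  by move=> e; rewrite -[y]Kk2 -ah e (addf0 (cadjD c3)).
- move=> hy; have : h' (cadj phi2 y) = 0 by rewrite -ah hy (addf0 (cadjD c3)).
  by case/ex => x gx; exists (k1 x); apply: (can_inj kK2); rewrite ag Kk1.
- move=> [x gx]; apply: (can_inj kK3); rewrite ah (addf0 (cadjD c3)).
  by apply/ex; exists (cadj phi1 x); rewrite -ag gx.
Qed.

End ExactCart.

Section JointlyConservative.
Variables (R : comPzRingType) (I : Type) (S : I -> comPzRingType).
Variable f : forall i, {rmorphism R -> S i}.

(** The descent half of faithful flatness, for a family jointly. Speaking of the [S i] and not of
    their product keeps the argument inside the rings that carry charts. *)
Definition reflects_exactness : Prop :=
  forall (M1 M2 M3 : lmodType R) (g : {linear M1 -> M2}) (h : {linear M2 -> M3}),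
    (forall i, exact_at (basechange_map (f i) g) (basechange_map (f i) h)) ->
    exact_at g h.

Hypothesis jc : reflects_exactness.

Lemma reflects_exact (M1 M2 M3 : lmodType R) (N1 N2 N3 : forall i, lmodType (S i))
    (g : M1 -> M2) (h : M2 -> M3)
    (g' : forall i, N1 i -> N2 i) (h' : forall i, N2 i -> N3 i)
    (phi1 : forall i, M1 -> N1 i) (phi2 : forall i, M2 -> N2 i)
    (phi3 : forall i, M3 -> N3 i) :
  lin g -> lin h -> (forall i, lin (g' i)) -> (forall i, lin (h' i)) ->
  (forall i, cart (f i) (phi1 i)) -> (forall i, cart (f i) (phi2 i)) ->
  (forall i, cart (f i) (phi3 i)) ->
  (forall i m, g' i (phi1 i m) = phi2 i (g m)) ->
  (forall i m, h' i (phi2 i m) = phi3 i (h m)) ->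
  (forall i, exact_at (g' i) (h' i)) -> exact_at g h.
Proof.
move=> gP hP g'P h'P c1 c2 c3 gg' hh' ex.
apply: (jc (g := bundle gP) (h := bundle hP)) => i.
by apply/(exact_cart (g' := g' i) (h' := h' i)) => //.
Qed.

(* x = 0 says that R -x-> P -id-> P is exact. *)
Lemma reflects_zero (P : lmodType R) (Q : forall i, lmodType (S i))
    (phi : forall i, P -> Q i) (x : P) :
  (forall i, cart (f i) (phi i)) -> (forall i, phi i x = 0) -> x = 0.
Proof.
move=> phiC phix.
have : exact_at (fun r : R^o => r *: x) (id : P -> P).
  apply: (@reflects_exact R^o P P (fun i => (S i)^o) Q Q _ _
    (fun i s => s *: phi i x) (fun i => id) (fun i r => f i r) phi phi) => //.
  - by split=> [a b|a b]; rewrite ?scalerDl // -scalerA.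
  - by move=> i; split=> [a b|a b]; rewrite ?scalerDl // -scalerA.
  - move=> i; have fP : semilin (f i) (fun r : R^o => f i r : (S i)^o).
      by split=> [a b|a b]; rewrite ?rmorphD // [LHS]rmorphM.
    apply: (@cart_intro _ _ (f i) R^o (S i)^o _
      (fun s : (S i)^o => tensor (f i) (s : S i) (1 : R^o)) fP).
    + move=> s; exists (tensor (f i) (s : S i) (1 : R^o)).
      by rewrite (cadj_tensor fP) rmorph1; apply: mulr1.
    + by move=> s t; apply: (@tensorDl _ _ (f i) R^o s t 1).
    + move=> s r; transitivity (tensor (f i) (s : S i) (r *: (1 : R^o))); first by rewrite tensorZr.
      by congr tensor; apply: mulr1.
  - by move=> i r; rewrite (phiC i).1.2.
  - move=> i y; split=> [->|[s <-]]; first by exists 0; rewrite scale0r.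
    by rewrite phix scaler0.
by move=> ex; apply/(ex x).2; exists 1; rewrite scale1r.
Qed.

(** Through [psi], each base change of [w] becomes an identity map. Injectivity is [reflects_zero];
    surjectivity is exactness of [w] followed by the zero map. *)
Lemma reflects_bij (P Q : lmodType R) (Q' : forall i, lmodType (S i))
    (w : P -> Q) (psi : forall i, Q -> Q' i) :
  lin w -> (forall i, cart (f i) (psi i)) ->
  (forall i, cart (f i) (fun x => psi i (w x))) -> bijective w.
Proof.
move=> wP psiC wC; apply: bij_inj_surj.
  apply: addf_inj wP.1 _ => x wx.
  by apply: reflects_zero wC _ => i; rewrite wx (addf0 (psiC i).1.1).
have : exact_at w (fun _ : Q => 0 : Q).
  apply: (@reflects_exact P Q Q Q' Q' Q' w _ (fun i => id) (fun i _ => 0)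
     (fun i x => psi i (w x)) psi psi) => //.
  - by split=> [a b|a b]; rewrite ?addr0 ?scaler0.
  - by move=> i; split=> [a b|a b]; rewrite ?addr0 ?scaler0.
  - by move=> i m; rewrite (addf0 (psiC i).1.1).
  - by move=> i y; split=> // _; exists y.
by move=> ex y; apply/ex.
Qed.

End JointlyConservative.

(** Being a base change is local on the target ring: [cadj u] is R'-linear, [cart_cancel] identifies
    its base change to each [B i], and bijectivity is then reflected. *)
Lemma cart_local (R R' : comPzRingType) (h : {rmorphism R -> R'})
    (I : Type) (B : I -> comPzRingType) (b : forall i, {rmorphism R' -> B i})
    (hb : forall i, {rmorphism R -> B i}) (M : lmodType R) (P : lmodType R')
    (Q : forall i, lmodType (B i)) (u : M -> P) (v : forall i, P -> Q i) :
  reflects_exactness b -> (forall i r, hb i r = b i (h r)) ->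
  semilin h u -> (forall i, cart (b i) (v i)) ->
  (forall i, cart (hb i) (fun m => v i (u m))) -> cart h u.
Proof.
move=> jc hbE uP vC vuC; split=> //.
apply: (reflects_bij jc (psi := v)) => //.
  by split=> [x y|r x]; [apply: (cadjD uP) | apply: (cadjZ uP)].
move=> i; apply: (cart_cancel (hbE i) (cart_tensor h M)).
  split=> [x y|r x]; first by rewrite cadjD // (vC i).1.1.
  by rewrite cadjZ // (vC i).1.2.
have -> : (fun m => v i (cadj u (tensor h 1 m))) = (fun m => v i (u m)).
  by apply/funext => m; rewrite cadj_tensor // scale1r.
exact: vuC.
Qed.

(** Flat base change preserves kernels, for arbitrary models: once the two right-hand terms are base
    changes, so is the kernel. The proof is a diagram chase. *)
Lemma flat_kernel (R S : comPzRingType) (f : {rmorphism R -> S})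
    (M A D : lmodType R) (N A' D' : lmodType S)
    (e : M -> A) (d : A -> D) (e' : N -> A') (d' : A' -> D')
    (nu : M -> N) (alpha : A -> A') (delta : D -> D') :
  flat f -> lin e -> lin d -> lin e' -> lin d' ->
  injective e -> exact_at e d -> injective e' -> exact_at e' d' ->
  semilin f nu -> cart f alpha -> cart f delta ->
  (forall m, e' (nu m) = alpha (e m)) -> (forall a, d' (alpha a) = delta (d a)) ->
  cart f nu.
Proof.
move=> fF eP dP e'P d'P eI exed e'I exed' nuP [aP [ka kaK aKa]] [dlP [kd kdK dKd]] ee' dd'.
have ae := cadj_basechange_map (g := bundle eP) e'P nuP aP ee'.
have ad := cadj_basechange_map (g := bundle dP) d'P aP dlP dd'.
have ex := fF _ _ _ (bundle eP) (bundle dP) exed.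
(* Injectivity of [e] is exactness at M of the zero map M -> M followed by [e], a form to which
   flatness applies. *)
have bI x : basechange_map f (bundle eP) x = 0 -> x = 0.
  have zP : lin (fun _ : M => 0 : M) by split=> [a b|a b]; rewrite ?addr0 ?scaler0.
  have : exact_at (bundle zP) (bundle eP).
    move=> y; split=> [/= ey|[z /= <-]]; last exact: (addf0 eP.1).
    by exists 0; apply: eI; rewrite ey (addf0 eP.1).
  move/fF => ex0 /ex0 [z <-]; move: z.
  apply: (tensor_ext (k := fun _ => 0)).
  - by move=> a b; rewrite linearD.
  - by move=> a b; rewrite addr0.
  - by move=> s m; rewrite basechange_map_tensor /= (addf0 (tensorDr f s)).
split=> //; apply: bij_inj_surj.
  apply: (addf_inj (cadjD nuP)) => x nux; apply: bI; apply: (can_inj kaK).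
  by rewrite ae nux (addf0 e'P.1) (addf0 (cadjD aP)).
move=> n; have : basechange_map f (bundle dP) (ka (e' n)) = 0.
  apply: (can_inj kdK); rewrite ad aKa (addf0 (cadjD dlP)).
  by apply/exed'; exists n.
case/ex => x ex1; exists x; apply: e'I.
by rewrite -ae ex1 aKa.
Qed.

(** By [cart_restr], the base change of a T-module to [S i (x) T] is, over [S i], the base change of
    its restriction to R. Exactness over T is therefore tested over R. *)
Lemma reflects_exactness_base_change (R T : comPzRingType) (g : {rmorphism R -> T})
    (I : Type) (S : I -> comPzRingType) (f : forall i, {rmorphism R -> S i}) :
  reflects_exactness f ->
  reflects_exactness (fun i => @inr_ring _ _ _ (f i) g : {rmorphism T -> tensor_ring (f i) g}).
Proof.
move=> jc M1 M2 M3 u v exi.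
pose rM i (M : lmodType T) : lmodType (S i) :=
  restr (@inl_ring _ _ _ (f i) g : {rmorphism S i -> tensor_ring (f i) g})
    (basechange (@inr_ring _ _ _ (f i) g : {rmorphism T -> tensor_ring (f i) g}) M).
have cM i (M : lmodType T) : cart (f i) (tensor (@inr_ring _ _ _ (f i) g :
    {rmorphism T -> tensor_ring (f i) g}) 1 : restr g M -> rM i M).
  by apply: cart_restr; apply: cart_tensor.
apply: (@reflects_exact _ _ _ _ jc (restr g M1) (restr g M2) (restr g M3)
  (rM^~ M1) (rM^~ M2) (rM^~ M3) u v
  (fun i => basechange_map _ u) (fun i => basechange_map _ v) _ _ _ _ _ _ _
  (cM^~ M1) (cM^~ M2) (cM^~ M3)) => //.
- by split=> [x y|r x]; [apply: (linearD u) | apply: (linearZ_LR u)].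
- by split=> [x y|r x]; [apply: (linearD v) | apply: (linearZ_LR v)].
- move=> i; split=> [x y|r x]; first exact: (linearD (basechange_map _ u)).
  exact: (linearZ_LR (basechange_map _ u)).
- move=> i; split=> [x y|r x]; first exact: (linearD (basechange_map _ v)).
  exact: (linearZ_LR (basechange_map _ v)).
- by move=> i m; rewrite basechange_map_tensor.
- by move=> i m; rewrite basechange_map_tensor.
Qed.

(** * Cardinality of tensor products *)

Section SetEmbedding.
Variables (T U : Type) (X : set T) (Y : set U).

Definition set_embedding (h : T -> U) : Prop :=
  (forall x, X x -> Y (h x)) /\ (forall x y, X x -> X y -> h x = h y -> x = y).

End SetEmbedding.

(** Comparability of cardinals: a maximal partial injection, viewed as a graph, exhausts X or Y,
    since otherwise one more pair could be added. The points [t0] and [u0] serve as values off the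
    two subsets. *)
Lemma set_embedding_total (T U : Type) (t0 : T) (u0 : U) (X : set T) (Y : set U) :
  (exists h, set_embedding X Y h) \/ (exists h, set_embedding Y X h).
Proof.
pose P (G : set (T * U)) := (forall p, G p -> X p.1 /\ Y p.2) /\
  (forall p q, G p -> G q -> p.1 = q.1 <-> p.2 = q.2).
have [F FP Ftot|G [[GXY Ginj] Gmax]] := @Zorn_bigcup _ P.
  split=> [p [G FG Gp]|p q [G FG Gp] [H FH Hq]]; first exact: (FP _ FG).1.
  case: (Ftot G H FG FH) => GH.
    exact: (FP _ FH).2 (GH _ Gp) Hq.
  exact: (FP _ FG).2 Gp (GH _ Hq).
case: (pselect (forall x, exists y, X x -> G (x, y))) => [XG|nXG].
  left; have [h hP] := choice XG; exists h; split=> [x Xx|x y Xx Xy hxy].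
    exact: (GXY _ (hP x Xx)).2.
  by apply/(Ginj _ _ (hP x Xx) (hP y Xy)).
case: (pselect (forall y, exists x, Y y -> G (x, y))) => [YG|nYG].
  right; have [h hP] := choice YG; exists h; split=> [y Yy|x y Yx Yy hxy].
    exact: (GXY _ (hP y Yy)).1.
  by apply/(Ginj _ _ (hP x Yx) (hP y Yy)).
exfalso.
have [x0 Hx] : exists x, ~ exists y, X x -> G (x, y) by apply/existsNP.
have [y0 Hy] : exists y, ~ exists x, Y y -> G (x, y) by apply/existsNP.
have Xx0 : X x0 by apply: contrapT => nX; apply: Hx; exists u0.
have Yy0 : Y y0 by apply: contrapT => nY; apply: Hy; exists t0.
apply: (Gmax (fun p => G p \/ p = (x0, y0))).
  split; first by move=> p; left.
  by move=> /(_ (x0, y0) (or_intror erefl)) G0; apply: Hx; exists y0.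
have nx p : G p -> p.1 <> x0.
  by case: p => x y Gp /= e; apply: Hx; exists y => _; rewrite -e.
have ny p : G p -> p.2 <> y0.
  by case: p => x y Gp /= e; apply: Hy; exists x => _; rewrite -e.
split=> [p [/GXY //|-> //]|p q [Gp|->] [Gq|->]] /=.
- exact: Ginj.
- by split=> [/(nx _ Gp)|/(ny _ Gp)].
- by split=> /esym; [move/(nx _ Gq)|move/(ny _ Gq)].
- by [].
Qed.

(* Zorn's lemma on the graphs G of injective pairings D x D -> D with D a subset
   of A containing the image of e, D being read off the diagonal of G. *)
Lemma infinite_square (A : Type) (e : nat -> A) : injective e ->
  exists p : A -> A -> A, forall a b c d, p a b = p c d -> a = c /\ b = d.
Proof.
move=> eI.
pose D (G : set (A * A * A)) x := exists z, G (x, x, z).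
pose G0 (t : A * A * A) := exists m n, t = (e m, e n, e (pickle (m, n))).
(* The last clause is conditional so that the union of the empty chain qualifies; maximality against
   [G0] later excludes the empty graph. *)
pose P (G : set (A * A * A)) := [/\
  forall x y z, G (x, y, z) -> [/\ D G x, D G y & D G z],
  forall x y, D G x -> D G y -> exists z, G (x, y, z),
  forall x y z x' y' z', G (x, y, z) -> G (x', y', z') ->
    (x = x' /\ y = y') <-> z = z'
  & (exists t, G t) -> forall t, G0 t -> G t].
have [F FP Ftot|G [[GD Gtot Ginj G0G] Gmax]] := @Zorn_bigcup _ P.
  have D_sub (G : set (A * A * A)) x : F G -> D G x -> D (\bigcup_(Z in F) Z)%classic x.
    by move=> FG [z Gz]; exists z, G.
  split=> [x y z [G FG Gt]|x y [z [G FG Gx]] [z' [H FH Hy]]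
          |x y z x' y' z' [G FG Gt] [H FH Ht]|[t [G FG Gt]] u G0u].
  - by case: (FP _ FG) => /(_ _ _ _ Gt) [? ? ?] _ _ _; split; apply: (D_sub G).
  - case: (Ftot G H FG FH) => GH.
      have [_ /(_ x y) + _ _] := FP _ FH.
      by case=> [||w Hw]; [by exists z; apply: GH | by exists z' | exists w, H].
    have [_ /(_ x y) + _ _] := FP _ FG.
    by case=> [||w Hw]; [by exists z | by exists z'; apply: GH | exists w, G].
  - case: (Ftot G H FG FH) => GH.
      by have [_ _ + _] := FP _ FH; apply=> //; apply: GH.
    by have [_ _ + _] := FP _ FG; apply=> //; apply: GH.
  - by exists G => //; have [_ _ _] := FP _ FG; apply=> //; exists t.
have pI : injective (@pickle (nat * nat)%type) := pcan_inj pickleK.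
have DG0 n : D G0 (e n) by exists (e (pickle (n, n))), n, n.
have PG0 : P G0.
  split=> [x y z [m [n [-> -> ->]]] //|x y [z [m [n [-> _ _]]]] [z' [m' [n' [-> _ _]]]]
          |x y z x' y' z' [m [n [-> -> ->]]] [m' [n' [-> -> ->]]]|//].
  - by exists (e (pickle (m, m'))), m, m'.
  - by split=> [[/eI -> /eI -> //]|/eI/pI[-> ->]].
have {}G0G : forall t, G0 t -> G t.
  apply: G0G; apply: contrapT => nG; apply: (Gmax G0) => //.
  split=> [t Gt|/(_ (e 0%N, e 0%N, e (pickle (0%N, 0%N))))]; first by case: nG; exists t.
  by move=> GG; apply: nG; eexists; apply: GG; exists 0%N, 0%N.
have De n : D G (e n) by have [z Gz] := DG0 n; exists z; apply: G0G.
have [phi phiP] : exists phi : A -> A -> A, forall x y, D G x -> D G y -> G (x, y, phi x y).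
  have : forall xy, exists z, D G xy.1 -> D G xy.2 -> G (xy.1, xy.2, z).
    move=> [x y] /=; case: (pselect (D G x /\ D G y)) => [[Dx Dy]|nD].
      by have [z Gz] := Gtot x y Dx Dy; exists z.
    by exists x => Dx Dy; case: nD.
  by move=> /choice [phi phiP]; exists (fun x y => phi (x, y)) => x y; apply: (phiP (x, y)).
have phiD x y : D G x -> D G y -> D G (phi x y).
  by move=> Dx Dy; have [] := GD _ _ _ (phiP _ _ Dx Dy).
have phiI x y x' y' : D G x -> D G y -> D G x' -> D G y' ->
    phi x y = phi x' y' -> x = x' /\ y = y'.
  by move=> Dx Dy Dx' Dy'; move/(Ginj _ _ _ _ _ _ (phiP _ _ Dx Dy) (phiP _ _ Dx' Dy')).
(* With [e 0] and [e 1] as tags, [phi] encodes a disjoint union of two copies of D inside D: points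
   of D under the first tag, outside points, brought into D by [h], under the second. *)
pose c (h : A -> A) x := if pselect (D G x) then phi (e 0%N) x else phi (e 1%N) (h x).
have cD h x : (~ D G x -> D G (h x)) -> D G (c h x).
  by move=> hx; rewrite /c; case: pselect => Dx; apply: phiD => //; apply: hx.
have cI h x y : (~ D G x -> D G (h x)) -> (~ D G y -> D G (h y)) ->
    (~ D G x -> ~ D G y -> h x = h y -> x = y) -> c h x = c h y -> x = y.
  move=> hx hy hxy; rewrite /c; case: pselect => Dx; case: pselect => Dy.
  - by move/phiI => [].
  - by move/phiI => [||||/eI] //; apply: hy.
  - by move/phiI => [||||/eI] //; apply: hx.
  - by move/phiI => [||||_ /hxy] //; [apply: hx|apply: hy|apply].
(* If the complement of D embeds in D, then [c h] embeds all of A in D and [phi] gives the pairing.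
   If D embeds in its complement, G can be enlarged, against maximality. *)
case: (set_embedding_total (e 0%N) (e 0%N) (fun x => ~ D G x) (D G)) =>
  [[h [hD hI]]|[psi [psiD psiI]]].
  exists (fun x y => phi (c h x) (c h y)) => x y x' y' /phiI [||||] *; try exact/cD/hD.
  by split; apply: (cI h) => //; try exact: hD; apply: hI.
exfalso.
have [h hK] : exists h : A -> A, forall x, D G x -> h (psi x) = x.
  have : forall y, exists x, forall x', D G x' -> psi x' = y -> x = x'.
    move=> y; case: (pselect (exists2 x, D G x & psi x = y)) => [[x Dx xy]|ny].
      by exists x => x' Dx' x'y; apply: psiI; rewrite // xy x'y.
    by exists y => x' Dx' x'y; case: ny; exists x'.
  by move=> /choice [h hP]; exists h => x Dx; apply: hP.
pose D' x := D G x \/ exists2 d, D G d & psi d = x.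
have hD x : D' x -> ~ D G x -> D G (h x).
  by move=> [//|[d Dd <-]] _; rewrite hK.
have hI x y : D' x -> D' y -> ~ D G x -> ~ D G y -> h x = h y -> x = y.
  by move=> [//|[d Dd <-]] [//|[d' Dd' <-]] _ _; rewrite !hK // => ->.
pose k x y := phi (c h x) (c h y).
have kD x y : D' x -> D' y -> D G (k x y).
  by move=> D'x D'y; apply: phiD; apply/cD/hD.
have kI x y x' y' : D' x -> D' y -> D' x' -> D' y' -> k x y = k x' y' -> x = x' /\ y = y'.
  move=> D1 D2 D3 D4 /phiI [||||e1 e2]; try exact/cD/hD.
  by split; apply: (cI h) => //; try exact: hD; apply: hI.
(* The pairs in D' that are not already pairs in D. Their values [psi (k x y)] lie outside D, hence
   never collide with old values, and stay in D', which is thus closed under the new pairing. *)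
pose N x y := [/\ D' x, D' y & ~ (D G x /\ D G y)].
pose G' (t : A * A * A) := G t \/ N t.1.1 t.1.2 /\ t.2 = psi (k t.1.1 t.1.2).
have DG' x : D G' x <-> D' x.
  split=> [[z [Gx|[[] //]]]|D'x]; first by left; exists z.
  case: (pselect (D G x)) => [[z Gx]|nD]; first by exists z; left.
  by exists (psi (k x x)); right; split=> //; split=> //; case.
apply: (Gmax G').
  split=> [t Gt|]; first by left.
  have D'p : D' (psi (e 0%N)) by right; exists (e 0%N).
  move=> /(_ (psi (e 0%N), psi (e 0%N), psi (k (psi (e 0%N)) (psi (e 0%N))))).
  move=> GG; apply: (psiD (e 0%N)) => //; eexists; apply: GG; right.
  by split=> //; split=> //= -[nDp _]; apply: (psiD (e 0%N) (De 0%N)).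
have oldnew x y z x' y' z' : G (x, y, z) -> N x' y' -> z' = psi (k x' y') ->
    (x = x' /\ y = y') <-> z = z'.
  move=> Gt [D'x' D'y' nD] ->; have [Dx Dy Dz] := GD _ _ _ Gt.
  split=> [[xx yy]|zz]; first by case: nD; rewrite -xx -yy.
  by case: (psiD (k x' y')); [apply: kD | rewrite -zz].
split.
- move=> x y z [/GD[? ? ?]|/= [[D'x D'y _] ->]]; first by split; apply/DG'; left.
  split; apply/DG' => //; right; exists (k x y) => //; exact: kD.
- move=> x y /DG' D'x /DG' D'y; case: (pselect (D G x /\ D G y)) => [[Dx Dy]|nD].
    by exists (phi x y); left; apply: phiP.
  by exists (psi (k x y)); right.
- move=> x y z x' y' z' [Gt|[/= Nt zE]] [Gt'|[/= Nt' zE']].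
  + exact: Ginj.
  + exact: oldnew.
  + have [e1 e2] := oldnew _ _ _ _ _ _ Gt' Nt zE.
    split=> [[ex ey]|ez]; first by apply/esym/e1; split; apply: esym.
    by have [-> ->] := e2 (esym ez).
  + have [D1 D2 _] := Nt; have [D3 D4 _] := Nt'; rewrite zE zE'; split=> [[-> ->] //|].
    by move=> ez; apply: kI => //; apply: psiI => //; apply: kD.
- by move=> _ t /G0G; left.
Qed.

Lemma card_setT_leP (A B : Type) :
  ([set: A] #<= [set: B])%card <-> exists h : A -> B, injective h.
Proof.
split=> [/card_leP[h]|[h hI]].
  exists (fun a => val (h (SigSub (mem_set (I : [set: A]%classic a))))) => x y.
  move/val_inj => /(@inj _ _ _ h) /=; rewrite !inE => /(_ I I).
  by case.
have /injfunPex[g] : exists2 f : A -> B, set_fun setT setT f & set_inj setT f.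
  by exists h => // x y _ _; apply: hI.
exact: inj_card_le g.
Qed.

(** The iterated pairing is injective on lists of a given length; recording the length separates the
    rest. *)
Lemma seq_embedding (A : Type) : infinite_set [set: A] ->
  exists h : seq A -> A, injective h.
Proof.
move=> /infiniteP/card_setT_leP[e eI]; have [p pI] := infinite_square eI.
pose c := foldr p (e 0%N); exists (fun l => p (e (size l)) (c l)) => l l' /pI[/eI].
elim: l l' => [|x l IHl] [|x' l'] //= [/IHl ll'] /pI[-> /ll' -> //].
Qed.

Section SmallTensorRing.
Variables (R S T : comPzRingType) (f : {rmorphism R -> S}) (g : {rmorphism R -> T}).

(** Needed when kappa is countable: lists over [S * T] give only a countable bound, which is not
    below kappa. Here every tensor is a sum over [t] in T of [c t (x) t], for one of finitely many
    functions [c]. *)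
Lemma finite_tensor_ring : finite_set [set: S] -> finite_set [set: T] ->
  finite_set [set: tensor_ring f g].
Proof.
move=> finS /finite_seqP[l lT].
pose E (l : seq T) : set (tensor_ring f g) :=
  fun x => exists c : T -> S, x = \sum_(t <- l) pure f g (c t) t.
have finE k : finite_set (E k).
  elim: k => [|t k IHk].
    apply: (sub_finite_set _ (finite_set1 0)) => x [c ->]; by rewrite big_nil.
  apply: (sub_finite_set _ (finite_image (fun p => pure f g p.1 t + p.2) (finite_setX finS IHk))).
  move=> x [c ->]; rewrite big_cons; exists (c t, \sum_(t' <- k) pure f g (c t') t') => //.
  by split=> //=; exists c.
(* Without repetitions in the list, a pure tensor is obtained from a function [c] with a single
   nonzero value. *)
apply: (sub_finite_set _ (finE (undup l))) => x _.
elim/(@pure_ind _ _ _ f g): x => [|x y [c ->] [d ->]|s t].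
- by exists (fun=> 0); rewrite big1 // => t _; apply: (addf0 (pureDl f g t)).
- exists (fun t => c t + d t); rewrite -big_split; apply: eq_bigr => t _.
  by rewrite /= pureDl.
exists (fun t' => if t' == t then s else 0).
have tl : t \in undup l by rewrite mem_undup; have : [set: T]%classic t by []; rewrite lT.
rewrite (bigD1_seq t) ?undup_uniq //= eqxx big1 ?addr0 // => t' /negbTE ->.
exact: (addf0 (pureDl f g t')).
Qed.

Lemma tensor_ring_embedding : exists h : tensor_ring f g -> seq (S * T), injective h.
Proof.
by exists (@trepr _ _ f (restr g T^o)); apply: (can_inj (@treprK _ _ f (restr g T^o))).
Qed.

End SmallTensorRing.

Definition small_card (K A : Type) : Prop :=
  ([set: A] #<= [set: K])%card /\ ~ ([set: K] #<= [set: A])%card.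

Lemma small_tensor_ring (K : Type) (infK : infinite_set [set: K])
    (R S T : small_ring K) (f : {rmorphism R -> S}) (g : {rmorphism R -> T}) :
  small_card K (tensor_ring f g).
Proof.
have finC (A : Type) : finite_set [set: A] -> small_card K A.
  move=> finA; split; last by move=> /card_le_finite/(_ finA).
  apply: card_le_trans (_ : ([set: nat] #<= [set: K])%card); last exact/infiniteP.
  have [n /card_eqPle[+ _]] := finA; move/card_le_trans; apply.
  exact: subset_card_le.
have subC (A B : Type) (h : B -> A) : injective h -> small_card K A -> small_card K B.
  move=> hI [AK nKA]; have BA : ([set: B] #<= [set: A])%card by apply/card_setT_leP; exists h.
  by split; [exact: card_le_trans BA AK | move=> KB; apply: nKA; apply: card_le_trans KB BA].
case: (pselect (finite_set [set: S] /\ finite_set [set: T])) => [[finS finT]|inf].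
  exact/finC/finite_tensor_ring.
have [j jI] := tensor_ring_embedding f g.
(* A stands for the larger of S and T, which is infinite; tensors then embed in lists over A, hence
   in A. *)
have main (A : small_ring K) (s : S -> A) (t : T -> A) :
    injective s -> injective t -> small_card K (tensor_ring f g).
  move=> sI tI.
  have infA : infinite_set [set: A].
    move=> finA; apply: inf; split; apply: card_le_finite finA; apply/card_setT_leP.
      by exists s.
    by exists t.
  have [h hI] := seq_embedding infA.
  have /card_setT_leP[e eI] : ([set: nat] #<= [set: A])%card by apply/infiniteP.
  have [p pI] := infinite_square eI.
  apply: (subC A _ (fun x => h [seq p (s y.1) (t y.2) | y <- j x])); last exact: small_ring_card.
  move=> x y /hI /inj_map xy; apply/jI/xy => -[a b] [a' b'] /= /pI[/sI -> /tI -> //].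
have := set_embedding_total (0 : S) (0 : T) [set: S] [set: T].
case=> -[h [_ hI]].
  by apply: (main T h id) => // x y; apply: hI.
by apply: (main S id h) => // x y; apply: hI.
Qed.

Definition small_tensor (K : Type) (infK : infinite_set [set: K])
    (R S T : small_ring K) (f : {rmorphism R -> S}) (g : {rmorphism R -> T}) :
  small_ring K := SmallRing (small_tensor_ring infK f g).

(** * Charts and transition maps *)

Section Groupoid.
Variable G : groupoid.
Implicit Types (a b c : gpd_ar G) (x y z w : gpd_ob G).

(* Junk value b when b and a are not composable. *)
Definition gcomp b a : gpd_ar G :=
  if pselect (gpd_dom b = gpd_cod a) is left e then gpd_comp e else b.

Lemma gcompE b a (e : gpd_dom b = gpd_cod a) : gcomp b a = gpd_comp e.
Proof. by rewrite /gcomp; case: pselect => // e'; rewrite (Prop_irrelevance e e'). Qed.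

Lemma gid_hom x : gpd_hom (gpd_id x) x x.
Proof. by split; rewrite ?gpd_dom_id ?gpd_cod_id. Qed.

Lemma ginv_hom a x y : gpd_hom a x y -> gpd_hom (gpd_inv a) y x.
Proof. by case=> <- <-; split; rewrite ?gpd_dom_inv ?gpd_cod_inv. Qed.

Lemma gcomp_hom b a x y z : gpd_hom a x y -> gpd_hom b y z -> gpd_hom (gcomp b a) x z.
Proof.
move=> [<- ay] [bd <-]; have e : gpd_dom b = gpd_cod a by rewrite ay bd.
by rewrite (gcompE e); split; rewrite ?gpd_dom_comp ?gpd_cod_comp.
Qed.

Lemma gcompA c b a x y z w : gpd_hom a x y -> gpd_hom b y z -> gpd_hom c z w ->
  gcomp c (gcomp b a) = gcomp (gcomp c b) a.
Proof.
move=> ha hb hc.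
have eba : gpd_dom b = gpd_cod a by rewrite hb.1 ha.2.
have ecb : gpd_dom c = gpd_cod b by rewrite hc.1 hb.2.
rewrite (gcompE eba) (gcompE ecb).
have e1 : gpd_dom c = gpd_cod (gpd_comp eba) by rewrite gpd_cod_comp.
have e2 : gpd_dom (gpd_comp ecb) = gpd_cod a by rewrite gpd_dom_comp.
by rewrite (gcompE e1) (gcompE e2); apply: gpd_compA.
Qed.

Lemma gcomp1 a x y : gpd_hom a x y -> gcomp a (gpd_id x) = a.
Proof.
move=> ha; have e : gpd_dom a = gpd_cod (gpd_id x) by rewrite gpd_cod_id ha.1.
by rewrite (gcompE e) gpd_compid.
Qed.

Lemma g1comp a x y : gpd_hom a x y -> gcomp (gpd_id y) a = a.
Proof.
move=> ha; have e : gpd_dom (gpd_id y) = gpd_cod a by rewrite gpd_dom_id ha.2.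
by rewrite (gcompE e) gpd_idcomp.
Qed.

Lemma gcompV a x y : gpd_hom a x y -> gcomp a (gpd_inv a) = gpd_id y.
Proof.
move=> [_ <-]; have e : gpd_dom a = gpd_cod (gpd_inv a) by rewrite gpd_cod_inv.
by rewrite (gcompE e) gpd_compV.
Qed.

Lemma gVcomp a x y : gpd_hom a x y -> gcomp (gpd_inv a) a = gpd_id x.
Proof.
move=> [<- _]; have e : gpd_dom (gpd_inv a) = gpd_cod a by rewrite gpd_dom_inv.
by rewrite (gcompE e) gpd_Vcomp.
Qed.

Lemma gcompKV b a x y z : gpd_hom a x y -> gpd_hom b z y ->
  gcomp a (gcomp (gpd_inv a) b) = b.
Proof.
by move=> ha hb; rewrite (gcompA hb (ginv_hom ha) ha) (gcompV ha) (g1comp hb).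
Qed.

Lemma gcompVK b a x y z : gpd_hom a x y -> gpd_hom b z x ->
  gcomp (gpd_inv a) (gcomp a b) = b.
Proof.
by move=> ha hb; rewrite (gcompA hb ha (ginv_hom ha)) (gVcomp ha) (g1comp hb).
Qed.

Lemma gcomp_inj b a a' x y z : gpd_hom b y z -> gpd_hom a x y -> gpd_hom a' x y ->
  gcomp b a = gcomp b a' -> a = a'.
Proof. by move=> hb ha ha' e; rewrite -(gcompVK hb ha) e (gcompVK hb ha'). Qed.

Lemma ginv_gcomp b a x y z : gpd_hom a x y -> gpd_hom b y z ->
  gpd_inv (gcomp b a) = gcomp (gpd_inv a) (gpd_inv b).
Proof.
move=> ha hb; have hba := gcomp_hom ha hb.
have hV := gcomp_hom (ginv_hom hb) (ginv_hom ha).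
apply: (gcomp_inj hba (ginv_hom hba) hV).
by rewrite (gcompV hba) -(gcompA hV ha hb) (gcompKV ha (ginv_hom hb)) (gcompV hb).
Qed.

Lemma ginvK a : gpd_inv (gpd_inv a) = a.
Proof.
have ha : gpd_hom a (gpd_dom a) (gpd_cod a) by [].
apply: (gcomp_inj (ginv_hom ha) (ginv_hom (ginv_hom ha)) ha).
by rewrite (gcompV (ginv_hom ha)) (gVcomp ha).
Qed.

End Groupoid.

Section GroupoidFunctor.
Variables (G H : groupoid) (F : gpd_functor G H).

Lemma gf_hom a x y : gpd_hom a x y -> gpd_hom (gf_ar F a) (gf_ob F x) (gf_ob F y).
Proof. by case=> <- <-; split; rewrite ?gf_dom ?gf_cod. Qed.

Lemma gf_gcomp b a x y z : gpd_hom a x y -> gpd_hom b y z ->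
  gf_ar F (gcomp b a) = gcomp (gf_ar F b) (gf_ar F a).
Proof.
move=> ha hb; have e : gpd_dom b = gpd_cod a by rewrite ha.2 hb.1.
have e' : gpd_dom (gf_ar F b) = gpd_cod (gf_ar F a) by rewrite gf_dom gf_cod e.
by rewrite (gcompE e) (gcompE e') (gf_comp _ e').
Qed.

Lemma gf_ginv a : gf_ar F (gpd_inv a) = gpd_inv (gf_ar F a).
Proof.
have ha : gpd_hom a (gpd_dom a) (gpd_cod a) by [].
have hFa := gf_hom ha.
apply: (gcomp_inj hFa (gf_hom (ginv_hom ha)) (ginv_hom hFa)).
by rewrite -(gf_gcomp (ginv_hom ha) ha) (gcompV ha) (gcompV hFa) gf_id.
Qed.

End GroupoidFunctor.

Lemma rmorph_ext (R S : comPzRingType) (f g : {rmorphism R -> S}) : f =1 g -> f = g.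
Proof.
move=> /funext; case: f g => f fP [g gP] /= fg; case: _ / fg in gP *.
congr GRing.RMorphism.Pack.
case: fP gP => [[fa] [fm]] [[ga] [gm]].
by rewrite (Prop_irrelevance fa ga) (Prop_irrelevance fm gm).
Qed.

Section SheafLemmas.
Variables (K : Type) (X : gpd_presheaf K) (N : gqcoh X).

Lemma qc_map_eq (R S : small_ring K) (f g : {rmorphism R -> S}) (x : objects X R)
    (y : objects X S) (ef : psh_map f x = y) (eg : psh_map g x = y) m :
  f =1 g -> qc_map N ef m = qc_map N eg m.
Proof.
move=> /rmorph_ext fg; case: _ / fg in eg *.
by rewrite (Prop_irrelevance ef eg).
Qed.

Lemma qc_map_idE (R : small_ring K) (f : {rmorphism R -> R}) (x : objects X R)
    (e : psh_map f x = x) m : f =1 id -> qc_map N e m = m.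
Proof.
move=> f1; have ei : psh_map (idfun : {rmorphism R -> R}) x = x by rewrite psh_id.
by rewrite (qc_map_eq e ei) // qc_map_id.
Qed.

Lemma qc_map_compE (R S T : small_ring K) (g : {rmorphism S -> T})
    (f : {rmorphism R -> S}) (h : {rmorphism R -> T}) (x : objects X R)
    (y : objects X S) (z : objects X T) (ef : psh_map f x = y)
    (eg : psh_map g y = z) (eh : psh_map h x = z) m :
  (forall r, h r = g (f r)) -> qc_map N eh m = qc_map N eg (qc_map N ef m).
Proof.
move=> hE; have e : psh_map (g \o f : {rmorphism R -> T}) x = z.
  by rewrite psh_comp ef eg.
by rewrite (qc_map_eq eh e) // (qc_map_comp ef eg).
Qed.

Lemma qc_map_cart (R S : small_ring K) (f : {rmorphism R -> S}) (x : objects X R)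
    (y : objects X S) (e : psh_map f x = y) : cart f (qc_map N e).
Proof. by split; [apply: linear_semilinear | apply: qc_iso]. Qed.

Lemma gq_psi_eq (R : small_ring K) (a a' : arrows X R) (x y : objects X R)
    (h : gpd_hom a x y) (h' : gpd_hom a' x y) m :
  a = a' -> gq_psi N h m = gq_psi N h' m.
Proof. by move=> aa'; case: _ / aa' in h' *; rewrite (Prop_irrelevance h h'). Qed.

Lemma gq_psi_gcomp (R : small_ring K) (b a : arrows X R) (x y z : objects X R)
    (ha : gpd_hom a x y) (hb : gpd_hom b y z) (hc : gpd_hom (gcomp b a) x z) m :
  gq_psi N hc m = gq_psi N hb (gq_psi N ha m).
Proof.
have e : gpd_dom b = gpd_cod a by rewrite ha.2 hb.1.
have hc' : gpd_hom (gpd_comp e) x z by rewrite -(gcompE e).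
by rewrite (gq_psi_eq hc hc') ?(gcompE e) // (gq_psi_comp ha hb).
Qed.

(** The axioms state only compatibility with composition: [psi] at an identity is idempotent and
    bijective, hence the identity. *)
Lemma gq_psi_id (R : small_ring K) (a : arrows X R) (x : objects X R)
    (h : gpd_hom a x x) m : a = gpd_id x -> gq_psi N h m = m.
Proof.
move=> ax; apply: (bij_inj (gq_psi_bij N h)).
have e : gcomp a a = a by rewrite {2}ax (gcomp1 h).
have h2 : gpd_hom (gcomp a a) x x by rewrite e.
by rewrite -(gq_psi_gcomp h h h2); apply: gq_psi_eq.
Qed.

Lemma gq_psi_cart (R : small_ring K) (a : arrows X R) (x y : objects X R)
    (h : gpd_hom a x y) : cart (idfun : {rmorphism R -> R}) (gq_psi N h).
Proof.
apply: bij_cart_id => //; last exact: gq_psi_bij.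
by split=> [u v|r u]; [apply: linearD | apply: linearZ].
Qed.

End SheafLemmas.

Section Transition.
Variables (K : Type) (X Y : gpd_presheaf K) (Phi : gpd_presheaf_map X Y).
Hypothesis Pfull : forall R, gpd_full (Phi R).
Hypothesis Pfaithful : forall R, gpd_faithful (Phi R).

Lemma psh_hom (Z : gpd_presheaf K) (R S : small_ring K) (f : {rmorphism R -> S})
    (a : arrows Z R) (x y : objects Z R) :
  gpd_hom a x y -> gpd_hom (psh_map f a : arrows Z S) (psh_map f x) (psh_map f y).
Proof. exact: gf_hom. Qed.

Lemma psh_gcomp (Z : gpd_presheaf K) (R S : small_ring K) (f : {rmorphism R -> S})
    (a b : arrows Z R) (x y z : objects Z R) :
  gpd_hom a x y -> gpd_hom b y z ->
  psh_map f (gcomp b a : arrows Z R) = gcomp (psh_map f b : arrows Z S) (psh_map f a).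
Proof. exact: gf_gcomp. Qed.

Lemma psh_mapE (Z : presheaf K) (R S : small_ring K) (f g : {rmorphism R -> S})
    (x : Z R) : f =1 g -> psh_map f x = psh_map g x.
Proof. by move/rmorph_ext => ->. Qed.

Lemma psh_compE (Z : presheaf K) (R S T : small_ring K) (g : {rmorphism S -> T})
    (f : {rmorphism R -> S}) (h : {rmorphism R -> T}) (x : Z R) :
  (forall r, h r = g (f r)) -> psh_map g (psh_map f x) = psh_map h x.
Proof. by move=> hE; rewrite -psh_comp; apply: psh_mapE => r; rewrite hE. Qed.

Lemma psh_idE (Z : presheaf K) (R : small_ring K) (f : {rmorphism R -> R}) (x : Z R) :
  f =1 id -> psh_map f x = x.
Proof. by move=> f1; rewrite -[RHS]psh_id; apply: psh_mapE. Qed.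

(* An arrow Phi x -> y over T, where y is kept implicit as its codomain. *)
Record loc := Loc {
  l_ring : small_ring K;
  l_pt : objects X l_ring;
  l_ar : arrows Y l_ring;
  l_dom : gpd_dom l_ar = gf_ob (Phi l_ring) l_pt
}.

Definition l_cod (p : loc) : objects Y (l_ring p) := gpd_cod (l_ar p).

Lemma l_hom p : gpd_hom (l_ar p) (gf_ob (Phi (l_ring p)) (l_pt p)) (l_cod p).
Proof. by split=> //; apply: l_dom. Qed.

Definition transition (p q : loc) (h : {rmorphism l_ring p -> l_ring q})
    (a : arrows X (l_ring q)) : Prop :=
  gpd_hom a (psh_map h (l_pt p)) (l_pt q) /\
  gcomp (l_ar q) (gf_ar (Phi (l_ring q)) a) = psh_map h (l_ar p).

Section Existence.
Variables (p q : loc) (h : {rmorphism l_ring p -> l_ring q}).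
Hypothesis H : psh_map h (l_cod p) = l_cod q.

Lemma push_hom : gpd_hom (psh_map h (l_ar p) : arrows Y _)
  (gf_ob (Phi (l_ring q)) (psh_map h (l_pt p))) (l_cod q).
Proof. by rewrite gpm_ob_nat -H; apply: psh_hom; apply: l_hom. Qed.

Lemma transition_exists : exists a, transition h a.
Proof.
have hb := gcomp_hom push_hom (ginv_hom (l_hom q)).
have [a ha aE] := Pfull hb; exists a; split=> //.
by rewrite aE (gcompKV (l_hom q) push_hom).
Qed.

Lemma transition_unique a a' : transition h a -> transition h a' -> a = a'.
Proof.
move=> [ha aE] [ha' aE']; apply: (Pfaithful ha ha').
apply: (gcomp_inj (l_hom q) (gf_hom _ ha) (gf_hom _ ha')).
by rewrite aE aE'.
Qed.

End Existence.

Variable N : gqcoh X.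

Definition theta (p q : loc) (h : {rmorphism l_ring p -> l_ring q})
    (H : psh_map h (l_cod p) = l_cod q) (m : N (l_ring p) (l_pt p)) :
    N (l_ring q) (l_pt q) :=
  gq_psi N (svalP (cid (transition_exists H))).1 (qc_map N (erefl (psh_map h (l_pt p))) m).

(** Uniqueness of the transition arrow removes the choice made in [theta]. The point [x] is equal to
    the pushed point only through [e], which avoids transports between fibres of N. *)
Lemma thetaE (p q : loc) (h : {rmorphism l_ring p -> l_ring q})
    (H : psh_map h (l_cod p) = l_cod q) a x
    (e : psh_map h (l_pt p) = x) (ha : gpd_hom a x (l_pt q)) m :
  gcomp (l_ar q) (gf_ar (Phi (l_ring q)) a) = psh_map h (l_ar p) ->
  theta H m = gq_psi N ha (qc_map N e m).
Proof.
move=> aE; rewrite /theta; case: _ / e in ha *; apply: gq_psi_eq.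
by apply: (transition_unique (svalP (cid (transition_exists H)))); split.
Qed.

Lemma theta_cart (p q : loc) (h : {rmorphism l_ring p -> l_ring q})
    (H : psh_map h (l_cod p) = l_cod q) : cart h (theta H).
Proof.
by apply: (cart_comp (f := h) (g := idfun)) (qc_map_cart _ _) (gq_psi_cart _ _).
Qed.

Lemma thetaD (p q : loc) (h : {rmorphism l_ring p -> l_ring q})
    (H : psh_map h (l_cod p) = l_cod q) : addfun (theta H).
Proof. exact: (theta_cart H).1.1. Qed.

Lemma thetaZ (p q : loc) (h : {rmorphism l_ring p -> l_ring q})
    (H : psh_map h (l_cod p) = l_cod q) r m : theta H (r *: m) = h r *: theta H m.
Proof. exact: (theta_cart H).1.2. Qed.

Lemma theta_id (p : loc) (h : {rmorphism l_ring p -> l_ring p})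
    (H : psh_map h (l_cod p) = l_cod p) m : h =1 id -> theta H m = m.
Proof.
move=> h1; have e := psh_idE (l_pt p) h1.
rewrite (thetaE H e (gid_hom _)) ?gq_psi_id ?qc_map_idE //.
by rewrite gf_id (gcomp1 (l_hom p)) (psh_idE (l_ar p) h1).
Qed.

(** The cocycle identity: the second transition arrow composed with the pushforward of the first is
    a transition arrow for [l], hence the one for [l]. *)
Lemma theta_comp (p q r : loc) (h : {rmorphism l_ring p -> l_ring q})
    (k : {rmorphism l_ring q -> l_ring r}) (l : {rmorphism l_ring p -> l_ring r})
    (Hh : psh_map h (l_cod p) = l_cod q) (Hk : psh_map k (l_cod q) = l_cod r)
    (Hl : psh_map l (l_cod p) = l_cod r) m :
  (forall t, l t = k (h t)) -> theta Hk (theta Hh m) = theta Hl m.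
Proof.
move=> lE.
have [a [ha aE]] := transition_exists Hh; have [b [hb bE]] := transition_exists Hk.
rewrite (thetaE Hh (erefl _) ha) // (thetaE Hk (erefl _) hb) //.
have hka := psh_hom k ha.
have hba := gcomp_hom hka hb.
have e : psh_map l (l_pt p) = psh_map k (psh_map h (l_pt p)).
  by rewrite (psh_compE _ lE).
rewrite (thetaE Hl e hba).
  rewrite (gq_psi_gcomp hka hb) (qc_map_compE (erefl _) (erefl _) e m lE).
  by rewrite (gq_psi_nat ha hka (erefl _) (erefl _) (erefl _)).
rewrite (gf_gcomp _ hka hb) (gcompA (gf_hom _ hka) (gf_hom _ hb) (l_hom r)) bE.
rewrite gpm_ar_nat -(psh_compE _ lE) -aE.
by rewrite (psh_gcomp k (gf_hom _ ha) (l_hom q)).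
Qed.

End Transition.

(** * Descent along a cover by charts *)

Section KernelModule.
Variables (R : comPzRingType) (A D : lmodType R) (d : A -> D).
Hypothesis dP : lin d.

(* The vacuous abstraction makes the type depend on dP, which its module structure
   uses. *)
Definition kernel : Type := (fun _ : lin d => {a : A | d a = 0}) dP.

HB.instance Definition _ := gen_eqMixin kernel.
HB.instance Definition _ := gen_choiceMixin kernel.

Definition kval (x : kernel) : A := sval x.

Lemma kvalP (x : kernel) : d (kval x) = 0.
Proof. exact: (svalP x). Qed.

Lemma kval_inj : injective kval.
Proof. by case=> a ha [b hb] /= ab; apply: eq_exist. Qed.

Let kmk a (ha : d a = 0) : kernel := exist _ a ha.

Let kernel_D (x y : kernel) : d (kval x + kval y) = 0.
Proof. by rewrite dP.1 !kvalP addr0. Qed.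
Let kernel_Z r (x : kernel) : d (r *: kval x) = 0.
Proof. by rewrite dP.2 kvalP scaler0. Qed.
Let kernel_N (x : kernel) : d (- kval x) = 0.
Proof. by rewrite (addfN dP.1) kvalP oppr0. Qed.

Let kadd x y := kmk (kernel_D x y).
Let kzero := kmk (addf0 dP.1).
Let kopp x := kmk (kernel_N x).
Let kscale r x := kmk (kernel_Z r x).

Lemma kernel_addA : associative kadd.
Proof. by move=> x y z; apply: kval_inj; apply: addrA. Qed.
Lemma kernel_addC : commutative kadd.
Proof. by move=> x y; apply: kval_inj; apply: addrC. Qed.
Lemma kernel_add0 : left_id kzero kadd.
Proof. by move=> x; apply: kval_inj; apply: add0r. Qed.
Lemma kernel_addN : left_inverse kzero kopp kadd.
Proof. by move=> x; apply: kval_inj; apply: addNr. Qed.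

HB.instance Definition _ :=
  GRing.isZmodule.Build kernel kernel_addA kernel_addC kernel_add0 kernel_addN.

Lemma kernel_scaleA a b x : kscale a (kscale b x) = kscale (a * b) x.
Proof. by apply: kval_inj; apply: scalerA. Qed.
Lemma kernel_scale1 : left_id 1 kscale.
Proof. by move=> x; apply: kval_inj; apply: scale1r. Qed.
Lemma kernel_scaleDr : right_distributive kscale +%R.
Proof. by move=> a x y; apply: kval_inj; apply: scalerDr. Qed.
Lemma kernel_scaleDl x : {morph kscale^~ x : a b / a + b}.
Proof. by move=> a b; apply: kval_inj; apply: scalerDl. Qed.

HB.instance Definition _ := GRing.Zmodule_isLmodule.Build R kernel
  kernel_scaleA kernel_scale1 kernel_scaleDr kernel_scaleDl.

Lemma kval_exact : exact_at kval d.
Proof.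
move=> a; split=> [da|[x <-]]; last exact: kvalP.
by exists (kmk da).
Qed.

End KernelModule.

Section SmallTensorMaps.
Variables (K : Type) (infK : infinite_set [set: K]).
Variables (R S : small_ring K) (f : {rmorphism R -> S}).

Section One.
Variables (T : small_ring K) (g : {rmorphism R -> T}).

Definition tinl : {rmorphism S -> small_tensor infK f g} := inl_ring f g.
Definition tinr : {rmorphism T -> small_tensor infK f g} := inr_ring f g.

Lemma tsquare r : tinl (f r) = tinr (g r).
Proof. exact: tensor_ring_square. Qed.

Variables (C : small_ring K) (a : {rmorphism S -> C}) (b : {rmorphism T -> C}).
Hypothesis ab : forall r, a (f r) = b (g r).

Definition tpair : {rmorphism small_tensor infK f g -> C} :=
  sval (cid (tensor_ring_universal ab)).

Lemma tpair_inl s : tpair (tinl s) = a s.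
Proof. exact: (svalP (cid (tensor_ring_universal ab))).1. Qed.
Lemma tpair_inr t : tpair (tinr t) = b t.
Proof. exact: (svalP (cid (tensor_ring_universal ab))).2. Qed.

(** Stated for a composite, which is the shape of the side condition of [th_comp]. *)
Lemma small_tensor_ext (B : small_ring K)
    (l : {rmorphism small_tensor infK f g -> C})
    (h : {rmorphism small_tensor infK f g -> B}) (k : {rmorphism B -> C}) :
  (forall s, l (tinl s) = k (h (tinl s))) -> (forall t, l (tinr t) = k (h (tinr t))) ->
  forall x, l x = k (h x).
Proof. exact: (@tensor_ring_rmorph_ext _ _ _ _ _ _ l (k \o h)). Qed.

End One.

Section Functoriality.
Variables (T T' : small_ring K) (g : {rmorphism R -> T}) (g' : {rmorphism R -> T'}).
Variables (h : {rmorphism T -> T'}).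
Hypothesis gh : forall r, g' r = h (g r).

Lemma tmap_subproof r : tinl g' (f r) = (tinr g' \o h) (g r).
Proof. by rewrite tsquare gh. Qed.

Definition tmap : {rmorphism small_tensor infK f g -> small_tensor infK f g'} :=
  tpair tmap_subproof.

Lemma tmap_inl s : tmap (tinl g s) = tinl g' s.
Proof. exact: tpair_inl. Qed.
Lemma tmap_inr t : tmap (tinr g t) = tinr g' (h t).
Proof. exact: tpair_inr. Qed.

End Functoriality.

End SmallTensorMaps.

Arguments tinl : simpl never.
Arguments tinr : simpl never.
Arguments tpair : simpl never.
Arguments tmap : simpl never.

(** * Charts and the Cech complex of a family of charts *)

Section Charts.
Variables (K : Type) (infK : infinite_set [set: K]).
Variables (X Y : gpd_presheaf K) (Phi : gpd_presheaf_map X Y).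
Hypothesis Pfull : forall R, gpd_full (Phi R).
Hypothesis Pfaithful : forall R, gpd_faithful (Phi R).
Variable N : gqcoh X.

Local Notation loc := (loc Phi).
Local Notation theta := (@theta _ _ _ Phi Pfull N _ _).
Local Notation "N [ p ]" := (gq_qcoh N (l_ring p) (l_pt p)) (at level 8, format "N [ p ]").

Lemma push_dom (p : loc) (T : small_ring K) (h : {rmorphism l_ring p -> T}) :
  gpd_dom (psh_map h (l_ar p) : arrows Y T) = gf_ob (Phi T) (psh_map h (l_pt p)).
Proof. by rewrite gpm_ob_nat; apply: (psh_hom h (l_hom p)).1. Qed.

Definition push (p : loc) (T : small_ring K) (h : {rmorphism l_ring p -> T}) : loc :=
  Loc (push_dom h).

Lemma push_cod (p : loc) (T : small_ring K) (h : {rmorphism l_ring p -> T}) :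
  l_cod (push h) = psh_map h (l_cod p).
Proof. exact: (psh_hom h (l_hom p)).2. Qed.

Record chart (R : small_ring K) (y : objects Y R) := Chart {
  ch_loc :> loc;
  ch_map : {rmorphism R -> l_ring ch_loc};
  ch_cod : psh_map ch_map y = l_cod ch_loc
}.

Section Base.
Variables (R : small_ring K) (y : objects Y R).

Definition chart_over (c c' : chart y) (h : {rmorphism l_ring c -> l_ring c'}) : Prop :=
  forall r, ch_map c' r = h (ch_map c r).

Lemma over_cod (c c' : chart y) (h : {rmorphism l_ring c -> l_ring c'}) :
  chart_over h -> psh_map h (l_cod c) = l_cod c'.
Proof. by move=> hP; rewrite -ch_cod -ch_cod (psh_compE _ hP). Qed.

Definition chart_theta (c c' : chart y) (h : {rmorphism l_ring c -> l_ring c'})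
    (hP : chart_over h) : N[c] -> N[c'] := theta (over_cod hP).

Local Notation th := chart_theta.

Lemma tens_cod (S : small_ring K) (f : {rmorphism R -> S}) (c : chart y) :
  psh_map (tinr infK f (ch_map c) \o ch_map c : {rmorphism R -> _}) y =
  l_cod (push (tinr infK f (ch_map c))).
Proof. by rewrite push_cod psh_comp ch_cod. Qed.

(* The chart S (x)_R T, with the pulled back point of X, for c a chart over T. *)
Definition tens (S : small_ring K) (f : {rmorphism R -> S}) (c : chart y) : chart y :=
  @Chart R y (push (tinr infK f (ch_map c))) _ (tens_cod f c).

Variables (n : nat) (c : 'I_n -> chart y).
Local Notation f i := (ch_map (c i)).

(** The point of X on an overlap comes from the second chart. Restriction from the first chart
    therefore involves a genuine transition arrow, and this is how full faithfulness provides the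
    descent datum. *)
Definition ovl (ij : 'I_n * 'I_n) : chart y := tens (f ij.1) (c ij.2).

Lemma over_inr (S : small_ring K) (g : {rmorphism R -> S}) (c' : chart y) :
  @chart_over c' (tens g c') (tinr infK g (ch_map c')).
Proof. by []. Qed.

Lemma over_inl (c' c'' : chart y) :
  @chart_over c' (tens (ch_map c') c'') (tinl infK (ch_map c') (ch_map c'')).
Proof. by move=> r; rewrite tsquare. Qed.

Lemma over_tmap (S : small_ring K) (g : {rmorphism R -> S}) (c' c'' : chart y)
    (h : {rmorphism l_ring c' -> l_ring c''}) (hP : chart_over h) :
  @chart_over (tens g c') (tens g c'') (tmap infK g hP).
Proof. by move=> r; rewrite /= tmap_inr hP. Qed.

Lemma th_comp (c1 c2 c3 : chart y) (h : {rmorphism l_ring c1 -> l_ring c2})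
    (k : {rmorphism l_ring c2 -> l_ring c3}) (l : {rmorphism l_ring c1 -> l_ring c3})
    (hP : chart_over h) (kP : chart_over k) (lP : chart_over l) m :
  (forall t, l t = k (h t)) -> th kP (th hP m) = th lP m.
Proof. exact: theta_comp. Qed.

Lemma th_id (c1 : chart y) (h : {rmorphism l_ring c1 -> l_ring c1}) (hP : chart_over h) m :
  h =1 id -> th hP m = m.
Proof. exact: theta_id. Qed.

Lemma th_cart (c1 c2 : chart y) (h : {rmorphism l_ring c1 -> l_ring c2})
    (hP : chart_over h) : cart h (th hP).
Proof. exact: theta_cart. Qed.

Lemma thD (c1 c2 : chart y) (h : {rmorphism l_ring c1 -> l_ring c2})
    (hP : chart_over h) : addfun (th hP).
Proof. exact: thetaD. Qed.

Lemma thZ (c1 c2 : chart y) (h : {rmorphism l_ring c1 -> l_ring c2})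
    (hP : chart_over h) r m : th hP (r *: m) = h r *: th hP m.
Proof. exact: thetaZ. Qed.

Definition cochain0 : lmodType R := prodm (fun i => restr (f i) N[c i]).
Definition cochain1 : lmodType R := prodm (fun ij => restr (ch_map (ovl ij)) N[ovl ij]).

Definition coboundary (m : cochain0) : cochain1 := fun ij =>
  th (over_inr (f ij.1) (c ij.2)) (m ij.2) - th (over_inl (c ij.1) (c ij.2)) (m ij.1).

Lemma coboundary_lin : lin coboundary.
Proof.
split=> [a b|r a]; apply/prodmP => ij; rewrite /coboundary !(prodm_addE, prodm_scaleE).
  by rewrite !thD opprD addrACA.
by rewrite !restr_scaleE !thZ tsquare -scalerBr.
Qed.

Lemma coboundary_eq0 m : coboundary m = 0 <-> forall i j,
  th (over_inr (f i) (c j)) (m j) = th (over_inl (c i) (c j)) (m i).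
Proof.
split=> [/prodmP m0 i j|m0]; first by apply/subr0_eq/(m0 (i, j)).
by apply/prodmP => -[i j]; apply/eqP; rewrite subr_eq0; apply/eqP/m0.
Qed.

Section Localized.
Variable k : 'I_n.

(** The Cech complex base changed to [S_k], realised by values of N at charts over [S_k (x) S_i] and
    [S_k (x) (S_i (x) S_j)] instead of by formal tensor products. *)
Definition cochain0_at : lmodType (l_ring (c k)) :=
  prodm (fun i => restr (tinl infK (f k) (f i)) N[tens (f k) (c i)]).
Definition cochain1_at : lmodType (l_ring (c k)) :=
  prodm (fun ij => restr (tinl infK (f k) (ch_map (ovl ij))) N[tens (f k) (ovl ij)]).

Definition coboundary_at (m : cochain0_at) : cochain1_at := fun ij =>
  th (over_tmap (f k) (over_inr (f ij.1) (c ij.2))) (m ij.2) -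
  th (over_tmap (f k) (over_inl (c ij.1) (c ij.2))) (m ij.1).

Definition augment_at (v : N[c k]) : cochain0_at := fun i => th (over_inl (c k) (c i)) v.

Lemma coboundary_at_lin : lin coboundary_at.
Proof.
split=> [a b|r a]; apply/prodmP => ij; rewrite /coboundary_at !(prodm_addE, prodm_scaleE).
  by rewrite !thD opprD addrACA.
by rewrite !restr_scaleE !thZ !tmap_inl -scalerBr.
Qed.

Lemma augment_at_lin : lin augment_at.
Proof.
split=> [a b|r a]; apply/prodmP => i; first exact: thD.
exact: thZ.
Qed.

Lemma mult_subproof r : (idfun : {rmorphism _ -> _}) (f k r) = (idfun : {rmorphism _ -> _}) (f k r).
Proof. by []. Qed.

Definition mult : {rmorphism l_ring (tens (f k) (c k)) -> l_ring (c k)} :=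
  tpair infK mult_subproof.

Lemma over_mult : chart_over mult.
Proof. by move=> r; rewrite /mult /= tpair_inr. Qed.

(** The component at [k] already suffices: multiplication [S_k (x) S_k -> S_k] is a retraction of
    [tinl]. *)
Lemma augment_at_inj : injective augment_at.
Proof.
apply: (addf_inj augment_at_lin.1) => v /prodmP/(_ k) v0.
have over_id : @chart_over (c k) (c k) idfun by [].
rewrite -[v](th_id over_id) // -(th_comp (over_inl (c k) (c k)) over_mult) => [|t].
  by rewrite [th _ v]v0 (addf0 (thD _)).
by rewrite /mult tpair_inl.
Qed.

(* The contracting homotopy is induced by a (x) b |-> ab : S_k (x) S_k -> S_k. *)
Lemma coboundary_at_exact : exact_at augment_at coboundary_at.
Proof.
move=> m; split=> [/prodmP m0|[v <-]]; last first.
  apply/prodmP => -[i j]; apply/eqP; rewrite subr_eq0; apply/eqP.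
  have over_inl3 := over_inl (c k) (ovl (i, j)).
  rewrite /augment_at (th_comp _ _ over_inl3) => [|t]; last by rewrite tmap_inl.
  by rewrite (th_comp _ _ over_inl3) // => t; rewrite tmap_inl.
exists (th over_mult (m k)); apply/prodmP => i; rewrite /augment_at.
have nu_subproof r : tinl infK (f k) (f i) (f k r) =
    (idfun : {rmorphism _ -> _}) (ch_map (ovl (k, i)) r) by rewrite tsquare.
(* [nu] multiplies the first two factors of [S_k (x) S_k (x) S_i]. Along it the cocycle condition at
   [(k, i)] says that [m i] is the restriction of the witness. *)
pose nu : {rmorphism l_ring (tens (f k) (ovl (k, i))) -> l_ring (tens (f k) (c i))} :=
  tpair infK nu_subproof.
have over_nu : chart_over nu by move=> r; rewrite /nu /= tpair_inr.
have /(congr1 (th over_nu)) : th (over_tmap (f k) (over_inr (f k) (c i))) (m i) =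
  th (over_tmap (f k) (over_inl (c k) (c i))) (m k) by apply/subr0_eq/(m0 (k, i)).
have over_id : @chart_over (tens (f k) (c i)) (tens (f k) (c i)) idfun by [].
rewrite (th_comp _ _ over_id); last first.
  apply: small_tensor_ext => t /=.
    by rewrite tmap_inl /nu tpair_inl.
  by rewrite tmap_inr /nu tpair_inr.
have over_l : @chart_over (tens (f k) (c k)) (tens (f k) (c i))
    (tinl infK (f k) (f i) \o mult) by move=> r; rewrite /= /mult tpair_inr tsquare.
rewrite th_id // (th_comp (over_tmap (f k) (over_inl (c k) (c i))) over_nu over_l);
  last first.
  apply: small_tensor_ext => t /=.
    by rewrite tmap_inl /mult /nu !tpair_inl.
  by rewrite tmap_inr /mult /nu !tpair_inr.
by move=> ->; rewrite (th_comp _ _ over_l).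
Qed.

Definition localize0 (m : cochain0) : cochain0_at := fun i =>
  th (over_inr (f k) (c i)) (m i).
Definition localize1 (m : cochain1) : cochain1_at := fun ij =>
  th (over_inr (f k) (ovl ij)) (m ij).

Lemma localize0_cart : cart (f k) localize0.
Proof.
apply: (@cart_prodm _ _ (f k) _ (fun i => restr (f i) N[c i])
  (fun i => restr (tinl infK (f k) (f i)) N[tens (f k) (c i)])
  (fun i => th (over_inr (f k) (c i)))) => i.
exact: (@cart_restr _ _ _ (f k) (f i) N[c i] N[tens (f k) (c i)] _
  (th_cart (over_inr (f k) (c i)))).
Qed.

Lemma localize1_cart : cart (f k) localize1.
Proof.
apply: (@cart_prodm _ _ (f k) _ (fun ij => restr (ch_map (ovl ij)) N[ovl ij])
  (fun ij => restr (tinl infK (f k) (ch_map (ovl ij))) N[tens (f k) (ovl ij)])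
  (fun ij => th (over_inr (f k) (ovl ij)))) => ij.
exact: (@cart_restr _ _ _ (f k) (ch_map (ovl ij)) N[ovl ij] N[tens (f k) (ovl ij)] _
  (th_cart (over_inr (f k) (ovl ij)))).
Qed.

Lemma coboundary_localize (m : cochain0) :
  coboundary_at (localize0 m) = localize1 (coboundary m).
Proof.
apply/prodmP => ij.
have over_j : @chart_over (c ij.2) (tens (f k) (ovl ij))
    (tinr infK (f k) (ch_map (ovl ij)) \o tinr infK (f ij.1) (f ij.2)) by [].
have over_i : @chart_over (c ij.1) (tens (f k) (ovl ij))
    (tinr infK (f k) (ch_map (ovl ij)) \o tinl infK (f ij.1) (f ij.2)).
  by move=> r; rewrite /= tsquare.
rewrite /coboundary_at /localize1 /coboundary (addfB (thD _)).
rewrite (th_comp _ _ over_j) => [|t]; last by rewrite tmap_inr.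
rewrite (th_comp _ _ over_i) => [|t]; last by rewrite tmap_inr.
by rewrite (th_comp _ _ over_j) // (th_comp _ _ over_i).
Qed.

(* The kernel of the coboundary is compared with the value at the chart c k
   after base change along the flat map f k, where the complex splits. *)
Lemma kernel_cart : flat (f k) ->
  cart (f k) (fun m : kernel coboundary_lin => kval m k : N[c k]).
Proof.
move=> fF; apply: (@flat_kernel _ _ (f k) (kernel coboundary_lin) cochain0 cochain1
  N[c k] cochain0_at cochain1_at (@kval _ _ _ _ coboundary_lin) coboundary
  augment_at coboundary_at _
  localize0 localize1) => //.
- exact: coboundary_lin.
- exact: augment_at_lin.
- exact: coboundary_at_lin.
- exact: kval_inj.
- exact: kval_exact.
- exact: augment_at_inj.
- exact: coboundary_at_exact.
- exact: localize0_cart.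
- exact: localize1_cart.
- move=> m; apply/prodmP => i; rewrite /augment_at /localize0.
  by have /coboundary_eq0 -> := kvalP m.
- exact: coboundary_localize.
Qed.

End Localized.

End Base.

Lemma base_cod (p : loc) : psh_map (idfun : {rmorphism l_ring p -> l_ring p}) (l_cod p) = l_cod p.
Proof. exact: psh_id. Qed.

(** Viewing [p] as a chart of its own codomain makes [th_comp] available for maps out of [p]. *)
Definition base_chart (p : loc) : chart (l_cod p) := Chart (base_cod p).

Section Glue.
Local Notation th := chart_theta.
Variables (p : loc) (n : nat) (c : 'I_n -> chart (l_cod p)).
Local Notation f i := (ch_map (c i)).
Hypothesis fJ : reflects_exactness (fun i => f i).

Lemma over_base i : @chart_over _ _ (base_chart p) (c i) (f i).
Proof. by []. Qed.

Lemma separated (v : N[p]) : (forall i, theta (ch_cod (c i)) v = 0) -> v = 0.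
Proof.
move=> v0; apply: (reflects_zero fJ (phi := fun i => theta (ch_cod (c i)))) => // i.
exact: theta_cart.
Qed.

(** Exactness of the augmented Cech complex of N over [p] is tested after base change to each [c k],
    where the complex splits. *)
Lemma glue_charts (m : forall i, N[c i]) :
  (forall i j, th (over_inr (f i) (c j)) (m j) = th (over_inl (c i) (c j)) (m i)) ->
  exists v : N[p], forall i, theta (ch_cod (c i)) v = m i.
Proof.
pose augment (v : N[p]) : cochain0 c := fun i => theta (ch_cod (c i)) v.
have augP : lin augment.
  by split=> [a b|r a]; apply/prodmP => i; [apply: thetaD | apply: thetaZ].
have aug_th v i : augment v i = th (over_base i) v.
  congr (theta _ v); exact: Prop_irrelevance.
have ex : exact_at augment (@coboundary _ _ _ c).
  apply: (reflects_exact fJ (g' := fun k => @augment_at _ _ _ c k)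
    (h' := fun k => @coboundary_at _ _ _ c k)
    (phi1 := fun k v => augment v k)
    (phi2 := fun k => @localize0 _ _ _ c k) (phi3 := fun k => @localize1 _ _ _ c k)) => //.
  - exact: coboundary_lin.
  - exact: augment_at_lin.
  - exact: coboundary_at_lin.
  - by move=> k; apply: theta_cart.
  - exact: localize0_cart.
  - exact: localize1_cart.
  - move=> k v; apply/prodmP => i; rewrite /augment_at /localize0 !aug_th.
    have over_i : @chart_over _ _ (base_chart p) (tens (f k) (c i))
      (tinr infK (f k) (f i) \o f i) by [].
    rewrite (th_comp _ _ over_i) => [|t]; first by rewrite (th_comp _ _ over_i).
    by rewrite tsquare.
  - by move=> k v; rewrite coboundary_localize.
  - exact: coboundary_at_exact.
move=> mE; have [v vm] : exists v, augment v = m by apply/ex/coboundary_eq0.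
by exists v => i; rewrite -vm.
Qed.

End Glue.

End Charts.

(** * From the product ring of a cover to its members *)

Section FaithfullyFlatFamily.
Variables (R : comPzRingType) (n : nat) (S : 'I_n -> comPzRingType).
Variable f : forall i, {rmorphism R -> S i}.
Local Notation pf := (product_map f : {rmorphism R -> product_ring S}).

Definition prod_inj (i : 'I_n) (s : S i) : product_ring S := dfwith (fun i => 0 : S i) s.

Lemma prod_inj_in i (s : S i) : prod_inj s i = s.
Proof. exact: dfwith_in. Qed.

Lemma prod_inj_out i (s : S i) j : i != j -> prod_inj s j = 0.
Proof. exact: dfwith_out. Qed.

Lemma product_sumE J (r : seq J) (F : J -> product_ring S) i :
  (\sum_(j <- r) F j) i = \sum_(j <- r) F j i.
Proof. by apply: (big_morph (fun x : product_ring S => x i)). Qed.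

Lemma product_decomp (s : product_ring S) : s = \sum_i prod_inj (s i).
Proof.
apply/functional_extensionality_dep => j; rewrite product_sumE (bigD1 j) //= prod_inj_in.
by rewrite big1 ?addr0 // => i ij; rewrite prod_inj_out.
Qed.

Section Components.
Variables (M : lmodType R) (i : 'I_n).

Definition comp_proj : basechange pf M -> basechange (f i) M :=
  tlift (fun (s : product_ring S) m => tensor (f i) (s i) m).
Definition comp_inj : basechange (f i) M -> basechange pf M :=
  tlift (fun s m => tensor pf (prod_inj s) m).

Lemma comp_proj_balanced :
  balanced pf (fun (s : product_ring S) (m : M) => tensor (f i) (s i) m).
Proof.
split=> [s t m|s m m'|s r m]; [exact: tensorDl | exact: tensorDr |].
by rewrite tensorZr.
Qed.

Lemma comp_inj_balanced : balanced (f i) (fun s (m : M) => tensor pf (prod_inj s) m).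
Proof.
split=> [s t m|s m m'|s r m]; [rewrite -tensorDl | exact: tensorDr | rewrite tensorZr].
  congr tensor; apply/functional_extensionality_dep => j.
  change (prod_inj (s + t) j = prod_inj s j + prod_inj t j).
  have [<-|ij] := eqVneq i j; first by rewrite !prod_inj_in.
  by rewrite !prod_inj_out // addr0.
congr tensor; apply/functional_extensionality_dep => j.
change (prod_inj (s * f i r) j = prod_inj s j * f j r).
have [<-|ij] := eqVneq i j; first by rewrite !prod_inj_in.
by rewrite !prod_inj_out // mul0r.
Qed.

Lemma comp_projD : addfun comp_proj. Proof. exact/tliftD/comp_proj_balanced. Qed.
Lemma comp_injD : addfun comp_inj. Proof. exact/tliftD/comp_inj_balanced. Qed.
Lemma comp_proj_tensor s m : comp_proj (tensor pf s m) = tensor (f i) (s i) m.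
Proof. by rewrite /comp_proj tlift_tensor //; apply: comp_proj_balanced. Qed.
Lemma comp_inj_tensor s m : comp_inj (tensor (f i) s m) = tensor pf (prod_inj s) m.
Proof. by rewrite /comp_inj tlift_tensor //; apply: comp_inj_balanced. Qed.

End Components.

Lemma comp_proj_nat (M M' : lmodType R) (g : {linear M -> M'}) i x :
  comp_proj i (basechange_map pf g x) = basechange_map (f i) g (comp_proj i x).
Proof.
move: x; apply: tensor_ext.
- by move=> x y; rewrite linearD comp_projD.
- by move=> x y; rewrite comp_projD linearD.
- by move=> s m; rewrite basechange_map_tensor !comp_proj_tensor basechange_map_tensor.
Qed.

Lemma comp_inj_nat (M M' : lmodType R) (g : {linear M -> M'}) i x :
  comp_inj (basechange_map (f i) g x) = basechange_map pf g (comp_inj x).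
Proof.
move: x; apply: tensor_ext.
- by move=> x y; rewrite linearD comp_injD.
- by move=> x y; rewrite comp_injD linearD.
- by move=> s m; rewrite basechange_map_tensor !comp_inj_tensor basechange_map_tensor.
Qed.

Lemma comp_decomp (M : lmodType R) (x : basechange pf M) :
  x = \sum_i comp_inj (comp_proj i x).
Proof.
move: x; apply: tensor_ext; first exact: addf_id.
  move=> x y; rewrite -big_split; apply: eq_bigr => i _.
  by rewrite comp_projD comp_injD.
move=> s m; rewrite [in LHS](product_decomp s).
under [RHS]eq_bigr => i _ do rewrite comp_proj_tensor comp_inj_tensor.
exact: (addf_sum (h := fun s : product_ring S => tensor pf s m) (fun s t => tensorDl pf s t m)).
Qed.

(** Base change to the product is naturally the direct sum of the base changes to the factors, so
    exactness can be checked factor by factor. *)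
Lemma faithfully_flat_reflects : faithfully_flat pf -> reflects_exactness f.
Proof.
move=> ff M1 M2 M3 g h ex; apply/ff => y; split=> [hy|[x <-]].
  have : forall i, exists x, basechange_map (f i) g x = comp_proj i y.
    by move=> i; apply/ex; rewrite -comp_proj_nat hy (addf0 (@comp_projD _ i)).
  move=> xP; exists (\sum_i comp_inj (sval (cid (xP i)))).
  rewrite linear_sum /= [RHS]comp_decomp; apply: eq_bigr => i _.
  by rewrite -comp_inj_nat (svalP (cid (xP i))).
rewrite [LHS]comp_decomp big1 // => i _; rewrite !comp_proj_nat.
have /ex -> : exists x', basechange_map (f i) g x' = basechange_map (f i) g (comp_proj i x).
  by exists (comp_proj i x).
exact: (addf0 (@comp_injD _ i)).
Qed.

End FaithfullyFlatFamily.

(** * The descended module and its evaluation at all charts *)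

Section Descent.
Variables (K : Type) (infK : infinite_set [set: K]).
Variables (X Y : gpd_presheaf K) (Phi : gpd_presheaf_map X Y).
Hypothesis Pfull : forall R, gpd_full (Phi R).
Hypothesis Pfaithful : forall R, gpd_faithful (Phi R).
Variable N : gqcoh X.

Local Notation loc := (loc Phi).
Local Notation theta := (@theta _ _ _ Phi Pfull N _ _).
Local Notation "N [ p ]" := (gq_qcoh N (l_ring p) (l_pt p)) (at level 8, format "N [ p ]").
Local Notation th := (@chart_theta _ _ _ Phi Pfull N _ _ _ _ _).
Local Notation chart := (@chart _ _ _ Phi _).

Lemma comp_cod (p q r : loc) (h : {rmorphism l_ring p -> l_ring q})
    (k : {rmorphism l_ring q -> l_ring r}) :
  psh_map h (l_cod p) = l_cod q -> psh_map k (l_cod q) = l_cod r ->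
  psh_map (k \o h : {rmorphism l_ring p -> l_ring r}) (l_cod p) = l_cod r.
Proof. by move=> Hh Hk; rewrite psh_comp Hh. Qed.

Lemma theta_compC (p q r : loc) (h : {rmorphism l_ring p -> l_ring q})
    (k : {rmorphism l_ring q -> l_ring r})
    (Hh : psh_map h (l_cod p) = l_cod q) (Hk : psh_map k (l_cod q) = l_cod r) m :
  theta Hk (theta Hh m) = theta (comp_cod Hh Hk) m.
Proof. exact: theta_comp. Qed.

Lemma theta_eq (p q : loc) (h k : {rmorphism l_ring p -> l_ring q})
    (Hh : psh_map h (l_cod p) = l_cod q) (Hk : psh_map k (l_cod p) = l_cod q) m :
  h =1 k -> theta Hh m = theta Hk m.
Proof.
move=> /rmorph_ext hk; case: _ / hk in Hk *.
by rewrite (Prop_irrelevance Hh Hk).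
Qed.

Section Evaluation.
Variables (R : small_ring K) (y : objects Y R) (n : nat) (c : 'I_n -> chart y).
Local Notation f i := (ch_map (c i)).
Hypothesis fJ : reflects_exactness (fun i => f i).
Hypothesis fF : forall i, flat (f i).

Definition descent : lmodType R := kernel (coboundary_lin infK Pfull N c).

Section AtChart.
Variable b : chart y.
Local Notation g := (ch_map b).

Lemma cover_cod i : psh_map (tinr infK (f i) g) (l_cod b) =
  l_cod (push (tinl infK (f i) g)).
Proof.
rewrite push_cod -!ch_cod -!psh_comp; apply: psh_mapE => r /=.
exact/esym/tsquare.
Qed.

(** The ring is that of [tens (f i) b], but the point of X comes from [c i] and not from [b]. The
    two charts are later compared by [theta] along the identity ring map. *)
Definition cover_at i : chart (l_cod b) :=
  @Chart _ _ _ Phi _ (l_cod b) (push (tinl infK (f i) g)) _ (cover_cod i).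

Lemma cover_at_reflects : reflects_exactness (fun i => ch_map (cover_at i)).
Proof. exact: reflects_exactness_base_change fJ. Qed.

Lemma from_cover_cod i :
  psh_map (tinl infK (f i) g : {rmorphism l_ring (c i) -> l_ring (cover_at i)})
    (l_cod (c i)) = l_cod (cover_at i).
Proof. exact/esym/push_cod. Qed.

Definition from_cover i (m : N[c i]) : N[cover_at i] := theta (from_cover_cod i) m.
Definition from_chart i (v : N[b]) : N[cover_at i] := theta (ch_cod (cover_at i)) v.

Lemma from_cover_cart i : cart (tinl infK (f i) g) (from_cover (i := i)).
Proof. exact: theta_cart. Qed.

Lemma from_chart_cart i : cart (tinr infK (f i) g) (from_chart i).
Proof. exact: theta_cart. Qed.

(* The value at an arbitrary chart b over T is glued along the cover of T by the
   S_i (x) T. *)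
Lemma ev_exists (m : descent) :
  exists v : N[b], forall i, from_chart i v = from_cover (kval m i).
Proof.
apply: (glue_charts Pfaithful cover_at_reflects (m := fun i => from_cover (kval m i))) => i j.
rewrite /from_cover /chart_theta !theta_compC.
set Z := tens infK _ _.
(* With T the ring of [b], [w] is the canonical map from [S_i (x)_R S_j] to
   [(S_i (x)_R T) (x)_T (S_j (x)_R T)]. The cocycle condition on [m], carried along [w], is the
   required gluing condition. *)
have w_subproof r :
    (tinl infK (ch_map (cover_at i)) (ch_map (cover_at j)) \o tinl infK (f i) g) (f i r) =
    (tinr infK (ch_map (cover_at i)) (ch_map (cover_at j)) \o tinl infK (f j) g) (f j r).
  transitivity (tinl infK (ch_map (cover_at i)) (ch_map (cover_at j)) (tinr infK (f i) g (g r))).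
    by congr (tinl infK (ch_map (cover_at i)) (ch_map (cover_at j)) _); apply: tsquare.
  transitivity (tinr infK (ch_map (cover_at i)) (ch_map (cover_at j)) (tinr infK (f j) g (g r))).
    exact: tsquare.
  by congr (tinr infK (ch_map (cover_at i)) (ch_map (cover_at j)) _); apply/esym/tsquare.
pose w := tpair infK w_subproof : {rmorphism l_ring (ovl infK c (i, j)) -> l_ring Z}.
have Hw : psh_map w (l_cod (ovl infK c (i, j))) = l_cod Z.
  rewrite [X in psh_map w X](push_cod (tinr infK (f i) (f j))).
  rewrite [RHS](push_cod (tinr infK (ch_map (cover_at i)) (ch_map (cover_at j)))).
  transitivity (psh_map (tinr infK (ch_map (cover_at i)) (ch_map (cover_at j)) \o
    tinl infK (f j) g) (l_cod (c j))).
    by apply: psh_compE => t; rewrite /w tpair_inr.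
  by rewrite psh_comp; congr psh_map; apply/esym/push_cod.
have /coboundary_eq0/(_ i j)/(congr1 (theta Hw)) := kvalP m.
rewrite /chart_theta !theta_compC => e.
transitivity (theta (comp_cod (over_cod (over_inr infK (f i) (c j))) Hw) (kval m j)).
  by apply: theta_eq => t; rewrite /= [RHS]tpair_inr.
by rewrite e; apply: theta_eq => t; rewrite /= tpair_inl.
Qed.

Definition ev (m : descent) : N[b] := sval (cid (ev_exists m)).

Lemma evP m i : from_chart i (ev m) = from_cover (kval m i).
Proof. exact: (svalP (cid (ev_exists m))). Qed.

Lemma chart_separated (v w : N[b]) :
  (forall i, from_chart i v = from_chart i w) -> v = w.
Proof.
move=> vw; apply/eqP; rewrite -subr_eq0; apply/eqP.
apply: (separated (c := cover_at)) cover_at_reflects _ _ => // i.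
have := vw i; rewrite /from_chart => vwi.
by rewrite (addfB (thetaD _ (ch_cod (cover_at i)))) vwi subrr.
Qed.

Lemma ev_semilin : semilin g ev.
Proof.
split=> [m m'|r m]; apply: chart_separated => i.
  by rewrite (from_chart_cart i).1.1 !evP -(from_cover_cart i).1.1.
rewrite (from_chart_cart i).1.2 !evP -tsquare -(from_cover_cart i).1.2.
by [].
Qed.

(** Locally over [S_i (x) T], evaluation becomes the projection of the kernel to [N(c i)] followed
    by restriction, and both are base changes. *)
Lemma ev_cart : cart g ev.
Proof.
apply: (cart_local (b := fun i => ch_map (cover_at i))
  (hb := fun i => tinl infK (f i) g \o f i) (v := from_chart)) => //.
- exact: cover_at_reflects.
- by move=> i r; rewrite /= tsquare.
- exact: ev_semilin.
- exact: from_chart_cart.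
- move=> i; have -> : (fun m => from_chart i (ev m)) = (fun m => from_cover (kval m i)).
    by apply/funext => m; rewrite evP.
  apply: (cart_comp (f := f i) (g := tinl infK (f i) g)) => //.
    exact: kernel_cart.
  exact: from_cover_cart.
Qed.

End AtChart.

Lemma ev_compat (b b' : chart y) (h : {rmorphism l_ring b -> l_ring b'})
    (hP : chart_over h) m : th hP (ev b m) = ev b' m.
Proof.
apply: chart_separated => i; rewrite evP.
have Hw : psh_map (tmap infK (f i) hP :
    {rmorphism l_ring (cover_at b i) -> l_ring (cover_at b' i)}) (l_cod (cover_at b i)) =
    l_cod (cover_at b' i).
  rewrite -(from_cover_cod b i) -(from_cover_cod b' i).
  by apply: psh_compE => t; rewrite tmap_inl.
have := congr1 (theta Hw) (evP b m i).
rewrite /from_chart /from_cover /chart_theta !theta_compC => e.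
transitivity (theta (comp_cod (ch_cod (cover_at b i)) Hw) (ev b m)).
  by apply: theta_eq => t; rewrite /= tmap_inr.
by rewrite e; apply: theta_eq => t; rewrite /= tmap_inl.
Qed.

(** The cocycle conditions at [(j, i)] say that [kval m i] has the property characterising
    [ev (c i) m]. Hence evaluations determine an element. *)
Lemma ev_cover m i : ev (c i) m = kval m i.
Proof.
apply: chart_separated => j; rewrite evP.
have /coboundary_eq0/(_ j i) e := kvalP m.
have Hw : psh_map (idfun : {rmorphism l_ring (ovl infK c (j, i)) ->
    l_ring (cover_at (c i) j)}) (l_cod (ovl infK c (j, i))) =
    l_cod (cover_at (c i) j).
  rewrite psh_id -(from_cover_cod (c i) j).
  exact/esym/(over_cod (over_inl infK (c j) (c i))).
have := congr1 (theta Hw) e; rewrite /from_cover /from_chart /chart_theta !theta_compC => {}e.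
transitivity (theta (comp_cod (over_cod (over_inl infK (c j) (c i))) Hw) (kval m j)).
  exact: theta_eq.
by rewrite -e; apply: theta_eq.
Qed.

Lemma ev_ext (m m' : descent) : (forall b, ev b m = ev b m') -> m = m'.
Proof.
move=> mm'; apply: kval_inj; apply/prodmP => i.
by have := mm' (c i); rewrite !ev_cover.
Qed.

Lemma ev_realize (v : forall b : chart y, N[b]) :
  (forall (b b' : chart y) (h : {rmorphism l_ring b -> l_ring b'}) (hP : chart_over h),
    th hP (v b) = v b') ->
  exists m, forall b, ev b m = v b.
Proof.
move=> vP; pose m0 : cochain0 N c := fun i => v (c i).
have m0P : coboundary infK Pfull m0 = 0 by apply/coboundary_eq0 => i j; rewrite !vP.
have [m mE] := (kval_exact (coboundary_lin infK Pfull N c) m0).1 m0P.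
exists m => b; apply: chart_separated => i; rewrite evP mE /m0.
have over_l : @chart_over _ _ _ _ _ _ (c i) (tens infK (f i) b) (tinl infK (f i) (ch_map b)).
  exact: over_inl.
have Hw : psh_map (idfun : {rmorphism l_ring (tens infK (f i) b) ->
    l_ring (cover_at b i)}) (l_cod (tens infK (f i) b)) =
    l_cod (cover_at b i).
  rewrite psh_id -(from_cover_cod b i).
  exact/esym/(over_cod over_l).
have e : th over_l (v (c i)) = th (over_inr infK (f i) b) (v b) by rewrite !vP.
have := congr1 (theta Hw) e; rewrite /from_cover /from_chart /chart_theta !theta_compC => {}e.
transitivity (theta (comp_cod (over_cod over_l) Hw) (v (c i))); first exact: theta_eq.
by rewrite e; apply: theta_eq.
Qed.

End Evaluation.

Hypothesis Pcover : forall (R : small_ring K) (y : objects Y R),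
  sheaf_ess_image (@flat_cover K) Phi y.

(** An arrow from [Phi x] to the restriction of [y] along a member of the cover is a chart of
    [y]. *)
Lemma charts_exist (R : small_ring K) (y : objects Y R) :
  exists (n : nat) (c : 'I_n -> chart y),
    reflects_exactness (fun i => ch_map (c i)) /\ forall i, flat (ch_map (c i)).
Proof.
have [U [Uflat Uff] Uess] := Pcover y.
have data i : {xb : objects X (@fam_ring K R U i) * arrows Y (@fam_ring K R U i) |
    gpd_hom xb.2 (gf_ob (Phi (@fam_ring K R U i)) xb.1) (psh_map (@fam_map K R U i) y)}.
  by apply: cid; have [x [b hb]] := Uess i; exists (x, b).
pose c i : chart y := @Chart _ _ _ Phi _ y
  (@Loc _ _ _ Phi _ (sval (data i)).1 (sval (data i)).2 (svalP (data i)).1)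
  (@fam_map K R U i) (esym (svalP (data i)).2).
exists (fam_size U), c; split; last exact: Uflat.
exact: faithfully_flat_reflects.
Qed.

End Descent.

Lemma lin_inverse (R : comPzRingType) (M N : lmodType R) (h : M -> N) (k : N -> M) :
  lin h -> cancel h k -> cancel k h -> lin k.
Proof.
move=> hP hK kK; split=> [x y|r x]; apply: (can_inj hK).
  by rewrite hP.1 !kK.
by rewrite hP.2 !kK.
Qed.

Section NaturalIso.
Variables (C D : category) (F G : functor C D).

Lemma naturally_isomorphic_sym : naturally_isomorphic F G -> naturally_isomorphic G F.
Proof.
move=> [t [s [tn st ts]]]; exists s, t; split=> // x y u.
by rewrite -[LHS]cat_compid -ts cat_compA -[cat_comp (cat_comp (s y) _) _]cat_compA
  -tn cat_compA st cat_idcomp.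
Qed.

Lemma pointwise_iso (t : forall x, cat_hom (F x) (G x)) :
  (forall x y (u : cat_hom x y), cat_comp (t y) (fun_hom F u) = cat_comp (fun_hom G u) (t x)) ->
  (forall x, exists s : cat_hom (G x) (F x),
    cat_comp s (t x) = cat_id (F x) /\ cat_comp (t x) s = cat_id (G x)) ->
  naturally_isomorphic F G.
Proof.
move=> tn iso; exists t, (fun x => sval (cid (iso x))).
by split=> // x; [apply: (svalP (cid (iso x))).1 | apply: (svalP (cid (iso x))).2].
Qed.

End NaturalIso.

Lemma gqcoh_map_iso (K : Type) (Z : gpd_presheaf K) (M N : gqcoh Z) (t : gqcoh_map M N) :
  (forall R (x : objects Z R), bijective (t R x)) ->
  exists s : gqcoh_map N M, gqcoh_comp s t = gqcoh_id M /\ gqcoh_comp t s = gqcoh_id N.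
Proof.
move=> tB.
have inv R (x : objects Z R) : {k : N R x -> M R x | cancel (t R x) k /\ cancel k (t R x)}.
  by apply: cid; have [k kK Kk] := tB R x; exists k.
pose k R x := sval (inv R x).
have tK R x : cancel (t R x) (k R x) := (svalP (inv R x)).1.
have kK R x : cancel (k R x) (t R x) := (svalP (inv R x)).2.
have kP R x : lin (k R x) by apply: lin_inverse (linear_lin (t R x)) (tK R x) (kK R x).
have kn (R S : small_ring K) (f : {rmorphism R -> S}) (x : objects Z R) (y : objects Z S)
    (e : psh_map f x = y) m : bundle (kP S y) (qc_map N e m) = qc_map M e (bundle (kP R x) m).
  by apply: (can_inj (tK S y)); rewrite /= kK (qm_nat t e) kK.
pose s0 : qcoh_map N M := QcohMap kn.
have ks (R : small_ring K) (a : arrows Z R) (x y : objects Z R) (h : gpd_hom a x y) m :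
    s0 R y (gq_psi N h m) = gq_psi M h (s0 R x m).
  by apply: (can_inj (tK R y)); rewrite /= kK (gm_psi t h) kK.
exists (GqcohMap ks); split; apply: gqcoh_map_eq => R x m /=; [exact: tK | exact: kK].
Qed.

Section Inverse.
Variables (K : Type) (infK : infinite_set [set: K]).
Variables (X Y : gpd_presheaf K) (Phi : gpd_presheaf_map X Y).
Hypothesis Pfull : forall R, gpd_full (Phi R).
Hypothesis Pfaithful : forall R, gpd_faithful (Phi R).
Hypothesis Pcover : forall (R : small_ring K) (y : objects Y R),
  sheaf_ess_image (@flat_cover K) Phi y.

Local Notation loc := (loc Phi).
Local Notation chart := (@chart _ _ _ Phi _).
Local Notation th N := (@chart_theta _ _ _ Phi Pfull N _ _ _ _ _).

(** * The inverse functor *)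

(* A small model for the module of compatible families indexed by all charts of y,
   which itself would live in too large a universe. *)
Record descent_data (N : gqcoh X) (R : small_ring K) (y : objects Y R) := DescentData {
  dd_mod :> lmodType R;
  dd_ev : forall b : chart y, dd_mod -> gq_qcoh N (l_ring b) (l_pt b);
  dd_cart : forall b, cart (ch_map b) (dd_ev b);
  dd_compat : forall (b b' : chart y) (h : {rmorphism l_ring b -> l_ring b'})
    (hP : chart_over h) m, th N hP (dd_ev b m) = dd_ev b' m;
  dd_ext : forall m m', (forall b, dd_ev b m = dd_ev b m') -> m = m';
  dd_realize : forall v : (forall b : chart y, gq_qcoh N (l_ring b) (l_pt b)),
    (forall (b b' : chart y) (h : {rmorphism l_ring b -> l_ring b'})
      (hP : chart_over h), th N hP (v b) = v b') ->
    exists m, forall b, dd_ev b m = v b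
}.

Lemma descent_data_exists N R (y : objects Y R) : exists d : descent_data N y, True.
Proof.
have [n [c [cJ cF]]] := charts_exist Pcover y.
unshelve eexists => //.
apply: (@DescentData N R y (descent infK Pfull N c) (ev Pfaithful cJ)).
- exact: ev_cart.
- exact: ev_compat.
- exact: ev_ext.
- exact: ev_realize.
Qed.

Definition descended N R (y : objects Y R) : descent_data N y :=
  sval (cid (descent_data_exists N y)).

(** Stands in for equality of charts, which are dependent records: it suffices that the arrows agree
    and the structure maps agree pointwise. *)
Lemma same_ev N R (y : objects Y R) (T : small_ring K) (x : objects X T)
    (b b' : arrows Y T) (D : gpd_dom b = gf_ob (Phi T) x)
    (D' : gpd_dom b' = gf_ob (Phi T) x) (g g' : {rmorphism R -> T})
    (C : psh_map g y = l_cod (@Loc _ _ _ Phi T x b D))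
    (C' : psh_map g' y = l_cod (@Loc _ _ _ Phi T x b' D')) (d : descent_data N y) m :
  b = b' -> g =1 g' ->
  dd_ev (d := d) (@Chart _ _ _ Phi R y (@Loc _ _ _ Phi T x b D) g C) m =
  dd_ev (d := d) (@Chart _ _ _ Phi R y (@Loc _ _ _ Phi T x b' D') g' C') m.
Proof.
move=> bb' /rmorph_ext gg'; case: _ / bb' in D' C' *; case: _ / gg' in C' *.
rewrite (Prop_irrelevance D' D) in C' *.
by rewrite (Prop_irrelevance C C').
Qed.

Section Pull.
Variables (R S : small_ring K) (f : {rmorphism R -> S}) (y : objects Y R) (z : objects Y S).
Hypothesis fyz : psh_map f y = z.

Lemma pull_cod (b : chart z) :
  psh_map (ch_map b \o f : {rmorphism R -> _}) y = l_cod b.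
Proof. by rewrite psh_comp fyz ch_cod. Qed.

Definition pull (b : chart z) : chart y := Chart (pull_cod b).

Variable N : gqcoh X.

Lemma pull_exists (m : descended N y) : exists m' : descended N z,
  forall b, dd_ev b m' = dd_ev (pull b) m.
Proof.
apply: (@dd_realize _ _ _ (descended N z) (fun b => dd_ev (pull b) m)) => b b' h hP.
have hP' : @chart_over _ _ _ _ _ y (pull b) (pull b') h by move=> r; rewrite /= hP.
rewrite -(dd_compat hP'); exact: theta_eq.
Qed.

Definition dd_pull (m : descended N y) : descended N z := sval (cid (pull_exists m)).

Lemma dd_pullE m b : dd_ev b (dd_pull m) = dd_ev (pull b) m.
Proof. exact: (svalP (cid (pull_exists m))). Qed.

Lemma dd_pull_semilin : semilin f dd_pull.
Proof.
split=> [m m'|r m]; apply: dd_ext => b.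
  by rewrite (dd_cart _ b).1.1 !dd_pullE (dd_cart _ (pull b)).1.1.
by rewrite (dd_cart _ b).1.2 !dd_pullE (dd_cart _ (pull b)).1.2.
Qed.

(** Only a cover of [z] is used: evaluating at a chart of [z] after [dd_pull] is evaluating at the
    same chart viewed over [y], and both evaluations are base changes. *)
Lemma dd_pull_cart : cart f dd_pull.
Proof.
have [n [c [cJ _]]] := charts_exist Pcover z.
apply: (cart_local (b := fun i => ch_map (c i)) (hb := fun i => ch_map (c i) \o f)
  (v := fun i => dd_ev (c i)) cJ) => //.
- exact: dd_pull_semilin.
- by move=> i; apply: dd_cart.
- move=> i; have -> : (fun m => dd_ev (c i) (dd_pull m)) = (fun m => dd_ev (pull (c i)) m).
    by apply/funext => m; rewrite dd_pullE.
  exact: (dd_cart _ (pull (c i))).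
Qed.

End Pull.

Section Relabel.
Variables (R : small_ring K) (a : arrows Y R) (y z : objects Y R).
Hypothesis ha : gpd_hom a y z.

Section Chart.
Variable b : chart z.

Lemma ch_hom : gpd_hom (l_ar b) (gf_ob (Phi (l_ring b)) (l_pt b)) (psh_map (ch_map b) z).
Proof. by rewrite ch_cod; apply: l_hom. Qed.

(** Composing with the inverse of [a] turns a chart of [z] into a chart of [y] while keeping its
    point of X, so both evaluations take values in the same module. *)
Definition relabel_ar : arrows Y (l_ring b) :=
  gcomp (gpd_inv (psh_map (ch_map b) a : arrows Y (l_ring b))) (l_ar b).

Lemma relabel_hom : gpd_hom relabel_ar (gf_ob (Phi (l_ring b)) (l_pt b))
  (psh_map (ch_map b) y).
Proof. exact: gcomp_hom ch_hom (ginv_hom (psh_hom (ch_map b) ha)). Qed.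

Definition relabel : chart y :=
  @Chart _ _ _ Phi R y (@Loc _ _ _ Phi (l_ring b) (l_pt b) relabel_ar relabel_hom.1)
    (ch_map b) (esym relabel_hom.2).

End Chart.

Variable N : gqcoh X.

(** The inverse of [a] appears on both sides of the equation defining a transition arrow, so the
    same arrow of X serves before and after relabelling. *)
Lemma relabel_theta (b b' : chart z) (h : {rmorphism l_ring b -> l_ring b'})
    (hP : chart_over h) (hP' : @chart_over _ _ _ _ _ y (relabel b) (relabel b') h) m :
  th N hP' m = th N hP m.
Proof.
have [t [ht tE]] := transition_exists Pfull (over_cod hP).
rewrite /chart_theta (thetaE Pfull Pfaithful (over_cod hP) (erefl _) ht) //.
apply: (thetaE Pfull Pfaithful (over_cod hP') (erefl _) ht).
have hPt := gf_hom (Phi (l_ring b')) ht.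
have hb := ch_hom b; have hb' := ch_hom b'.
have hab := ginv_hom (psh_hom (ch_map b) ha).
have hab' := ginv_hom (psh_hom (ch_map b') ha).
rewrite -[RHS]/(psh_map h (relabel_ar b)) (psh_gcomp h hb hab) -tE.
rewrite -[LHS]/(gcomp (gcomp _ _) _) -(gcompA hPt hb' hab'); congr gcomp.
rewrite -[RHS]/(gf_ar (gp_map Y h) _) gf_ginv; congr gpd_inv.
by rewrite -(psh_compE a hP).
Qed.

Lemma relabel_exists (m : descended N y) : exists m' : descended N z,
  forall b, dd_ev b m' = dd_ev (relabel b) m.
Proof.
apply: (@dd_realize _ _ _ (descended N z) (fun b => dd_ev (relabel b) m)) => b b' h hP.
have hP' : @chart_over _ _ _ _ _ y (relabel b) (relabel b') h by move=> r; rewrite /= hP.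
by rewrite -(dd_compat hP') (relabel_theta hP hP').
Qed.

Definition dd_relabel (m : descended N y) : descended N z := sval (cid (relabel_exists m)).

Lemma dd_relabelE m b : dd_ev b (dd_relabel m) = dd_ev (relabel b) m.
Proof. exact: (svalP (cid (relabel_exists m))). Qed.

Lemma dd_relabel_lin : lin dd_relabel.
Proof.
split=> [m m'|r m]; apply: dd_ext => b.
  by rewrite (dd_cart _ b).1.1 !dd_relabelE (dd_cart _ (relabel b)).1.1.
by rewrite (dd_cart _ b).1.2 !dd_relabelE (dd_cart _ (relabel b)).1.2.
Qed.

End Relabel.

Section InverseObject.
Variable N : gqcoh X.

Lemma dd_pull_id (R : small_ring K) (y : objects Y R)
    (e : psh_map (idfun : {rmorphism R -> R}) y = y) (m : descended N y) : dd_pull e m = m.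
Proof.
apply: dd_ext => b; rewrite dd_pullE; case: b => -[T x b D] g C.
by rewrite /pull /=; apply: (@same_ev N R y T x b b D D).
Qed.

Lemma dd_pull_comp (R S T : small_ring K) (g : {rmorphism S -> T})
    (f : {rmorphism R -> S}) (x : objects Y R) (y : objects Y S) (z : objects Y T)
    (ef : psh_map f x = y) (eg : psh_map g y = z)
    (egf : psh_map (g \o f : {rmorphism R -> T}) x = z) (m : descended N x) :
  dd_pull egf m = dd_pull eg (dd_pull ef m).
Proof.
apply: dd_ext => b; rewrite !dd_pullE; case: b => -[U u b D] k C.
by rewrite /pull /=; apply: (@same_ev N R x U u b b D D).
Qed.

Definition inverse_qcoh : qcoh (objects Y) :=
  @Qcoh K (objects Y) (fun R y => descended N y)
    (fun R S f x y e => slinear (dd_pull_semilin e N)) dd_pull_id dd_pull_comp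
    (fun R S f x y e => (dd_pull_cart e N).2).

Lemma dd_relabel_comp (R : small_ring K) (b a c : arrows Y R) (x y z : objects Y R)
    (ha : gpd_hom a x y) (hb : gpd_hom b y z) (hc : gpd_hom c x z) (m : descended N x) :
  c = gcomp b a -> dd_relabel hc m = dd_relabel hb (dd_relabel ha m).
Proof.
move=> cE; apply: dd_ext => d; rewrite !dd_relabelE; apply: same_ev => //.
have hd := ch_hom d; have hda := psh_hom (ch_map d) ha; have hdb := psh_hom (ch_map d) hb.
rewrite /relabel_ar cE (psh_gcomp (ch_map d) ha hb) (ginv_gcomp hda hdb).
by rewrite -(gcompA hd (ginv_hom hdb) (ginv_hom hda)).
Qed.

Lemma dd_relabel_id (R : small_ring K) (a : arrows Y R) (y : objects Y R)
    (ha : gpd_hom a y y) (m : descended N y) : a = gpd_id y -> dd_relabel ha m = m.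
Proof.
move=> aE; apply: dd_ext => d; rewrite dd_relabelE; case: d => -[T x b D] g C.
rewrite /relabel /=; apply: (@same_ev N R y T x _ b _ D) => //; rewrite /relabel_ar /=.
have hb : gpd_hom b (gf_ob (Phi T) x) (psh_map g y) by rewrite C; split.
rewrite aE (gf_id (gp_map Y g)).
have hi := gid_hom (psh_map g y).
have -> : gpd_inv (gpd_id (gf_ob (gp_map Y g) y)) = gpd_id (psh_map g y).
  by have := gcompV hi; rewrite (g1comp (ginv_hom hi)).
exact: g1comp hb.
Qed.

Lemma dd_relabel_bij (R : small_ring K) (a : arrows Y R) (y z : objects Y R)
    (ha : gpd_hom a y z) : bijective (@dd_relabel R a y z ha N).
Proof.
have hV := ginv_hom ha.
exists (@dd_relabel R _ z y hV N) => m.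
  have e := gVcomp ha; have hi : gpd_hom (gcomp (gpd_inv a) a) y y by rewrite e; apply: gid_hom.
  by rewrite -(dd_relabel_comp ha hV hi) // dd_relabel_id.
have e := gcompV ha; have hi : gpd_hom (gcomp a (gpd_inv a)) z z by rewrite e; apply: gid_hom.
by rewrite -(dd_relabel_comp hV ha hi) // dd_relabel_id.
Qed.

Lemma dd_relabel_nat (R S : small_ring K) (f : {rmorphism R -> S})
    (a : arrows Y R) (b : arrows Y S) (x y : objects Y R) (x' y' : objects Y S)
    (ha : gpd_hom a x y) (hb : gpd_hom b x' y') (e : psh_map f a = b)
    (ex : psh_map f x = x') (ey : psh_map f y = y') (m : descended N x) :
  dd_relabel hb (dd_pull ex m) = dd_pull ey (dd_relabel ha m).
Proof.
apply: dd_ext => d; rewrite dd_relabelE !dd_pullE dd_relabelE.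
apply: same_ev => //; rewrite /relabel_ar -e.
by congr (gcomp (gpd_inv _) _); rewrite -(psh_comp (ch_map d) f a).
Qed.

Lemma dd_relabel_gpd_comp (R : small_ring K) (b a : arrows Y R) (x y z : objects Y R)
    (ha : gpd_hom a x y) (hb : gpd_hom b y z) (e : gpd_dom b = gpd_cod a)
    (hc : gpd_hom (gpd_comp e) x z) (m : descended N x) :
  dd_relabel hc m = dd_relabel hb (dd_relabel ha m).
Proof. by apply: dd_relabel_comp; rewrite (gcompE e). Qed.

Definition inverse_ob : gqcoh Y :=
  @Gqcoh K Y inverse_qcoh (fun R a x y h => bundle (dd_relabel_lin h N))
    dd_relabel_bij dd_relabel_nat dd_relabel_gpd_comp.

End InverseObject.

Section InverseMap.
Variables (N N' : gqcoh X) (t : gqcoh_map N N').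

Lemma inverse_map_exists (R : small_ring K) (y : objects Y R) (m : descended N y) :
  exists m' : descended N' y, forall b, dd_ev b m' = t _ _ (dd_ev b m).
Proof.
apply: (@dd_realize _ _ _ (descended N' y) (fun b => t _ _ (dd_ev b m))) => b b' h hP.
rewrite -(dd_compat hP); have [a [ha aE]] := transition_exists Pfull (over_cod hP).
rewrite /chart_theta !(thetaE Pfull Pfaithful (over_cod hP) (erefl _) ha) //.
by rewrite -(qm_nat t) -(gm_psi t).
Qed.

Definition inverse_map_fun (R : small_ring K) (y : objects Y R) (m : descended N y) :
    descended N' y :=
  sval (cid (inverse_map_exists m)).

Lemma inverse_map_funE (R : small_ring K) (y : objects Y R) (m : descended N y) b :
  dd_ev b (inverse_map_fun m) = t _ _ (dd_ev b m).
Proof. exact: (svalP (cid (inverse_map_exists m))). Qed.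

Lemma inverse_map_lin (R : small_ring K) (y : objects Y R) : lin (@inverse_map_fun R y).
Proof.
split=> [m m'|r m]; apply: dd_ext => b.
  by rewrite (dd_cart _ b).1.1 !inverse_map_funE (dd_cart _ b).1.1 linearD.
by rewrite (dd_cart _ b).1.2 !inverse_map_funE (dd_cart _ b).1.2 linearZ.
Qed.

Lemma inverse_map_nat (R S : small_ring K) (f : {rmorphism R -> S}) (x : objects Y R)
    (y : objects Y S) (e : psh_map f x = y) (m : descended N x) :
  inverse_map_fun (dd_pull e m) = dd_pull e (inverse_map_fun m).
Proof. by apply: dd_ext => b; rewrite inverse_map_funE !dd_pullE inverse_map_funE. Qed.

Lemma inverse_map_psi (R : small_ring K) (a : arrows Y R) (x y : objects Y R)
    (h : gpd_hom a x y) (m : descended N x) :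
  inverse_map_fun (dd_relabel h m) = dd_relabel h (inverse_map_fun m).
Proof. by apply: dd_ext => b; rewrite inverse_map_funE !dd_relabelE inverse_map_funE. Qed.

Definition inverse_map : gqcoh_map (inverse_ob N) (inverse_ob N') :=
  @GqcohMap K Y (inverse_ob N) (inverse_ob N')
    (@QcohMap K _ (inverse_ob N) (inverse_ob N')
      (fun R y => bundle (@inverse_map_lin R y)) inverse_map_nat) inverse_map_psi.

End InverseMap.

Lemma inverse_map_id (N : gqcoh X) : inverse_map (gqcoh_id N) = gqcoh_id (inverse_ob N).
Proof. by apply: gqcoh_map_eq => R y m; apply: dd_ext => b; rewrite /= inverse_map_funE. Qed.

Lemma inverse_map_comp (L M N : gqcoh X) (t : gqcoh_map M N) (s : gqcoh_map L M) :
  inverse_map (gqcoh_comp t s) = gqcoh_comp (inverse_map t) (inverse_map s).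
Proof.
by apply: gqcoh_map_eq => R y m; apply: dd_ext => b; rewrite /= !inverse_map_funE.
Qed.

Definition inverse_functor : functor (ShQc X) (ShQc Y) :=
  @Functor (ShQc X) (ShQc Y) inverse_ob inverse_map inverse_map_id
    (fun x y z v u => inverse_map_comp v u).

(** * The counit: the inverse functor followed by pullback *)

Section Counit.
Variable N : gqcoh X.

Lemma unit_dom (R : small_ring K) (x : objects X R) :
  gpd_dom (gpd_id (gf_ob (Phi R) x)) = gf_ob (Phi R) x.
Proof. exact: gpd_dom_id. Qed.

Lemma unit_cod (R : small_ring K) (x : objects X R) :
  psh_map (idfun : {rmorphism R -> R}) (gf_ob (Phi R) x : objects Y R) =
  l_cod (@Loc _ _ _ Phi R x _ (unit_dom x)).
Proof. by rewrite psh_id /l_cod /= gpd_cod_id. Qed.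

(** The identity arrow of [Phi x] is a chart over R itself. Its structure map is the identity, so
    evaluation there is bijective, which gives the counit. *)
Definition unit_chart (R : small_ring K) (x : objects X R) :
  chart (gf_ob (Phi R) x : objects Y R) :=
  @Chart _ _ _ Phi R _ (@Loc _ _ _ Phi R x _ (unit_dom x)) _ (unit_cod x).

Definition counit_fun (R : small_ring K) (x : objects X R)
    (m : descended N (gf_ob (Phi R) x : objects Y R)) : N R x := dd_ev (unit_chart x) m.

Lemma counit_lin (R : small_ring K) (x : objects X R) : lin (@counit_fun R x).
Proof.
by case: (dd_cart (descended N _) (unit_chart x)) => -[D Z] _;
  split=> [m m'|r m]; rewrite /counit_fun ?D ?Z.
Qed.

Lemma counit_bij (R : small_ring K) (x : objects X R) : bijective (@counit_fun R x).
Proof. exact: cart_id_bij (dd_cart _ (unit_chart x)). Qed.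

Lemma counit_nat (R S : small_ring K) (f : {rmorphism R -> S}) (x : objects X R)
    (y : objects X S) (e : psh_map f x = y) (m : descended N (gf_ob (Phi R) x : objects Y R)) :
  counit_fun (dd_pull (gpm_point Phi e) m) = qc_map N e (counit_fun m).
Proof.
rewrite /counit_fun dd_pullE.
have hP : @chart_over _ _ _ _ _ _ (unit_chart x) (pull (gpm_point Phi e) (unit_chart y)) f.
  by [].
rewrite -(dd_compat hP) /chart_theta.
rewrite (thetaE Pfull Pfaithful (over_cod hP) e (gid_hom y)) ?gq_psi_id //.
rewrite gf_id /= (gf_id (gp_map Y f)) (gcomp1 (gid_hom _)); congr gpd_id.
by rewrite -(gpm_point Phi e).
Qed.

Lemma counit_psi (R : small_ring K) (a : arrows X R) (x y : objects X R)
    (h : gpd_hom a x y) (m : descended N (gf_ob (Phi R) x : objects Y R)) :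
  counit_fun (dd_relabel (gpm_hom Phi h) m) = gq_psi N h (counit_fun m).
Proof.
rewrite /counit_fun dd_relabelE.
have hP : @chart_over _ _ _ _ _ _ (unit_chart x) (relabel (gpm_hom Phi h) (unit_chart y)) idfun.
  by [].
rewrite -(dd_compat hP) /chart_theta.
(* The transition arrow is [a] itself: relabelling contributes the inverse of [Phi a], which cancels
   [Phi a]. *)
rewrite (thetaE Pfull Pfaithful (over_cod hP) (psh_id _) h) ?qc_map_idE //.
have hPa := gpm_hom Phi h.
rewrite [RHS]gp_ar_id /= /relabel_ar /= gp_ar_id.
by rewrite (gcomp1 (ginv_hom hPa)) (gVcomp hPa).
Qed.

Definition counit : gqcoh_map (pullback_ob Phi (inverse_ob N)) N :=
  @GqcohMap K X (pullback_ob Phi (inverse_ob N)) N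
    (@QcohMap K _ (pullback_ob Phi (inverse_ob N)) N
      (fun R x => bundle (@counit_lin R x)) counit_nat) counit_psi.

End Counit.

(** * The unit: pullback followed by the inverse functor *)

Section Unit.
Variable M : gqcoh Y.

(** A chart [Phi x -> y] over T gives a value at [x] by restricting [m] to T and transporting it
    back along the inverse arrow. *)
Definition local_value (R : small_ring K) (y : objects Y R) (b : chart y) (m : M R y) :
    gq_qcoh (pullback_ob Phi M) (l_ring b) (l_pt b) :=
  gq_psi M (ginv_hom (l_hom b)) (qc_map M (ch_cod b) m).

Lemma local_value_cart (R : small_ring K) (y : objects Y R) (b : chart y) :
  cart (ch_map b) (@local_value R y b).
Proof.
exact: (cart_comp (f := ch_map b) (g := idfun)) (qc_map_cart _ _) (gq_psi_cart _ _).
Qed.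

Lemma unit_exists (R : small_ring K) (y : objects Y R) (m : M R y) :
  exists m' : descended (pullback_ob Phi M) y, forall b, dd_ev b m' = local_value b m.
Proof.
apply: (@dd_realize _ _ _ (descended (pullback_ob Phi M) y) (fun b => local_value b m)).
move=> b b' h hP; have [a [ha aE]] := transition_exists Pfull (over_cod hP).
rewrite /chart_theta (thetaE Pfull Pfaithful (over_cod hP) (erefl _) ha) //.
rewrite /local_value /=.
have hV : gpd_hom (psh_map h (gpd_inv (l_ar b) : arrows Y _) : arrows Y (l_ring b'))
    (l_cod b') (gf_ob (Phi (l_ring b')) (psh_map h (l_pt b))).
  rewrite -(over_cod hP) gpm_ob_nat; exact: psh_hom (ginv_hom (l_hom b)).
rewrite -(gq_psi_nat (ginv_hom (l_hom b)) hV (erefl _) (over_cod hP)).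
rewrite -(qc_map_compE (ch_cod b) (over_cod hP) (ch_cod b') m hP).
(* The transition equation, solved for the inverse of [l_ar b'], writes it as [Phi a] composed with
   the pushforward of the inverse of [l_ar b]. *)
pose hPa := gpm_hom Phi ha.
have hc := gcomp_hom hV hPa.
apply: etrans (esym (gq_psi_gcomp hV hPa hc _)) _; apply: gq_psi_eq.
have hVV := ginv_hom (l_hom b').
rewrite -(gcompVK (l_hom b') hc) (gcompA hV hPa (l_hom b')) aE.
have hb := l_hom b; rewrite -(psh_gcomp h (ginv_hom hb) hb) (gcompV hb).
by rewrite [psh_map _ _](gf_id (gp_map Y h)) [gf_ob _ _](over_cod hP) (gcomp1 hVV).
Qed.

Definition unit_fun (R : small_ring K) (y : objects Y R) (m : M R y) :
  descended (pullback_ob Phi M) y := sval (cid (unit_exists m)).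

Lemma unit_funE (R : small_ring K) (y : objects Y R) (m : M R y) b :
  dd_ev b (unit_fun m) = local_value b m.
Proof. exact: (svalP (cid (unit_exists m))). Qed.

Lemma unit_lin (R : small_ring K) (y : objects Y R) : lin (@unit_fun R y).
Proof.
split=> [m m'|r m]; apply: dd_ext => b.
  by rewrite (dd_cart _ b).1.1 !unit_funE (local_value_cart b).1.1.
by rewrite (dd_cart _ b).1.2 !unit_funE (local_value_cart b).1.2.
Qed.

(** Over each chart of a cover, both sides are base changes to the same module, through
    [local_value] and [dd_ev]. So the unit is a base change along the identity, that is, a
    bijection. *)
Lemma unit_bij (R : small_ring K) (y : objects Y R) : bijective (@unit_fun R y).
Proof.
have [n [c [cJ _]]] := charts_exist Pcover y.
apply: (@cart_id_bij _ idfun) => //.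
apply: (cart_local (b := fun i => ch_map (c i)) (hb := fun i => ch_map (c i))
  (v := fun i => dd_ev (c i)) cJ) => //.
- exact: unit_lin.
- by move=> i; apply: dd_cart.
- move=> i; have -> : (fun m => dd_ev (c i) (unit_fun m)) = local_value (c i).
    by apply/funext => m; rewrite unit_funE.
  exact: local_value_cart.
Qed.

Lemma unit_nat (R S : small_ring K) (f : {rmorphism R -> S}) (x : objects Y R)
    (y : objects Y S) (e : psh_map f x = y) (m : M R x) :
  unit_fun (qc_map M e m) = dd_pull e (unit_fun m).
Proof.
apply: dd_ext => b; rewrite dd_pullE !unit_funE /local_value.
by rewrite -(qc_map_compE e (ch_cod b) (ch_cod (pull e b))).
Qed.

Lemma unit_psi (R : small_ring K) (a : arrows Y R) (x y : objects Y R)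
    (h : gpd_hom a x y) (m : M R x) :
  unit_fun (gq_psi M h m) = dd_relabel h (unit_fun m).
Proof.
apply: dd_ext => b; rewrite dd_relabelE !unit_funE /local_value.
have hga := psh_hom (ch_map b) h.
have hgy : gpd_hom (psh_map (ch_map b) a : arrows Y _) (l_cod (relabel h b)) (l_cod b).
  by rewrite -(ch_cod b) -(ch_cod (relabel h b)).
rewrite -(gq_psi_nat h hgy (erefl _) (ch_cod (relabel h b)) (ch_cod b)).
have hc := gcomp_hom hgy (ginv_hom (l_hom b)).
rewrite -(gq_psi_gcomp hgy (ginv_hom (l_hom b)) hc).
have e : gcomp (gpd_inv (l_ar b)) (psh_map (ch_map b) a) = gpd_inv (l_ar (relabel h b)).
  by rewrite [RHS](ginv_gcomp (ch_hom b) (ginv_hom hga)) ginvK.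
exact: (gq_psi_eq hc (ginv_hom (l_hom (relabel h b))) _ e).
Qed.

Definition unit_map : gqcoh_map M (inverse_ob (pullback_ob Phi M)) :=
  @GqcohMap K Y M (inverse_ob (pullback_ob Phi M))
    (@QcohMap K _ M (inverse_ob (pullback_ob Phi M))
      (fun R x => bundle (@unit_lin R x)) unit_nat) unit_psi.

End Unit.

Lemma pullback_equivalence : equivalence_of_categories (pullback Phi).
Proof.
exists inverse_functor; split.
  apply: naturally_isomorphic_sym.
  apply: (@pointwise_iso _ _ (id_functor _) (comp_functor inverse_functor (pullback Phi)) unit_map).
    move=> M M' t; apply: gqcoh_map_eq => R y m; apply: dd_ext => b.
    rewrite /= unit_funE inverse_map_funE unit_funE /local_value /=.
    by rewrite -(qm_nat t) -(gm_psi t).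
  by move=> M; apply: gqcoh_map_iso; apply: unit_bij.
apply: (@pointwise_iso _ _ (comp_functor (pullback Phi) inverse_functor) (id_functor _) counit).
  move=> N N' t; apply: gqcoh_map_eq => R x m.
  by rewrite /= /counit_fun inverse_map_funE.
by move=> N; apply: gqcoh_map_iso; apply: counit_bij.
Qed.

End Inverse.

Theorem theorem3 (K : Type) (infK : infinite_set [set: K])
    (X Y : gpd_presheaf K) (Phi : gpd_presheaf_map X Y) :
  internal_equivalence (@flat_cover K) Phi ->
  equivalence_of_categories (pullback Phi).
Proof. by case=> full faithful cover; apply: pullback_equivalence. Qed.
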